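(* Let $\Lambda$ be lacunary, and let $\phi:[0,1]\to[0,1]$ be a Borel function with $\operatorname{ess\,sup}_{[0,1]}\phi=1$ whose set of essential points of maximum is finite, $\mathfrak{M}_\phi=\{x_1,\dots,x_k\}$, and with $\phi=1$ on $\mathfrak{M}_\phi$. (i) If $D_-^i>0$ and $D_+^s<0$ on $\mathfrak{M}_\phi$, then $C_\phi:M^2_\Lambda\to L^2$ is bounded. (ii) If $D_-^i=+\infty$ and $D_+^s=-\infty$ on $\mathfrak{M}_\phi$, then $C_\phi:M^2_\Lambda\to L^2$ is compact. (iii) If for some $\varepsilon>0$, $\beta>1$ and constant $c$ we have $|x-x_i|\le c\,|\phi(x)-1|^\beta$ for all $x\in[0,1]$ with $|x-x_i|<\varepsilon$ and all $i=1,\dots,k$, then $C_\phi\in\mathcal{S}_q(M^2_\Lambda,L^2)$ for all $q>0$.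
   Context: $L^2=L^2([0,1])$ with respect to Lebesgue measure. $\Lambda$ is a strictly increasing infinite sequence of nonnegative real numbers with $\sum_{\lambda\in\Lambda}1/\lambda<\infty$ (a term $\lambda=0$, if present, is omitted). $M^2_\Lambda$ is the closed linear span of $\{x^\lambda:\lambda\in\Lambda\}$ in $L^2$. Writing $\lambda_1<\lambda_2<\dots$ for the positive elements of $\Lambda$, $\Lambda$ is lacunary if there is $\gamma>1$ with $\lambda_{n+1}/\lambda_n\ge\gamma$ for all $n\ge1$. The composition operator is defined by $C_\phi(g)=g\circ\phi$ for all $g$ in the linear span of $\{x^\lambda:\lambda\in\Lambda\}$; it is called bounded if it satisfies $\|g\circ\phi\|_{L^2}\le C\|g\|_{L^2}$ for all such $g$, in which case it extends to a bounded operator $M^2_\Lambda\to L^2$; compactness and Schatten class membership refer to this extension. A point $x\in[0,1]$ is an essential point of maximum for $\phi$ if $\operatorname{ess\,sup}_E\phi=\operatorname{ess\,sup}_{[0,1]}\phi$ for every neighborhood $E$ of $x$ in $[0,1]$; $\mathfrak{M}_\phi$ is the set of all such points. The one-sided derivatives are $D_-^i(y)=\liminf_{t\to y-}\frac{\phi(y)-\phi(t)}{y-t}$ and $D_+^s(y)=\limsup_{t\to y+}\frac{\phi(y)-\phi(t)}{y-t}$. At $y=0$ only the condition on the right derivative is imposed, and at $y=1$ only the condition on the left derivative. For Hilbert spaces, $\mathcal{S}_q(\mathcal{H}_1,\mathcal{H}_2)$, $q>0$, is the class of compact operators $T:\mathcal{H}_1\to\mathcal{H}_2$ such that the sequence of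 eigenvalues of $|T|=\sqrt{T^*T}$ (counted with multiplicity) is in $\ell_q$. *)

(* Defs.v *)
From HB Require Import structures.
From mathcomp Require Import all_boot all_order all_algebra.
From mathcomp Require Import ring_quotient.
From mathcomp Require Import all_classical all_reals all_analysis.
From mathcomp Require Import measurable_realfun.
Import Order.TTheory GRing.Theory Num.Theory.
Import numFieldNormedType.Exports.

Set Implicit Arguments.
Unset Strict Implicit.
Unset Printing Implicit Defensive.

Local Open Scope classical_set_scope.
Local Open Scope ring_scope.
Local Open Scope quotient_scope.

HB.mixin Record NormedModule_isPreHilbert (R : realType) V
    & NormedModule R V := {
  inner : V -> V -> R;
  innerC : forall x y, inner x y = inner y x;
  inner_linear : forall a x y z,
    inner (a *: x + y) z = a * inner x z + inner y z;
  inner_norm : forall x, inner x x = `|x| ^+ 2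
}.

#[short(type="preHilbertType")]
HB.structure Definition PreHilbert (R : realType) :=
  {V of NormedModule R V & NormedModule_isPreHilbert R V}.

Definition compact_op (R : realType) (V W : preHilbertType R) (T : V -> W) :=
  precompact (T @` [set x | `|x| <= 1]).

Definition is_adjoint (R : realType) (V W : preHilbertType R)
    (T : V -> W) (S : W -> V) :=
  forall x y, inner (T x) y = inner x (S y).

(* A is |T|, the positive square root of T^* T; over the reals, positivity of
   the quadratic form does not imply self-adjointness *)
Definition is_absolute_value (R : realType) (V W : preHilbertType R)
    (T : {linear V -> W}) (A : {linear V -> V}) :=
  [/\ continuous A, is_adjoint A A, forall x, 0 <= inner (A x) x &
      exists2 S : {linear W -> V}, is_adjoint T S & forall x, A (A x) = S (T x)].

Definition has_dim (R : realType) (V : lmodType R) (E : set V) (n : nat) :=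
  exists b : 'I_n -> V,
    (forall c : 'I_n -> R, \sum_(i < n) c i *: b i = 0 -> forall i, c i = 0) /\
    E = [set \sum_(i < n) c i *: b i | c in [set: 'I_n -> R]].

(* s enumerates the nonzero eigenvalues of A, each repeated according to the
   dimension of its eigenspace; the remaining terms of s are equal to 0, so that
   finitely many nonzero eigenvalues and a kernel of any dimension are allowed *)
Definition is_eigenvalue_seq (R : realType) (V : lmodType R)
    (A : V -> V) (s : R^nat) :=
  forall l : R, l != 0 -> exists2 n : nat,
    has_dim [set x | A x = l *: x] n & ([set k | s k = l] #= `I_n)%card.

Definition schatten (R : realType) (V W : preHilbertType R) (q : R)
    (T : {linear V -> W}) :=
  compact_op T /\
  exists (A : {linear V -> V}) (s : R^nat),
    [/\ is_absolute_value T A, is_eigenvalue_seq A s &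
        cvgn (series (fun k => `|s k| `^ q))].

Section L2_space.
Context d (T : measurableType d) (R : realType).
Variable mu : {measure set T -> \bar R}.

Local Notation Lf2 := (LfunType mu (lee1n 2)).

Definition aezero : {pred Lf2} :=
  [pred f : Lf2 | `[< {ae mu, forall x, (f : T -> R) x = 0} >]].

Lemma aezeroP (f : Lf2) :
  reflect {ae mu, forall x, (f : T -> R) x = 0} (f \in aezero).
Proof. exact: asboolP. Qed.

Lemma LfBE (f g : Lf2) x : (f - g : Lf2) x = f x - g x. Proof. by []. Qed.
Lemma LfDE (f g : Lf2) x : (f + g : Lf2) x = f x + g x. Proof. by []. Qed.
Lemma LfZE a (f : Lf2) x : (a *: f : Lf2) x = a * f x. Proof. by []. Qed.
Lemma Lf0E x : (0 : Lf2) x = 0. Proof. by []. Qed.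

Lemma aezero_zmod_closed : zmod_closed aezero.
Proof.
split; first by apply/aezeroP; apply/nearW => x; rewrite Lf0E.
move=> f g /aezeroP f0 /aezeroP g0; apply/aezeroP.
by apply: filterS2 f0 g0 => x fx gx; rewrite LfBE fx gx subrr.
Qed.

HB.instance Definition _ :=
  GRing.isZmodClosed.Build Lf2 aezero aezero_zmod_closed.

Definition L2 : Type := Quotient.quot aezero.
HB.instance Definition _ := EqQuotient.on L2.
HB.instance Definition _ := Choice.on L2.
HB.instance Definition _ := GRing.Zmodule.on L2.
HB.instance Definition _ := ZmodQuotient.on L2.

Definition L2fun (F : L2) : T -> R := (repr F : Lf2).

Lemma L2_eqP (f g : Lf2) :
  reflect {ae mu, forall x, (f : T -> R) x = g x} (\pi_L2 f == \pi_L2 g).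
Proof.
rewrite -Quotient.idealrBE; apply: (iffP (aezeroP _)); apply: filterS => x.
  by rewrite LfBE => /subr0_eq.
by rewrite LfBE => ->; rewrite subrr.
Qed.

Lemma L2fun_pi (f : Lf2) : {ae mu, forall x, L2fun (\pi_L2 f) x = f x}.
Proof. by apply/L2_eqP; rewrite reprK. Qed.

Lemma L2fun_inj (F G : L2) : {ae mu, forall x, L2fun F x = L2fun G x} -> F = G.
Proof. by move=> /L2_eqP/eqP; rewrite !reprK. Qed.

Lemma L2funD (F G : L2) :
  {ae mu, forall x, L2fun (F + G) x = L2fun F x + L2fun G x}.
Proof.
have -> : F + G = \pi_L2 (repr F + repr G) by rewrite raddfD /= !reprK.
exact: L2fun_pi.
Qed.

Lemma L2fun0 : {ae mu, forall x, L2fun 0 x = 0}.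
Proof.
have -> : 0 = \pi_L2 0 by rewrite raddf0.
exact: L2fun_pi.
Qed.

Definition L2scale (a : R) (F : L2) : L2 := \pi_L2 (a *: repr F : Lf2).

Let L2funZ' a (F : L2) : {ae mu, forall x, L2fun (L2scale a F) x = a * L2fun F x}.
Proof. exact: L2fun_pi. Qed.

Let scaleA a b F : L2scale a (L2scale b F) = L2scale (a * b) F.
Proof.
apply: L2fun_inj.
apply: filterS3 (L2funZ' a (L2scale b F)) (L2funZ' b F) (L2funZ' (a * b) F).
by move=> x -> -> ->; rewrite mulrA.
Qed.

Let scale1 : left_id 1 L2scale.
Proof.
by move=> F; apply: L2fun_inj; apply: filterS (L2funZ' 1 F) => x ->; rewrite mul1r.
Qed.

Let scaleDr : right_distributive L2scale +%R.
Proof.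
move=> a F G; apply: L2fun_inj.
apply: filter_app (L2funZ' a (F + G)); apply: filter_app (L2funD F G).
apply: filter_app (L2funD (L2scale a F) (L2scale a G)).
apply: filter_app (L2funZ' a F); apply: filterS (L2funZ' a G).
by move=> x E1 E2 E3 E4 E5; rewrite E5 E4 E3 E2 E1 mulrDr.
Qed.

Let scaleDl F : {morph L2scale^~ F : a b / a + b}.
Proof.
move=> a b; apply: L2fun_inj.
apply: filter_app (L2funZ' (a + b) F).
apply: filter_app (L2funD (L2scale a F) (L2scale b F)).
apply: filter_app (L2funZ' a F); apply: filterS (L2funZ' b F).
by move=> x E1 E2 E3 E4; rewrite E4 E3 E2 E1 mulrDl.
Qed.

HB.instance Definition _ :=
  GRing.Zmodule_isLmodule.Build R L2 scaleA scale1 scaleDr scaleDl.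

Lemma L2funZ a (F : L2) : {ae mu, forall x, L2fun (a *: F) x = a * L2fun F x}.
Proof. exact: L2funZ'. Qed.

Definition L2norm (F : L2) : R := fine ('N[mu]_2[EFin \o L2fun F])%E.

Definition L2inner (F G : L2) : R := (\int[mu]_x (L2fun F x * L2fun G x))%R.

Let Lnorm_ae (f g : Lf2) : {ae mu, forall x, f x = g x} ->
  ('N[mu]_2[EFin \o f] = 'N[mu]_2[EFin \o g])%E.
Proof.
move=> fg; rewrite Lnorm.unlock; apply: (congr1 (fun z => z `^ 2^-1)%E).
apply: ge0_ae_eq_integral => //.
- apply/measurable_EFinP.
  apply: (@measurableT_comp _ _ _ _ _ _ (@powR R ^~ 2)) => //.
  exact: measurableT_comp.
- apply/measurable_EFinP.
  apply: (@measurableT_comp _ _ _ _ _ _ (@powR R ^~ 2)) => //.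
  exact: measurableT_comp.
- by move=> x _; exact: poweR_ge0.
- by move=> x _; exact: poweR_ge0.
by apply: filterS fg => x /= ->.
Qed.

Let norm_ler F G : L2norm (F + G) <= L2norm F + L2norm G.
Proof.
rewrite /L2norm (@Lnorm_ae _ (repr F + repr G)); first exact: ler_LnormD.
exact: L2funD.
Qed.

Let normZ a F : L2norm (a *: F) = `|a| * L2norm F.
Proof.
rewrite /L2norm (@Lnorm_ae _ (a *: repr F)); last exact: L2funZ.
by rewrite LnormZ fineM// fin_numElt (lt_le_trans ltNy0) ?Lnorm_ge0//=;
  exact: Lfunction_finite.
Qed.

Let norm_eq0 F : L2norm F = 0 -> F = 0.
Proof.
move=> /fine_Lnormr_eq0 F0; apply: L2fun_inj.
apply: filter_app F0; apply: filterS L2fun0.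
by move=> x E1 E2; rewrite E1 /L2fun E2.
Qed.

HB.instance Definition _ :=
  Lmodule_isNormed.Build R L2 norm_ler normZ norm_eq0.

Lemma L2mul_integrable (F G : L2) :
  mu.-integrable [set: T] (EFin \o (fun x => L2fun F x * L2fun G x)).
Proof.
apply/Lfun1_integrable; apply: Lfun2_mul_Lfun1; exact: LfunP.
Qed.

Let L2innerC F G : L2inner F G = L2inner G F.
Proof. by apply: eq_Rintegral => x _; rewrite mulrC. Qed.

Let L2inner_linear a F G H :
  L2inner (a *: F + G) H = a * L2inner F H + L2inner G H.
Proof.
rewrite /L2inner -RintegralZl//; last exact: L2mul_integrable.
have iaF : mu.-integrable [set: T]
    (EFin \o (fun x => a * (L2fun F x * L2fun H x))).
  by have := integrableZl measurableT a (L2mul_integrable F H).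
rewrite -RintegralD//; last exact: L2mul_integrable.
congr fine; apply: ae_eq_integral => //.
- exact: measurable_int (L2mul_integrable _ _).
- apply: measurable_int; apply: integrableD iaF (L2mul_integrable G H) => //.
apply: filter_app (L2funD (a *: F) G); apply: filterS (L2funZ a F).
by move=> x E1 E2 _; rewrite E2 E1 mulrDl mulrA.
Qed.

Let L2inner_norm F : L2inner F F = `|F| ^+ 2.
Proof.
have -> : `|F| = L2norm F by [].
rewrite /L2norm /L2inner /Rintegral -powR_mulrn ?fine_ge0 ?Lnorm_ge0//.
have fin : 'N[mu]_2[EFin \o L2fun F]%E \is a fin_num.
  rewrite fin_numElt (lt_le_trans ltNy0) ?Lnorm_ge0//=.
  exact: Lfunction_finite.
rewrite -fine_poweR poweR_Lnorm//; congr fine; apply: eq_integral => x _ /=.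
by rewrite powR_mulrn// -normrX ger0_norm ?sqr_ge0.
Qed.
HB.instance Definition _ :=
  NormedModule_isPreHilbert.Build R L2 L2innerC L2inner_linear L2inner_norm.

End L2_space.

Section Muntz_space.
Context {R : realType}.

Definition I01 : set R := `[0, 1].

Fact measurable_I01 : measurable (I01 : set (measurableTypeR R)).
Proof. exact: measurable_itv. Qed.

Definition mu01 := mrestr (@lebesgue_measure R) measurable_I01.
HB.instance Definition _ := Measure.on mu01.

Local Notation L201 := (L2 mu01).

Definition represents (F : L201) (g : R -> R) :=
  {ae mu01, forall x, L2fun F x = g x}.

Variable lam : R^nat.

(* a finite list of pairs (c, n) encodes the linear combination of the functions
   c x^(lam n); x `^ 0 = 1 also at x = 0 *)
Definition muntz_sum (p : seq (R * nat)) (x : R) : R :=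
  \sum_(t <- p) t.1 * x `^ lam t.2.

Definition muntz_span : set (R -> R) := range muntz_sum.

Definition muntz_pred : {pred L201} :=
  mem (closure [set F : L201 | exists2 g, muntz_span g & represents F g]).

Lemma muntz_submod_closed : submod_closed muntz_pred.
Proof.
split=> [|a F G].
  apply/mem_set/subset_closure; exists (muntz_sum [::]); first by exists [::].
  by apply: filterS (L2fun0 mu01) => x ->; rewrite /muntz_sum big_nil.
move=> /set_mem clF /set_mem clG; apply/mem_set => B nB.
have cont : (fun z : L201 * L201 => a *: z.1 + z.2) @ (F, G) --> a *: F + G.
  by apply: cvgD; [apply: cvgZr; exact: cvg_fst|exact: cvg_snd].
have [[U V] /= [nU nV] UV] := cont B nB.
have [F' [[_ [p _ <-] F'p] UF']] := clF U nU.
have [G' [[_ [r _ <-] G'r] VG']] := clG V nV.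
exists (a *: F' + G'); split; last exact: (UV (F', G')).
exists (muntz_sum ([seq (a * t.1, t.2) | t <- p] ++ r)); first by eexists.
apply: filter_app (L2funD (a *: F') G'); apply: filter_app (L2funZ a F').
apply: filter_app F'p; apply: filterS G'r => x E1 E2 E3 E4.
rewrite E4 E3 E2 E1 /muntz_sum big_cat big_map mulr_sumr /=.
by under eq_bigr do rewrite mulrA.
Qed.

HB.instance Definition _ :=
  GRing.isSubmodClosed.Build R L201 muntz_pred muntz_submod_closed.

Definition muntz : Type := {F : L201 | F \in muntz_pred}.
HB.instance Definition _ := SubChoice.on muntz.
HB.instance Definition _ := [SubChoice_isSubLmodule of muntz by <:].

Definition muntz_norm (F : muntz) : R := `|val F|.

Let norm_ler (F G : muntz) : muntz_norm (F + G) <= muntz_norm F + muntz_norm G.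
Proof. by rewrite /muntz_norm raddfD ler_normD. Qed.

Let normZ a (F : muntz) : muntz_norm (a *: F) = `|a| * muntz_norm F.
Proof. by rewrite /muntz_norm GRing.valZ normrZ. Qed.

Let norm_eq0 (F : muntz) : muntz_norm F = 0 -> F = 0.
Proof. by move=> /normr0_eq0 F0; apply: val_inj; rewrite F0 raddf0. Qed.

HB.instance Definition _ := Lmodule_isNormed.Build R muntz norm_ler normZ norm_eq0.

Definition muntz_inner (F G : muntz) : R := inner (val F) (val G).

Let m_innerC F G : muntz_inner F G = muntz_inner G F.
Proof. exact: innerC. Qed.

Let m_inner_linear a F G H :
  muntz_inner (a *: F + G) H = a * muntz_inner F H + muntz_inner G H.
Proof. by rewrite /muntz_inner GRing.valD GRing.valZ inner_linear. Qed.

Let m_inner_norm F : muntz_inner F F = `|F| ^+ 2.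
Proof. exact: inner_norm. Qed.

HB.instance Definition _ := NormedModule_isPreHilbert.Build R muntz
  m_innerC m_inner_linear m_inner_norm.

End Muntz_space.

Section composition.
Context {R : realType}.
Implicit Types (lam : R^nat) (phi g : R -> R).

Definition norm01 g : \bar R :=
  ((\int[lebesgue_measure]_(x in @I01 R) (`|g x| ^+ 2)%:E) `^ 2^-1)%E.

Definition comp_bounded lam phi :=
  exists C : R, forall g, muntz_span lam g ->
    (norm01 (g \o phi) <= C%:E * norm01 g)%E.

(* T is the bounded extension of g |-> g \o phi to the closure of the span *)
Definition is_comp_op lam phi (T : muntz lam -> L2 (@mu01 R)) :=
  continuous T /\
  forall (F : muntz lam) g, muntz_span lam g ->
    represents (val F) g -> represents (T F) (g \o phi).

(* As (0 : R)^-1 = 0, an exponent lam n = 0 does not contribute to the sum *)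
Definition muntz_exponents lam :=
  [/\ forall n, 0 <= lam n, forall n, lam n < lam n.+1 &
      cvgn (series (fun n => (lam n)^-1))].

(* Only lam 0 can vanish, so consecutive positive exponents are consecutive
   terms of lam *)
Definition lacunary lam :=
  exists2 gamma : R, 1 < gamma &
    forall n, 0 < lam n -> gamma <= lam n.+1 / lam n.

Definition ess_sup_on (E : set R) phi : \bar R :=
  ereal_inf [set y | {ae lebesgue_measure, forall x, E x -> ((phi x)%:E <= y)%E}].

Definition ess_max_points phi : set R :=
  [set x | I01 x /\
    forall E : set R, E `<=` I01 -> within I01 (nbhs x) E ->
      ess_sup_on E phi = ess_sup_on I01 phi].

Definition lower_left_derivative phi (y : R) : \bar R :=
  limf_einf (fun t => ((phi y - phi t) / (y - t))%:E) y^'-.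

Definition upper_right_derivative phi (y : R) : \bar R :=
  limf_esup (fun t => ((phi y - phi t) / (y - t))%:E) y^'+.

End composition.

(* Main.v *)
Require Import Defs.
From HB Require Import structures.
From mathcomp Require Import all_boot all_order all_algebra.
From mathcomp Require Import qpoly.
From mathcomp Require Import all_classical all_reals all_analysis.
From mathcomp Require Import measurable_realfun.
From mathcomp Require Import ring lra zify.
Import Order.TTheory GRing.Theory Num.Theory.
Import numFieldNormedType.Exports.

Set Implicit Arguments.
Unset Strict Implicit.
Unset Printing Implicit Defensive.

Local Open Scope classical_set_scope.
Local Open Scope ring_scope.

(** Write mu_n = lam n + 1/2, e_n = sqrt (2 mu_n) x^(lam n), a function of norm 1,
    and w_n = sqrt (2 mu_n) phi^(lam n), its image under the composition operator.

    The e_n form a Riesz sequence. Their Gram matrix has entries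
    2 sqrt (mu_j mu_k) / (mu_j + mu_k), which decay geometrically away from the
    diagonal because the mu_n are lacunary, so that the Schur test bounds the
    norm of a combination from above (lac_schur). The Gram matrix is a Cauchy
    matrix, and its inverse is the same matrix between two bounded diagonal ones
    (cauchy_inverse, cauchy_coef_le); so the inverse is bounded too, which gives
    the bound from below (riesz_lower_bound).

    The Gram matrix of the w_n involves the moments of phi, the integrals of phi^s.
    Away from the maxima phi is essentially bounded by some rho < 1
    (ess_lt1_away). Near a maximum y an inequality |x - y| <= c (1 - phi x)^beta
    bounds phi^s by a multiple of a Cauchy kernel of width c / s^beta. Hence the moments are at
    most of order c s^(- beta) (moment_le). One-sided derivatives that do not
    vanish give this with beta = 1, and infinite ones allow every c > 0
    (slope_peak).

    Let kappa_m be the largest ratio of the moments of phi to the ones of the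
    identity, 1 / (s + 1), over s = lam j + lam k with j, k >= m. By the Schur
    test again, the norm of a combination of the w_k with k >= m is at most
    a multiple of sqrt kappa_m times the norm of its coefficients (powers_tail).
    Thus the composition operator is bounded if kappa is, and its distance to an
    operator of rank m is of order sqrt kappa_m (riesz_operator). In case (ii)
    kappa_m tends to 0, so the operator is a limit of operators of finite rank,
    hence compact because L^2 is complete (approximable_compact, L2_complete). In
    case (iii) kappa_m decays geometrically, because the exponents grow
    geometrically; so do the singular values, which are at most the distances to
    operators of finite rank (singular_le_approx).

    For the Schatten classes an absolute value and an adjoint are needed. They are
    built from a singular system: unit vectors v_k maximising |T x| on the
    orthogonal complement of the previous ones (norm_attained,
    singular_system_exists). *)

(** * The inverse of a Cauchy matrix *)

Section CauchyMatrix.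
Variables (F : fieldType) (n : nat) (mu : nat -> F).
Hypothesis mu_inj : injective mu.
Hypothesis muD_neq0 : forall i j, mu i + mu j != 0.

(** This is 2 mu_k divided by the value at mu_k of the finite Blaschke product of
    the (x - mu_i) / (x + mu_i) for i <> k. *)
Definition cauchy_coef (k : 'I_n) : F :=
  (\prod_(i < n) (mu k + mu i)) / \prod_(i < n | i != k) (mu k - mu i).

(** Lagrange interpolation at the nodes mu_k of the polynomial with roots - mu_l,
    l <> j, evaluated at - mu_i. It says that the inverse of the matrix
    1 / (mu_j + mu_k) has entries b_j b_k / (mu_j + mu_k), where b is
    cauchy_coef: the inverse is again that Cauchy matrix, between two diagonal
    ones. *)
Lemma cauchy_inverse (i j : 'I_n) :
  \sum_(k < n) cauchy_coef k / ((mu j + mu k) * (mu k + mu i)) =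
  (i == j)%:R / cauchy_coef j.
Proof.
have n_gt0 : (0 < n)%N by case: n i => // -[].
pose p := \prod_(l < n | l != j) ('X - (- mu l)%:P).
have sp : (size p <= n)%N.
  rewrite size_prod => [|l _]; last by rewrite polyXsubC_eq0.
  under eq_bigr do rewrite size_XsubC.
  rewrite sum_nat_const (eq_card (B := predC1 j))// cardC1 card_ord.
  by case: (n) n_gt0 => // m _; rewrite /=; lia.
have cN : #|(fun l : 'I_n => l != j)| = n.-1.
  by rewrite (eq_card (B := predC1 j))// cardC1 card_ord.
have cNk k : #|(fun l : 'I_n => l != k)| = n.-1.
  by rewrite (eq_card (B := predC1 k))// cardC1 card_ord.
have /(congr1 (fun q => q.[- mu i])) := lagrange_gen n_gt0 mu_inj sp.
rewrite horner_sum horner_prod.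
under eq_bigr do rewrite hornerXsubC opprK.
have prodD k : \prod_(l < n) (mu k + mu l) != 0 by apply/prodf_neq0.
have prodB (k : 'I_n) : \prod_(l < n | l != k) (mu k - mu l) != 0.
  apply/prodf_neq0 => l lk; rewrite subr_eq0 (inj_eq mu_inj).
  by rewrite (inj_eq val_inj) eq_sym.
have term (k : 'I_n) : ((p.[mu k])%:P * tnth (lagrange n mu) k).[- mu i] =
    (- 1) ^+ n.-1 * (\prod_(l < n) (mu i + mu l)) *
      (cauchy_coef k / ((mu j + mu k) * (mu k + mu i))).
  rewrite lagrangeE// hornerM hornerC hornerM hornerC !horner_prod.
  under eq_bigr do rewrite hornerXsubC opprK.
  under [X in X^-1]eq_bigr do rewrite hornerXsubC.
  under [X in _ * (_ * X)]eq_bigr do rewrite hornerXsubC -opprD.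
  rewrite prodrN cNk /cauchy_coef.
  have -> : \prod_(l < n) (mu k + mu l) =
      (mu k + mu j) * \prod_(l < n | l != j) (mu k + mu l) by rewrite (bigD1 j).
  have -> : \prod_(l < n) (mu i + mu l) =
      (mu i + mu k) * \prod_(l < n | l != k) (mu i + mu l) by rewrite (bigD1 k).
  rewrite [mu j + mu k]addrC [mu i + mu k]addrC.
  by field; rewrite !muD_neq0 prodB.
rewrite (eq_bigr _ (fun k _ => term k)) -mulr_sumr => /esym E.
have {E} E : \sum_(k < n) cauchy_coef k / ((mu j + mu k) * (mu k + mu i)) =
   (\prod_(l < n | l != j) (- mu i + mu l)) /
   ((- 1) ^+ n.-1 * \prod_(l < n) (mu i + mu l)).
  by rewrite -E mulrC mulKf// mulf_neq0// signr_eq0.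
rewrite {}E; have [->|ij] := eqVneq i j.
  under eq_bigr do rewrite addrC -opprB.
  rewrite prodrN cN /cauchy_coef invf_div mul1r.
  by rewrite -mulf_div divff ?mul1r// signr_eq0.
by rewrite (bigD1 i)//= addNr !mul0r.
Qed.

End CauchyMatrix.

(** * Gram matrices of lacunary sequences *)

Definition ndist (j k : nat) : nat := (j - k) + (k - j).

Lemma ndistC j k : ndist j k = ndist k j.
Proof. by rewrite /ndist addnC. Qed.

Section GeometricDecay.
Variables (R : realType) (r : R).
Hypothesis r01 : 0 <= r < 1.

Let r_ge0 : 0 <= r. Proof. by case/andP: r01. Qed.
Let r1 : 0 < 1 - r. Proof. by rewrite subr_gt0; case/andP: r01. Qed.

Lemma sum_expr_le n : \sum_(k < n) r ^+ k <= (1 - r)^-1.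
Proof.
rewrite -[leRHS]mul1r ler_pdivlMr// mulrC -opprB mulNr -subrX1 opprB.
by rewrite lerBlDr lerDl exprn_ge0.
Qed.

Lemma sum_ndist_le n (j : nat) : \sum_(k < n) r ^+ ndist j k <= 2 / (1 - r).
Proof.
have tail m : \sum_(k < m) r ^+ (k - j) * (j <= k)%:R <= (1 - r)^-1.
  rewrite -(big_mkord xpredT (fun k => r ^+ (k - j) * (j <= k)%:R)).
  have [mj|jm] := leqP m j.
    rewrite big_nat big1 ?invr_ge0 ?ltW// => k /andP[_ km].
    by rewrite leqNgt (leq_trans km mj) mulr0.
  rewrite (@big_cat_nat _ _ _ j)//= ?(ltnW jm)// big_nat big1 ?add0r; last first.
    by move=> k /andP[_ kj]; rewrite leqNgt kj mulr0.
  rewrite -{1}[j]add0n big_addn big_mkord; apply: le_trans (sum_expr_le (m - j)).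
  by apply: ler_sum => k _; rewrite addnK leq_addl mulr1.
have head : \sum_(k < n) r ^+ (j - k) * (k < j)%:R <= (1 - r)^-1.
  rewrite -(big_mkord xpredT (fun k => r ^+ (j - k) * (k < j)%:R)).
  apply: (@le_trans _ _ (\sum_(0 <= k < maxn n j) r ^+ (j - k) * (k < j)%:R)).
    rewrite [leRHS](@big_cat_nat _ _ _ n)//= ?leq_maxl// lerDl sumr_ge0// => k _.
    by rewrite mulr_ge0// exprn_ge0.
  rewrite (@big_cat_nat _ _ _ j)//= ?leq_maxr// [X in _ + X]big_nat.
  rewrite [X in _ + X]big1 ?addr0; last first.
    by move=> k /andP[jk _]; rewrite ltnNge jk mulr0.
  rewrite big_nat_rev/= add0n big_mkord; apply: le_trans (sum_expr_le j).
  apply: ler_sum => k _; rewrite subKn//.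
  rewrite (_ : (_ < _)%N = true) ?mulr1; last by have := ltn_ord k; lia.
  by rewrite exprS ler_piMl ?exprn_ge0// ltW//; case/andP: r01.
rewrite mulr2n mulrDl mul1r; apply: le_trans (lerD (tail n) head).
rewrite -big_split/=; apply: ler_sum => k _; rewrite /ndist.
have [jk|kj] := leqP j k; rewrite /= ?mulr1 ?mulr0 ?addr0 ?add0r.
  by rewrite (eqP (jk : (j - k)%N == 0%N)).
by rewrite (eqP (ltnW kj : (k - j)%N == 0%N)) addn0.
Qed.

(** The Schur test for a symmetric kernel: 2 |c_j c_k| <= c_j^2 + c_k^2, and the
    rows of the kernel have uniformly bounded sums. *)
Lemma schur_ndist n (c : nat -> R) :
  \sum_(j < n) \sum_(k < n) `|c j| * `|c k| * r ^+ ndist j k <=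
  2 / (1 - r) * \sum_(k < n) c k ^+ 2.
Proof.
pose S := \sum_(j < n) \sum_(k < n) (c j ^+ 2) * r ^+ ndist j k.
have SE : S = \sum_(j < n) \sum_(k < n) (c k ^+ 2) * r ^+ ndist j k.
  rewrite /S exchange_big/=; apply: eq_bigr => j _; apply: eq_bigr => k _.
  by rewrite ndistC.
apply: (@le_trans _ _ S).
  rewrite -(ler_pM2l (ltr0n _ 2)) mulr_natl mulr2n mulr_natl mulr2n {2}SE.
  rewrite -!big_split/=; apply: ler_sum => j _.
  rewrite -!big_split/=; apply: ler_sum => k _.
  rewrite -!mulrDl ler_wpM2r ?exprn_ge0//.
  rewrite -(real_normK (num_real (c j))) -(real_normK (num_real (c k))).
  by have := sqr_ge0 (`|c j| - `|c k|); nra.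
rewrite mulr_sumr; apply: ler_sum => j _.
by rewrite -mulr_sumr mulrC ler_wpM2r ?sqr_ge0// sum_ndist_le.
Qed.

End GeometricDecay.

Section LacunaryKernel.
Variables (R : realType) (mu : nat -> R) (t : R).
Hypothesis t01 : 0 < t < 1.
Hypothesis mu0_gt0 : 0 < mu 0%N.
Hypothesis mu_lac : forall n, mu n <= t * mu n.+1.

Let t_gt0 : 0 < t. Proof. by case/andP: t01. Qed.
Let t_lt1 : t < 1. Proof. by case/andP: t01. Qed.

Lemma lac_gt0 n : 0 < mu n.
Proof.
elim: n => // n IH; have := lt_le_trans IH (mu_lac n).
by rewrite pmulr_rgt0.
Qed.

Lemma lac_decay j k : (j <= k)%N -> mu j <= t ^+ (k - j) * mu k.
Proof.
move=> /subnK <-; rewrite addnK; elim: (k - j)%N => [|m IH].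
  by rewrite add0n expr0 mul1r.
apply: (le_trans IH).
by rewrite exprSr -mulrA ler_wpM2l ?exprn_ge0 ?(ltW t_gt0)// addSn mu_lac.
Qed.

Lemma lac_inj : injective mu.
Proof.
have mono j k : (j < k)%N -> mu j < mu k.
  move=> jk; apply: (le_lt_trans (lac_decay (ltnW jk))).
  rewrite gtr_pMl ?lac_gt0// exprn_ilt1 ?ltW//.
  by rewrite subn_eq0 -ltnNge.
move=> j k E; apply/eqP; case: (ltngtP j k) => // /mono; by rewrite E ltxx.
Qed.

Lemma lacD_neq0 j k : mu j + mu k != 0.
Proof. by rewrite gt_eqF// addr_gt0// lac_gt0. Qed.

(** The Gram matrix of the functions sqrt (2 mu_n) x^(mu_n - 1/2) in L^2(0,1),
    which have norm 1. *)
Definition lac_gram j k : R :=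
  Num.sqrt (2 * mu j) * Num.sqrt (2 * mu k) / (mu j + mu k).

Lemma lac_gramC j k : lac_gram j k = lac_gram k j.
Proof. by rewrite /lac_gram addrC [X in X / _]mulrC. Qed.

Lemma lac_gram_decay j k : lac_gram j k <= 2 * Num.sqrt t ^+ ndist j k.
Proof.
wlog jk : j k / (j <= k)%N.
  move=> H; case/orP: (leq_total j k) => [/H//|kj].
  by rewrite lac_gramC ndistC; apply: H.
rewrite /ndist (eqP (jk : (j - k)%N == 0%N)) add0n.
rewrite ler_pdivrMr ?addr_gt0 ?lac_gt0//.
have E : Num.sqrt (2 * mu j) <= Num.sqrt t ^+ (k - j) * Num.sqrt (2 * mu k).
  have -> : Num.sqrt t ^+ (k - j) = Num.sqrt (t ^+ (k - j)).
    rewrite -[LHS]ger0_norm ?exprn_ge0 ?sqrtr_ge0// -sqrtr_sqr exprAC.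
    by rewrite sqr_sqrtr ?(ltW t_gt0).
  rewrite -sqrtrM ?exprn_ge0 ?(ltW t_gt0)// ler_wsqrtr//.
  by rewrite mulrCA ler_pM2l// lac_decay.
apply: (@le_trans _ _ (Num.sqrt t ^+ (k - j) * (2 * mu k))).
  rewrite -[X in _ <= _ * X]sqr_sqrtr ?mulr_ge0 ?(ltW (lac_gt0 k))//.
  by rewrite expr2 mulrA ler_wpM2r ?sqrtr_ge0.
rewrite mulrCA -mulrA ler_wpM2l// ler_wpM2l ?exprn_ge0 ?sqrtr_ge0//.
by rewrite lerDr ltW ?lac_gt0.
Qed.

Definition schur_const : R := 2 * (2 / (1 - Num.sqrt t)).

Let sqrt01 : 0 <= Num.sqrt t < 1.
Proof. by rewrite sqrtr_ge0 -[ltRHS]sqrtr1 ltr_sqrt. Qed.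

Lemma schur_const_gt0 : 0 < schur_const.
Proof. by rewrite !mulr_gt0// invr_gt0 subr_gt0; case/andP: sqrt01. Qed.

Lemma lac_schur n (c : nat -> R) :
  \sum_(j < n) \sum_(k < n) `|c j| * `|c k| * lac_gram j k <=
  schur_const * \sum_(k < n) c k ^+ 2.
Proof.
rewrite /schur_const -mulrA; apply: le_trans (ler_wpM2l _ (schur_ndist sqrt01 n c)) => //.
rewrite mulr_sumr; apply: ler_sum => j _; rewrite mulr_sumr; apply: ler_sum => k _.
by rewrite [leRHS]mulrCA ler_wpM2l ?mulr_ge0// lac_gram_decay.
Qed.

Definition blaschke_const : R := expR (2 / (1 - t) * (2 / (1 - t))).

(** The Blaschke products stay away from 0 uniformly in n and k: each factor
    (mu_k + mu_i) / |mu_k - mu_i| is at most 1 + 2 t^|k - i| / (1 - t), and the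
    product of these bounds is at most the exponential of a geometric series. *)
Lemma cauchy_coef_le n (k : 'I_n) :
  `|cauchy_coef mu k| <= 2 * mu k * blaschke_const.
Proof.
rewrite /cauchy_coef (bigD1 k)//= -(mulrA (_ + _)) normrM.
rewrite [X in X * _]ger0_norm; last by rewrite addr_ge0// ltW ?lac_gt0.
rewrite (_ : mu k + mu k = 2 * mu k); last by ring.
rewrite ler_wpM2l ?mulr_ge0 ?(ltW (lac_gt0 k))//.
rewrite -prodf_div normr_prod.
have step (i : 'I_n) : i != k ->
    `|(mu k + mu i) / (mu k - mu i)| <= expR (2 / (1 - t) * t ^+ ndist k i).
  move=> ik; have {ik} ik : (i != k :> nat) by [].
  apply: le_trans (expR_ge1Dx _).
  have key a b : (a < b)%N ->
      `|mu b + mu a| / `|mu b - mu a| <= 1 + 2 / (1 - t) * t ^+ (b - a).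
    move=> ab; have d := lac_decay (ltnW ab).
    have a0 := lac_gt0 a; have b0 := lac_gt0 b.
    have T : t ^+ (b - a) <= t.
      by rewrite -[leRHS]expr1 ler_wiXn2l ?subn_gt0// ltW.
    have T0 : 0 <= t ^+ (b - a) by rewrite exprn_ge0// ltW.
    have ba : (1 - t) * mu b <= mu b - mu a.
      by rewrite mulrBl mul1r lerB// (le_trans d)// ler_pM2r.
    have ba0 : 0 < mu b - mu a by apply: lt_le_trans ba; rewrite mulr_gt0// subr_gt0.
    rewrite gtr0_norm ?addr_gt0// gtr0_norm// ler_pdivrMr//.
    suff : mu a <= (1 - t)^-1 * t ^+ (b - a) * (mu b - mu a) by nra.
    rewrite -mulrA ler_pdivlMl ?subr_gt0//.
    apply: (@le_trans _ _ (t ^+ (b - a) * ((1 - t) * mu b))).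
      by rewrite mulrCA ler_pM2l ?subr_gt0.
    by rewrite ler_wpM2l.
  rewrite normf_div; case: (ltngtP i k) ik => // ik _.
    by rewrite /ndist (eqP (ltnW ik : (i - k)%N == 0%N)) addn0 key.
  by rewrite /ndist (eqP (ltnW ik : (k - i)%N == 0%N)) add0n addrC distrC key.
apply: (@le_trans _ _ (\prod_(i < n | i != k) expR (2 / (1 - t) * t ^+ ndist k i))).
  by apply: ler_prod => i ik; rewrite normr_ge0 step.
rewrite -expR_sum ler_expR -mulr_sumr ler_wpM2l//.
  by rewrite divr_ge0// subr_ge0 ltW.
apply: le_trans (@sum_ndist_le _ t _ n k); last by rewrite ltW.
by rewrite [leRHS](bigD1 k)//= lerDr exprn_ge0// ltW.
Qed.

End LacunaryKernel.

(** * Inner product spaces and the lower Riesz bound *)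

Section InnerProduct.
Variables (R : realType) (V : preHilbertType R).
Implicit Types x y z : V.

Lemma innerDl x y z : inner (x + y) z = inner x z + inner y z.
Proof. by have := inner_linear 1 x y z; rewrite scale1r mul1r. Qed.

Lemma inner0l z : inner 0 z = 0 :> R.
Proof. by apply: (addIr (inner 0 z)); rewrite -innerDl addr0 add0r. Qed.

Lemma innerZl a x z : inner (a *: x) z = a * inner x z.
Proof. by have := inner_linear a x 0 z; rewrite inner0l !addr0. Qed.

Lemma innerDr x y z : inner z (x + y) = inner z x + inner z y.
Proof. by rewrite !(innerC z) innerDl. Qed.

Lemma inner0r z : inner z 0 = 0 :> R.
Proof. by rewrite innerC inner0l. Qed.

Lemma innerZr a x z : inner z (a *: x) = a * inner z x.
Proof. by rewrite !(innerC z) innerZl. Qed.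

Lemma innerBl x y z : inner (x - y) z = inner x z - inner y z.
Proof. by rewrite -scaleN1r innerDl innerZl mulN1r. Qed.

Lemma innerBr x y z : inner z (x - y) = inner z x - inner z y.
Proof. by rewrite !(innerC z) innerBl. Qed.

Lemma inner_suml (I : Type) (r : seq I) (P : pred I) (f : I -> V) z :
  inner (\sum_(i <- r | P i) f i) z = \sum_(i <- r | P i) inner (f i) z.
Proof.
by apply: (big_morph (fun x => inner x z) (fun x y => innerDl x y z) (inner0l z)).
Qed.

Lemma inner_sumr (I : Type) (r : seq I) (P : pred I) (f : I -> V) z :
  inner z (\sum_(i <- r | P i) f i) = \sum_(i <- r | P i) inner z (f i).
Proof. by rewrite innerC inner_suml; apply: eq_bigr => i _; rewrite innerC. Qed.

Lemma sqr_norm_sum (n : nat) (c : nat -> R) (e : nat -> V) :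
  `|\sum_(k < n) c k *: e k| ^+ 2 =
  \sum_(j < n) \sum_(k < n) c j * c k * inner (e j) (e k).
Proof.
rewrite -inner_norm inner_suml; apply: eq_bigr => j _.
rewrite inner_sumr; apply: eq_bigr => k _.
by rewrite innerZl innerZr mulrA.
Qed.

Lemma sqr_normD x y : `|x + y| ^+ 2 = `|x| ^+ 2 + 2 * inner x y + `|y| ^+ 2.
Proof.
by rewrite -!inner_norm innerDl !innerDr (innerC y x); ring.
Qed.

Lemma sqr_normB x y : `|x - y| ^+ 2 = `|x| ^+ 2 - 2 * inner x y + `|y| ^+ 2.
Proof.
by rewrite -!inner_norm innerBl !innerBr (innerC y x); ring.
Qed.

Lemma sqr_normZ a x : `|a *: x| ^+ 2 = a ^+ 2 * `|x| ^+ 2.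
Proof. by rewrite normrZ exprMn real_normK ?num_real. Qed.

Lemma parallelogram x y :
  `|x - y| ^+ 2 = 2 * `|x| ^+ 2 + 2 * `|y| ^+ 2 - `|x + y| ^+ 2.
Proof. by rewrite sqr_normB sqr_normD; ring. Qed.

(** The quadratic inequality behind Cauchy-Schwarz, kept with its parameter t
    because the lower Riesz bound uses it with an explicit t. *)
Lemma inner_le_sqr x y (t : R) : 2 * t * inner x y <= `|x| ^+ 2 + t ^+ 2 * `|y| ^+ 2.
Proof.
have := sqr_ge0 `|x - t *: y|; rewrite sqr_normB innerZr sqr_normZ; lra.
Qed.

Lemma cauchy_schwarz x y : `|inner x y| <= `|x| * `|y|.
Proof.
wlog ip : x / 0 <= inner x y.
  move=> H; case: (leP 0 (inner x y)) => [/H//|/ltW ip].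
  have E : inner (- x) y = - inner x y by rewrite -scaleN1r innerZl mulN1r.
  by rewrite -[`|inner x y|]normrN -E -[`|x|]normrN H// E oppr_ge0.
rewrite ger0_norm//; have [->|y0] := eqVneq y 0.
  by rewrite inner0r normr0 mulr0.
have ny : 0 < `|y| by rewrite normr_gt0.
have [->|x0] := eqVneq x 0; first by rewrite inner0l normr0 mul0r.
have nx : 0 < `|x| by rewrite normr_gt0.
have := inner_le_sqr x y (`|x| / `|y|).
have a0 : 0 < `|x| / `|y| by rewrite divr_gt0.
rewrite -exprMn divfK ?gt_eqF// => Q.
by rewrite -(ler_pM2l a0) [leRHS]mulrCA divfK ?gt_eqF//; lra.
Qed.

Lemma inner_continuous y : continuous (fun x => inner x y).
Proof.
move=> x; apply/cvgrPdist_le => e e0.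
have d0 : 0 < e / (`|y| + 1) by rewrite divr_gt0// ltr_wpDl.
near=> z; rewrite -innerBl; apply: (le_trans (cauchy_schwarz _ _)).
apply: (@le_trans _ _ (e / (`|y| + 1) * `|y|)).
  by rewrite ler_wpM2r//; near: z; exact: (cvgr_dist_le cvg_id).
rewrite mulrAC ler_pdivrMr ?ltr_wpDl//.
by rewrite ler_wpM2l ?lerDl ?(ltW e0).
Unshelve. all: by end_near. Qed.

End InnerProduct.

Section RieszLowerBound.
Variables (R : realType) (mu : nat -> R) (t : R).
Hypothesis t01 : 0 < t < 1.
Hypothesis mu0_gt0 : 0 < mu 0%N.
Hypothesis mu_lac : forall n, mu n <= t * mu n.+1.

Definition riesz_const : R := blaschke_const t ^+ 2 * schur_const t.

Lemma riesz_const_gt0 : 0 < riesz_const.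
Proof. by rewrite mulr_gt0 ?exprn_gt0 ?expR_gt0// schur_const_gt0. Qed.

Variables (V : preHilbertType R) (e : nat -> V).
Hypothesis gram_e : forall j k, inner (e j) (e k) = lac_gram mu j k.

(** The lower Riesz bound for a normalised lacunary sequence. Let G be the Gram
    matrix of the e_k. By cauchy_inverse the inverse H of G is E G E with E
    diagonal, and by cauchy_coef_le the entries of E are bounded, so that the
    Schur bound for G also bounds H. With x the sum of the c_k e_k and y the one
    with coefficients H c, one has <x, y> = |c|^2 and |y|^2 = <c, H c>, and
    Cauchy-Schwarz concludes. This works for every ratio t < 1, although G need
    not be diagonally dominant. *)
Lemma riesz_lower_bound n (c : nat -> R) :
  \sum_(k < n) c k ^+ 2 <= riesz_const * `|\sum_(k < n) c k *: e k| ^+ 2.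
Proof.
pose sq j := Num.sqrt (2 * mu j).
have mu_gt0 j : 0 < mu j by exact: (lac_gt0 t01).
have sq2 j : sq j ^+ 2 = 2 * mu j by rewrite sqr_sqrtr ?mulr_ge0 ?ltW.
have sq_gt0 j : 0 < sq j by rewrite sqrtr_gt0 mulr_gt0.
(* cauchy_coef as a sequence, to be used as coefficients of a combination *)
pose b (k : nat) : R := if insub k is Some i then @cauchy_coef R n mu i else 0.
have bE (k : 'I_n) : b k = cauchy_coef mu k by rewrite /b valK.
pose H j k := b j * b k / (sq j * sq k * (mu j + mu k)).
have HG (i j : 'I_n) : \sum_(k < n) H j k * lac_gram mu k i = (i == j)%:R.
  have := cauchy_inverse (@lac_inj _ _ _ t01 mu0_gt0 mu_lac)
    (lacD_neq0 t01 mu0_gt0 mu_lac) i j.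
  move=> /(congr1 (fun z => b j * sq i / sq j * z)).
  rewrite mulr_sumr => E; transitivity (b j * sq i / sq j * ((i == j)%:R / b j)).
    rewrite {2}bE -E; apply: eq_bigr => k _; rewrite /H /lac_gram -!/(sq _) -bE.
    by field; rewrite !gt_eqF// ?addr_gt0.
  have [->|ij] := eqVneq i j; last by rewrite mul0r mulr0.
  have bj0 : b j != 0.
    rewrite bE mulf_neq0 ?invr_eq0//; apply/prodf_neq0 => l lj.
      by rewrite gt_eqF// addr_gt0.
    rewrite subr_eq0 (inj_eq (@lac_inj _ _ _ t01 mu0_gt0 mu_lac)).
    by rewrite (inj_eq val_inj) eq_sym.
  by rewrite !mulr1n mul1r; field; rewrite bj0 gt_eqF.
pose d k := \sum_(j < n) c j * H j k.
pose x := \sum_(k < n) c k *: e k; pose y := \sum_(k < n) d k *: e k.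
pose S := \sum_(k < n) c k ^+ 2.
have xy : inner y x = S.
  rewrite /y /x /S inner_suml.
  transitivity (\sum_(k < n) \sum_(i < n) d k * (c i * lac_gram mu k i)).
    apply: eq_bigr => k _; rewrite innerZl inner_sumr mulr_sumr.
    by apply: eq_bigr => i _; rewrite innerZr gram_e.
  rewrite exchange_big/=; apply: eq_bigr => i _.
  transitivity (\sum_(j < n) c j * c i * (i == j)%:R).
    under eq_bigr do rewrite /d mulr_suml.
    rewrite exchange_big/=; apply: eq_bigr => j _; rewrite -HG mulr_sumr.
    by apply: eq_bigr => k _; ring.
  rewrite (bigD1 i)//= eqxx mulr1 big1 ?addr0 ?expr2// => j ji.
  by rewrite eq_sym (negPf ji) mulr0.
have yy : `|y| ^+ 2 = \sum_(j < n) \sum_(k < n) c j * c k * H j k.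
  rewrite -inner_norm {2}/y inner_sumr.
  transitivity (\sum_(k < n) d k * c k).
    apply: eq_bigr => k _; rewrite innerZr; congr (_ * _).
    rewrite /y inner_suml.
    transitivity (\sum_(l < n) \sum_(j < n) c j * (H j l * lac_gram mu l k)).
      apply: eq_bigr => l _; rewrite innerZl gram_e /d mulr_suml.
      by apply: eq_bigr => j _; ring.
    rewrite exchange_big/= (bigD1 k)//= -mulr_sumr HG eqxx mulr1.
    rewrite big1 ?addr0// => j jk.
    by rewrite -mulr_sumr HG eq_sym (negPf jk) mulr0.
  under eq_bigr do rewrite /d mulr_suml.
  rewrite exchange_big/=; apply: eq_bigr => j _; apply: eq_bigr => k _; ring.
have yyK : `|y| ^+ 2 <= riesz_const * S.
  rewrite yy /riesz_const -mulrA.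
  apply: le_trans (ler_wpM2l _ (lac_schur t01 mu0_gt0 mu_lac n c)); last first.
    by rewrite exprn_ge0// expR_ge0.
  rewrite mulr_sumr; apply: ler_sum => j _; rewrite mulr_sumr.
  apply: ler_sum => k _; apply: le_trans (ler_norm _) _; rewrite !normrM.
  rewrite [leRHS]mulrCA ler_wpM2l ?mulr_ge0// normfV.
  have bb (i : 'I_n) : `|b i| <= sq i ^+ 2 * blaschke_const t.
    by rewrite bE sq2 (cauchy_coef_le t01).
  rewrite (gtr0_norm (_ : 0 < sq j * sq k * (mu j + mu k))) ?mulr_gt0 ?addr_gt0//.
  rewrite ler_pdivrMr ?mulr_gt0 ?addr_gt0//.
  apply: (le_trans (ler_pM _ _ (bb j) (bb k))) => //.
  rewrite /lac_gram -/(sq j) -/(sq k) le_eqVlt; apply/orP; left; apply/eqP.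
  by field; rewrite gt_eqF// addr_gt0.
rewrite -/S -/x; have K0 := riesz_const_gt0.
have := inner_le_sqr x y riesz_const^-1; rewrite innerC xy => Q.
have T : riesz_const^-1 ^+ 2 * `|y| ^+ 2 <= riesz_const^-1 * S.
  rewrite expr2 -mulrA ler_wpM2l ?invr_ge0 ?(ltW K0)//.
  by rewrite ler_pdivrMl.
rewrite -ler_pdivrMl//; lra.
Qed.

End RieszLowerBound.

(** * Extension of bounded operators from a dense span *)

Lemma near_harmonic (R : realType) (e : R) : 0 < e ->
  \forall n \near \oo, n.+1%:R^-1 <= e.
Proof.
move=> e0; have /cvgrPdist_le/(_ _ e0) := @cvg_harmonic R.
by apply: filterS => n /=; rewrite sub0r normrN ger0_norm ?invr_ge0.
Qed.

Section Completeness.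
Variables (R : realType) (V : normedModType R).

Definition norm_cauchy (u : V^nat) := forall e : R, 0 < e ->
  exists N, forall m n, (N <= m)%N -> (N <= n)%N -> `|u m - u n| <= e.

Definition seq_complete := forall u : V^nat, norm_cauchy u -> cvgn u.

Lemma norm_cauchy_harmonic (u : V^nat) (C : R) :
  (forall m n, (m <= n)%N -> `|u m - u n| <= C * m.+1%:R^-1) -> norm_cauchy u.
Proof.
move=> uC e e0.
have [N HN] : exists N : nat, `|C| * N.+1%:R^-1 <= e.
  have [N HN] : exists N : nat, `|C| / e < N.+1%:R.
    by exists (Num.trunc (`|C| / e)); rewrite truncnS_gt.
  exists N; rewrite ler_pdivrMr// mulrC -ler_pdivrMr// ltW//.
have small m n : (N <= m)%N -> (m <= n)%N -> `|u m - u n| <= e.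
  move=> Nm mn; apply: (le_trans (uC _ _ mn)); apply: le_trans HN.
  apply: (@le_trans _ _ (`|C| * m.+1%:R^-1)).
    by rewrite ler_wpM2r// ler_norm.
  by rewrite ler_wpM2l// lef_pV2 ?posrE// ler_nat.
exists N => m n Nm Nn; case/orP: (leq_total m n) => ?; first exact: small.
by rewrite distrC small.
Qed.

End Completeness.

Lemma real_seq_complete (R : realType) : seq_complete R^o.
Proof.
move=> u uC; apply: cauchy_cvg; apply: cauchy_exP => e e0.
have [|N HN] := uC (e / 2); first by rewrite divr_gt0.
exists (u N); exists N => // n /= Nn; rewrite -ball_normE/=.
apply: (le_lt_trans (HN _ _ (leqnn N) Nn)).
by rewrite gtr_pMr// invf_lt1// ltr1n.
Qed.

Section LinearCombination.
Variables (R : realType) (V : lmodType R).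

Definition lincomb (e : nat -> V) n (c : nat -> R) := \sum_(k < n) c k *: e k.

(** Combinations of different lengths are added after both are padded by zeros. *)
Definition truncate n (c : nat -> R) k := if (k < n)%N then c k else 0.

Lemma lincomb_truncate e n m c : (n <= m)%N ->
  lincomb e m (truncate n c) = lincomb e n c.
Proof.
move=> nm; rewrite /lincomb -!(big_mkord xpredT (fun k => _ k *: e k)).
rewrite (@big_cat_nat _ _ _ n)//= [X in _ + X]big_nat.
rewrite [X in _ + X]big1 ?addr0 => [|k /andP[nk _]]; last first.
  by rewrite /truncate ltnNge nk scale0r.
by rewrite !big_mkord; apply: eq_bigr => k _; rewrite /truncate ltn_ord.
Qed.

Lemma lincomb_lin e a n c m d :
  a *: lincomb e n c + lincomb e m d =
  lincomb e (maxn n m) (fun k => a * truncate n c k + truncate m d k).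
Proof.
rewrite -(lincomb_truncate e c (leq_maxl n m)).
rewrite -(lincomb_truncate e d (leq_maxr n m)).
rewrite /lincomb scaler_sumr -big_split/=.
by apply: eq_bigr => k _; rewrite scalerDl scalerA.
Qed.

End LinearCombination.

Definition dense_span (R : realType) (V : normedModType R) (e : nat -> V) :=
  forall F (eps : R), 0 < eps -> exists n c, `|F - lincomb e n c| <= eps.

Lemma linear_lincomb (R : realType) (V W : lmodType R) (T : {linear V -> W}) e n c :
  T (lincomb e n c) = lincomb (T \o e) n c.
Proof. by rewrite linear_sum; apply: eq_bigr => k _; rewrite linearZ. Qed.

Section Extension.
Variables (R : realType) (V W : normedModType R).
Variables (e : nat -> V) (w : nat -> W) (C : R).
Hypothesis e_dense : dense_span e.
Hypothesis W_complete : seq_complete W.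
Hypothesis C_ge0 : 0 <= C.
Hypothesis wC : forall n c, `|lincomb w n c| <= C * `|lincomb e n c|.

Let graph F Y := forall eps : R, 0 < eps -> exists n c,
  `|F - lincomb e n c| <= eps /\ `|Y - lincomb w n c| <= eps.

Let graph_lin a F Y F' Y' : graph F Y -> graph F' Y' ->
  graph (a *: F + F') (a *: Y + Y').
Proof.
move=> FY FY' eps eps0.
have d0 : 0 < eps / (`|a| + 1) by rewrite divr_gt0// ltr_wpDl.
have [n [c [Hc1 Hc2]]] := FY _ d0; have [m [d [Hd1 Hd2]]] := FY' _ d0.
exists (maxn n m), (fun k => a * truncate n c k + truncate m d k).
have split (U : normedModType R) (x y x' y' : U) :
    `|x - y| <= eps / (`|a| + 1) -> `|x' - y'| <= eps / (`|a| + 1) ->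
    `|(a *: x + x') - (a *: y + y')| <= eps.
  move=> xy xy'; rewrite opprD addrACA -scalerBr.
  apply: (le_trans (ler_normD _ _)); rewrite normrZ.
  apply: (@le_trans _ _ (`|a| * (eps / (`|a| + 1)) + eps / (`|a| + 1))).
    by rewrite lerD// ler_wpM2l.
  rewrite -{2}[eps / _]mul1r -mulrDl mulrC divfK// gt_eqF// ltr_wpDl//.
by rewrite -!lincomb_lin; split; apply: split.
Qed.

Let graph_bound F Y : graph F Y -> `|Y| <= C * `|F|.
Proof.
move=> FY; apply/ler_addgt0Pr => eps eps0.
have d0 : 0 < eps / (C + 1) by rewrite divr_gt0// ltr_wpDl.
have [n [c [H1 H2]]] := FY _ d0.
have : `|Y| <= `|Y - lincomb w n c| + `|lincomb w n c|.
  by rewrite -{1}[Y](subrK (lincomb w n c)) ler_normD.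
have : `|lincomb e n c| <= `|F - lincomb e n c| + `|F|.
  by rewrite addrC -{1}[lincomb e n c](subKr F) ler_normB.
move/(ler_wpM2l C_ge0) => E1 E2; have := wC n c.
have : C * (eps / (C + 1)) + eps / (C + 1) = eps.
  by rewrite -{2}[eps / _]mul1r -mulrDl mulrC divfK// gt_eqF// ltr_wpDl.
have := ler_wpM2l C_ge0 H1; lra.
Qed.

Let graph_total F : exists Y, graph F Y.
Proof.
have /choice[s Hs] : forall m : nat, exists nc : nat * (nat -> R),
    `|F - lincomb e nc.1 nc.2| <= m.+1%:R^-1.
  by move=> m; have [|n [c H]] := @e_dense F m.+1%:R^-1; [|exists (n, c)].
pose u m := lincomb w (s m).1 (s m).2.
have uC : norm_cauchy u.
  apply: (@norm_cauchy_harmonic _ _ _ (C * 2)) => m n mn.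
  have -> : u m - u n = lincomb w (maxn (s n).1 (s m).1) (fun k =>
      -1 * truncate (s n).1 (s n).2 k + truncate (s m).1 (s m).2 k).
    by rewrite -lincomb_lin scaleN1r addrC.
  apply: (le_trans (wC _ _)); rewrite -mulrA ler_wpM2l//.
  rewrite -lincomb_lin scaleN1r addrC.
  rewrite -(subrKA F) mulrDl mul1r; apply: (le_trans (ler_normD _ _)).
  rewrite lerD// ?(distrC _ F)// (le_trans (Hs _))//.
  by rewrite lef_pV2 ?posrE// ler_nat.
have u_cvg := W_complete uC.
exists (limn u) => eps eps0.
have : \forall n \near \oo, `|limn u - u n| <= eps by move/cvgrPdist_le: u_cvg; apply.
move=> H1; have [m [Hm1 Hm2]] := filter_ex (filterI H1 (near_harmonic eps0)).
by exists (s m).1, (s m).2; split=> //; apply: (le_trans (Hs m)).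
Qed.

Let graph_uniq F Y Y' : graph F Y -> graph F Y' -> Y = Y'.
Proof.
move=> FY FY'; have := graph_lin (-1) FY FY'.
move/graph_bound; rewrite !scaleN1r !addNr normr0 mulr0 normr_le0 addrC subr_eq0.
by move=> /eqP.
Qed.

(** The closure of the graph of sum c_k e_k |-> sum c_k w_k is the graph of the
    extension: it is linear, it is total because W is complete, and the bound
    makes it single-valued. The combinations of the e_k may be given in several
    ways; the bound also ensures that the images agree. *)
Lemma bounded_extension :
  exists2 T : {linear V -> W}, forall k, T (e k) = w k &
    forall F, `|T F| <= C * `|F|.
Proof.
have /choice[f fP] := graph_total.
have f_lin : linear f.
  by move=> a F G; apply: (graph_uniq (fP _)); apply: graph_lin.
pose T : {linear V -> W} := HB.pack f (GRing.isLinear.Build R V W *:%R f f_lin).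
exists T => [k|F]; last exact: graph_bound.
apply: (graph_uniq (fP _)) => eps eps0; exists k.+1, (fun j => (j == k)%:R).
have E (U : lmodType R) (x : nat -> U) : lincomb x k.+1 (fun j => (j == k)%:R) = x k.
  rewrite /lincomb (bigD1 ord_max)//= eqxx scale1r big1 ?addr0// => j.
  by rewrite -val_eqE/= => /negPf ->; rewrite scale0r.
by rewrite !E !subrr !normr0 ltW.
Qed.

Lemma bound_extends (L : V -> W) (B D : R) : 0 <= B -> 0 <= D ->
  (forall F G, `|L F - L G| <= B * `|F - G|) ->
  (forall n c, `|L (lincomb e n c)| <= D * `|lincomb e n c|) ->
  forall F, `|L F| <= D * `|F|.
Proof.
move=> B0 D0 L_lip LD F; apply/ler_addgt0Pr => eps eps0.
have d0 : 0 < eps / (B + D + 1) by rewrite divr_gt0// ltr_wpDl// addr_ge0.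
have [n [c H]] := e_dense F d0.
have : `|L F| <= `|L F - L (lincomb e n c)| + `|L (lincomb e n c)|.
  by rewrite -{1}[L F](subrK (L (lincomb e n c))) ler_normD.
have : `|lincomb e n c| <= `|F - lincomb e n c| + `|F|.
  by rewrite addrC -{1}[lincomb e n c](subKr F) ler_normB.
move/(ler_wpM2l D0) => E1 E2; have E3 := LD n c.
have E4 := L_lip F (lincomb e n c).
have E5 := ler_wpM2l B0 H; have E6 := ler_wpM2l D0 H.
have : (B + D + 1) * (eps / (B + D + 1)) = eps.
  by rewrite mulrC divfK// gt_eqF// ltr_wpDl// addr_ge0.
lra.
Qed.

End Extension.

(** * Operators approximated by operators of finite rank *)

Section RieszOperator.
Variables (R : realType) (V W : normedModType R).
Variables (e : nat -> V) (w : nat -> W) (K : R) (kappa : nat -> R).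
Hypothesis e_dense : dense_span e.
Hypothesis W_complete : seq_complete W.
Hypothesis K_ge0 : 0 <= K.
Hypothesis kappa_ge0 : forall m, 0 <= kappa m.
Hypothesis e_lower : forall n (c : nat -> R),
  \sum_(k < n) c k ^+ 2 <= K * `|lincomb e n c| ^+ 2.
Hypothesis w_tail : forall m n (c : nat -> R),
  `|\sum_(k < n | (m <= k)%N) c k *: w k| ^+ 2 <= kappa m * \sum_(k < n) c k ^+ 2.

Let tail_le m n (c : nat -> R) : `|\sum_(k < n | (m <= k)%N) c k *: w k| <=
  Num.sqrt (kappa m * K) * `|lincomb e n c|.
Proof.
rewrite -(@ler_pXn2r _ 2)// ?nnegrE ?mulr_ge0 ?sqrtr_ge0//.
rewrite exprMn sqr_sqrtr ?mulr_ge0// -mulrA.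
by apply: (le_trans (w_tail _ _ _)); rewrite ler_wpM2l.
Qed.

(** The lower Riesz bound makes the coordinates al_k bounded functionals on the
    span, hence on V. The partial sums of al_k(F) w_k are then operators of
    finite rank, and their distance to T is controlled by the tails of the w_k;
    this holds on the span and passes to V by continuity. *)
Lemma riesz_operator : exists (T : {linear V -> W}) (al : nat -> {linear V -> R^o}),
  [/\ forall k, T (e k) = w k,
      forall F, `|T F| <= Num.sqrt (kappa 0 * K) * `|F|,
      forall k F, `|al k F| <= Num.sqrt K * `|F| &
      forall m F, `|T F - \sum_(k < m) (al k F : R) *: w k| <=
                  Num.sqrt (kappa m * K) * `|F|].
Proof.
have [|T Te TC] := bounded_extension e_dense W_complete
    (sqrtr_ge0 (kappa 0 * K)) (w := w).
  by move=> n c; apply: le_trans (tail_le 0 n c); rewrite le_eqVlt; apply/orP; left.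
have sum_delta k n (c : nat -> R) :
    \sum_(j < n) c j *: ((j : nat) == k)%:R = truncate n c k :> R^o.
  rewrite /truncate; case: ltnP => kn.
    rewrite (bigD1 (Ordinal kn))//= eqxx big1 ?addr0 ?/GRing.scale/= ?mulr1//.
    by move=> j; rewrite -val_eqE/= => /negPf ->; rewrite mulr0.
  rewrite big1// => j _; have := ltn_ord j; rewrite /GRing.scale/=.
  by case: eqP => [->|_ _]; rewrite ?mulr0// ltnNge kn.
have al_ex k : exists2 a : {linear V -> R^o}, forall j, a (e j) = (j == k)%:R :> R^o &
    forall F, `|a F| <= Num.sqrt K * `|F|.
  apply: bounded_extension => //; first exact: real_seq_complete.
  move=> n c; rewrite /lincomb sum_delta.
  rewrite -(@ler_pXn2r _ 2)// ?nnegrE ?mulr_ge0 ?sqrtr_ge0//.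
  rewrite exprMn sqr_sqrtr//; apply: le_trans (e_lower _ _).
  rewrite real_normK ?num_real// /truncate; case: ltnP => kn.
    by rewrite (bigD1 (Ordinal kn))//= lerDl sumr_ge0// => j _; rewrite sqr_ge0.
  by rewrite expr0n/= sumr_ge0// => j _; rewrite sqr_ge0.
have [al alE alK] : exists2 al : nat -> {linear V -> R^o},
    forall k j, al k (e j) = (j == k)%:R :> R^o &
    forall k F, `|al k F| <= Num.sqrt K * `|F|.
  have /choice[al Hal] : forall k, exists a : {linear V -> R^o},
     (forall j, a (e j) = (j == k)%:R :> R^o) /\
    forall F, `|a F| <= Num.sqrt K * `|F|.
    by move=> k; have [a] := al_ex k; exists a.
  by exists al => k; have [] := Hal k.
exists T, al; split=> // m F.
pose B := Num.sqrt (kappa 0 * K) + \sum_(k < m) Num.sqrt K * `|w k|.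
apply: (@bound_extends _ _ _ e e_dense
  (fun F => T F - \sum_(k < m) (al k F : R) *: w k) B).
- by rewrite addr_ge0 ?sqrtr_ge0// sumr_ge0// => k _; rewrite mulr_ge0 ?sqrtr_ge0.
- exact: sqrtr_ge0.
- move=> G H /=.
  rewrite opprD addrACA -linearB -opprD -sumrB.
  under eq_bigr do rewrite -scalerBl -linearB.
  apply: (le_trans (ler_normB _ _)); rewrite mulrDl lerD// mulr_suml.
  apply: (le_trans (ler_norm_sum _ _ _)); apply: ler_sum => k _.
  by rewrite normrZ mulrAC ler_wpM2r.
- move=> n c; apply: le_trans (tail_le m n c); rewrite le_eqVlt.
  apply/orP; left; apply/eqP; congr (`| _ |).
  have alc k : al k (lincomb e n c) = truncate n c k :> R^o.
    by rewrite linear_lincomb /lincomb -sum_delta; apply: eq_bigr => j _ /=; rewrite alE.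
  under eq_bigr do rewrite alc.
  have -> : T (lincomb e n c) = lincomb w n c.
    by rewrite linear_lincomb; apply: eq_bigr => j _ /=; rewrite Te.
  rewrite -[X in X - _](lincomb_truncate w c (leq_maxl n m)).
  have -> : \sum_(k < m) truncate n c k *: w k =
    \sum_(k < maxn n m | (k < m)%N) truncate n c k *: w k.
    rewrite -(big_mkord xpredT (fun k => truncate n c k *: w k)).
    rewrite -(big_mkord (fun k => (k < m)%N) (fun k => truncate n c k *: w k)).
    by rewrite -(@big_nat_widen _ _ _ _ _ _ xpredT) ?leq_maxr.
  rewrite /lincomb [X in X - _](bigID (fun k : 'I_(maxn n m) => (k < m)%N))/=.
  rewrite [X in X - _]addrC addrK.
  rewrite -(big_mkord (fun k => ~~ (k < m)%N) (fun k => truncate n c k *: w k)).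
  rewrite -(big_mkord (fun k => (m <= k)%N) (fun k => c k *: w k)).
  rewrite (@big_cat_nat _ _ _ n)//= ?leq_maxl// [X in _ + X]big_nat_cond.
  rewrite [X in _ + X]big1 ?addr0 => [|k /andP[/andP[nk _] _]]; last first.
    by rewrite /truncate ltnNge nk scale0r.
  rewrite big_nat_cond [RHS]big_nat_cond; apply: eq_big => k.
    by rewrite -leqNgt.
  by move=> /andP[/andP[_ kn] _]; rewrite /truncate kn.
Qed.

End RieszOperator.

Section TotallyBounded.
Variables (R : realType) (W : normedModType R).
Hypothesis W_complete : seq_complete W.

(** A totally bounded subset of a complete space, with compact sets in place of
    finite ones as approximants. An ultrafilter on A is pushed to a nearby
    compact set, where it clusters; hence it contains arbitrarily small balls and
    converges. *)
Lemma compact_closure (A : set W) :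
  (forall eps : R, 0 < eps -> exists2 K, compact K &
    forall a, A a -> exists2 k, K k & `|a - k| <= eps) ->
  compact (closure A).
Proof.
move=> AK; rewrite compact_ultra => F UF FA.
have small (eps : R) : 0 < eps -> exists x, F [set y | `|x - y| <= eps].
  move=> eps0; have d0 : 0 < eps / 4 by rewrite divr_gt0.
  have [K cK HK] := AK _ d0.
  (* f moves the points of the closure to the compact set K *)
  have /choice[f Hf] : forall a, exists k, closure A a -> K k /\ `|a - k| <= eps / 2.
    move=> a; have [clAa|] := pselect (closure A a); last by exists 0.
    have [a' [/= Aa' aa']] := clAa _ (nbhsx_ballx a _ d0).
    have [k Kk ak] := HK _ Aa'; exists k => _; split=> //.
    move: aa'; rewrite -ball_normE/= => aa'.
    have := ler_normD (a - a') (a' - k); rewrite subrKA; lra.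
  have [x [Kx clx]] := cK (f @ F) _ (filterS (fun a ca => (Hf a ca).1) FA).
  exists x; have [//|FC] := in_ultra_setVsetC [set y | `|x - y| <= eps] UF.
  have FAC : F (closure A `&` ~` [set y | `|x - y| <= eps]) by apply: filterI.
  have fFS : (f @ F) [set k | eps / 2 <= `|x - k|].
    have : F [set a | eps / 2 <= `|x - f a|].
      apply: filterS FAC => a [/Hf[_ af] /= /negP]; rewrite -ltNge => xa.
      by have := ler_normD (x - f a) (f a - a); rewrite subrKA (distrC (f a)); lra.
    by [].
  have [y [/= Sy]] := clx _ _ fFS (nbhsx_ballx x _ d0).
  by rewrite -ball_normE/= => xy; move: Sy; lra.
have /choice[x Hx] : forall n : nat, exists x, F [set y | `|x - y| <= n.+1%:R^-1].
  by move=> n; apply: small.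
have xC : norm_cauchy x.
  apply: (@norm_cauchy_harmonic _ _ _ 2) => m n mn.
  have [y [/= ym yn]] := filter_ex (filterI (Hx m) (Hx n)).
  have : (n.+1%:R^-1 : R) <= m.+1%:R^-1 by rewrite lef_pV2 ?posrE// ler_nat.
  have := ler_normD (x m - y) (y - x n); rewrite subrKA (distrC y).
  by move: (m.+1%:R^-1) (n.+1%:R^-1) ym yn => a b ym yn; lra.
have xl := W_complete xC.
have Fl : F --> limn x.
  apply/cvgrPdist_le => eps eps0; have d0 : 0 < eps / 2 by rewrite divr_gt0.
  have H1 : \forall n \near \oo, `|limn x - x n| <= eps / 2.
    by move/cvgrPdist_le: xl; apply.
  have [n [Hn1 Hn2]] := filter_ex (filterI H1 (near_harmonic d0)).
  apply: filterS (Hx n) => y /= xy.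
  have := ler_normD (limn x - x n) (x n - y); rewrite subrKA.
  by move: (n.+1%:R^-1) xy Hn2 => a xy Hn2; lra.
exists (limn x); split=> //.
apply: closed_closure => B nB.
by have [y Hy] := filter_ex (filterI FA (Fl _ nB)); exists y.
Qed.

End TotallyBounded.

(** The finite-rank approximants send a ball into such a set. *)
Lemma finite_box_compact (R : realType) (W : normedModType R) (w : nat -> W) n (B : R) :
  compact [set \sum_(k < n) c ord0 k *: w k | c in
    [set c : 'rV[R]_n | forall k, `[- B, B]%classic (c ord0 k)]].
Proof.
apply: continuous_compact.
  apply: continuous_subspaceT; apply: continuous_big => [|k _ c]; first exact: add_continuous.
  have ck := @coord_continuous R 1 n ord0 k c.
  exact: (cvgZr_tmp ck).
by apply: (@rV_compact _ _ (fun=> `[- B, B]%classic)) => k; exact: segment_compact.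
Qed.

Lemma approximable_compact (R : realType) (V W : preHilbertType R)
    (T : V -> W) (al : nat -> V -> R) (w : nat -> W) (A : R) (eps : nat -> R) :
  seq_complete W ->
  (forall k F, `|al k F| <= A * `|F|) ->
  (forall m F, `|T F - \sum_(k < m) al k F *: w k| <= eps m * `|F|) ->
  eps @ \oo --> 0 -> compact_op T.
Proof.
move=> W_complete alA Teps eps0; rewrite /compact_op precompactE.
apply: compact_closure => // d d0.
have [m Hm] : exists m, `|eps m| <= d.
  have /cvgrPdist_le/(_ _ d0) := eps0.
  by move=> /filter_ex[m /=]; rewrite sub0r normrN; exists m.
exists [set \sum_(k < m) c ord0 k *: w k | c in
    [set c : 'rV[R]_m | forall k, `[- `|A|, `|A|]%classic (c ord0 k)]].
  exact: finite_box_compact.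
move=> _ [F /= F1 <-]; exists (\sum_(k < m) al k F *: w k).
  exists (\row_(k < m) al k F).
    move=> k /=; rewrite mxE in_itv/= -ler_norml; apply: (le_trans (alA k F)).
    by apply: (le_trans (ler_norm _)); rewrite normrM normr_id ler_piMr.
  by apply: eq_bigr => k _; rewrite mxE.
apply: (le_trans (Teps m F)); apply: le_trans Hm.
by apply: (le_trans (ler_norm _)); rewrite normrM normr_id ler_piMr.
Qed.

(** * Singular systems of compact operators *)

Section NormAttained.
Variables (R : realType) (V W : preHilbertType R) (T : {linear V -> W}) (B : R).
Hypothesis V_complete : seq_complete V.
Hypothesis TB : forall x, `|T x| <= B * `|x|.
Hypothesis T_compact : compact_op T.

Lemma bounded_cvg (u : V^nat) x : u @ \oo --> x -> T (u n) @[n --> \oo] --> T x.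
Proof.
move=> ux; apply/cvgrPdist_le => e e0.
have d0 : 0 < e / (`|B| + 1) by rewrite divr_gt0// ltr_wpDl.
move/cvgrPdist_le: ux => /(_ _ d0); apply: filterS => n Hn.
rewrite -linearB; apply: (le_trans (TB _)).
apply: (@le_trans _ _ (`|B| * (e / (`|B| + 1)))).
  by apply: (le_trans (ler_wpM2r _ (ler_norm B))) => //; rewrite ler_wpM2l.
rewrite mulrCA ler_piMr ?(ltW e0)// ler_pdivrMr ?ltr_wpDl// mul1r lerDl//.
Qed.

Variable s : seq V.
Definition orth_to (x : V) := forall y, y \in s -> inner x y = 0 :> R.

Lemma orth_lin a x y : orth_to x -> orth_to y -> orth_to (a *: x + y).
Proof. by move=> xs ys z zs; rewrite inner_linear xs// ys// mulr0 addr0. Qed.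

Lemma orthZ a x : orth_to x -> orth_to (a *: x).
Proof. by move=> xs z zs; rewrite innerZl xs// mulr0. Qed.

Lemma orth_closed (u : V^nat) x : (forall n, orth_to (u n)) ->
  u @ \oo --> x -> orth_to x.
Proof.
move=> us ux y ys.
have ci : inner (u n) y @[n --> \oo] --> (inner x y : R).
  have := cvg_comp _ _ ux (@inner_continuous R V y x). by [].
have c0 : (fun n => inner (u n) y : R) = cst 0 by apply/funext => n; exact: us.
move: ci; rewrite c0 => ci; exact: (cvg_unique _ ci (cvg_cst _)).
Qed.

(** The largest value sigma of |T x| on the unit ball of the orthogonal complement
    of s is attained. By compactness the images of a maximising sequence may be
    assumed to converge to some y, of norm sigma. Then T (x_m + x_n) is close to
    2 y, which forces |x_m + x_n| to be close to 2; by the parallelogram law the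
    sequence itself is Cauchy. If sigma = 0 the vector 0 is chosen. *)
Lemma norm_attained : exists x, [/\ orth_to x, x = 0 \/ `|x| = 1 &
  forall z, orth_to z -> `|T z| <= `|T x| * `|z|].
Proof.
pose E := [set `|T x| | x in [set x | orth_to x /\ `|x| <= 1]].
have E0 : E 0.
  exists 0; last by rewrite linear0 normr0.
  by split=> [y _|]; rewrite ?inner0l// normr0.
have supE : has_sup E.
  split; first by exists 0.
  exists `|B| => _ [x [_ x1] <-]; apply: (le_trans (TB x)).
  by apply: (le_trans (ler_norm _)); rewrite normrM normr_id ler_piMr.
pose sg := sup E.
have sg_ub z : orth_to z -> `|T z| <= sg * `|z|.
  move=> zs; have [->|z0] := eqVneq z 0; first by rewrite linear0 !normr0 mulr0.
  rewrite -ler_pdivrMr ?normr_gt0//.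
  apply: (ub_le_sup (proj2 supE)); exists (`|z|^-1 *: z).
    split; first exact: orthZ.
    by rewrite normrZ normfV normr_id mulVf ?normr_eq0.
  by rewrite linearZ normrZ normfV normr_id mulrC.
have sg_ge0 : 0 <= sg by exact: (ub_le_sup (proj2 supE)).
have [sg0|sg_neq0] := eqVneq sg 0.
  exists 0; split; [by move=> y _; rewrite inner0l|by left|].
  by move=> z /sg_ub; rewrite sg0 linear0 normr0.
have sg_gt0 : 0 < sg by rewrite lt_neqAle eq_sym sg_neq0.
have /choice[x Hx] : forall n : nat, exists x,
    [/\ orth_to x, `|x| <= 1 & sg - n.+1%:R^-1 <= `|T x|].
  move=> n; have n0 : 0 < n.+1%:R^-1 :> R by [].
  have [_ [x [xs x1] <-] Hx] := sup_adherent n0 supE.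
  by exists x; split=> //; exact: ltW.
(* y is a cluster point of the images of the maximising sequence x *)
have [y _ yx] : exists2 y, closure (T @` [set x | `|x| <= 1]) y &
    cluster ((T \o x) @ \oo) y.
  have := T_compact; rewrite /compact_op precompactE => cT.
  have [|y [? ?]] := cT ((T \o x) @ \oo); last by exists y.
  by exists 0%N => // n _ /=; apply: subset_closure; exists (x n) => //; have [] := Hx n.
have /choice[f Hf] : forall k : nat, exists n, (k <= n)%N /\ `|y - T (x n)| <= k.+1%:R^-1.
  move=> k; have k0 : 0 < k.+1%:R^-1 :> R by [].
  have nk : ((T \o x) @ \oo) [set T (x n) | n in [set n | (k <= n)%N]].
    by exists k => // n /= kn; exists n.
  have [_ [[n /= kn <-]]] := yx _ _ nk (nbhsx_ballx y _ k0).
  by rewrite -ball_normE/= => /ltW; exists n.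
pose z k := x (f k).
have zs k : orth_to (z k) by have [] := Hx (f k).
have z1 k : `|z k| <= 1 by have [] := Hx (f k).
have zy k : `|y - T (z k)| <= k.+1%:R^-1 by have [] := Hf k.
have zsg k : sg - k.+1%:R^-1 <= `|T (z k)|.
  have [_ _] := Hx (f k); apply: le_trans; rewrite lerD2l lerN2.
  by rewrite lef_pV2 ?posrE// ler_nat ltnS; have [] := Hf k.
(* parallelogram law: 2 sigma - 6 a <= sigma p gives 4 - p ^ 2 <= 24 a / sigma,
   where a = 1 / (m + 1) and p = |z_m + z_n| *)
have zmn m n : (m <= n)%N -> `|z m - z n| ^+ 2 <= 24 / sg * m.+1%:R^-1.
  move=> mn; rewrite parallelogram.
  have rn : (n.+1%:R^-1 : R) <= m.+1%:R^-1 by rewrite lef_pV2 ?posrE// ler_nat.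
  have zm2 : `|z m| ^+ 2 <= 1 by rewrite -[leRHS](expr1n _ 2) ler_pXn2r ?nnegrE.
  have zn2 : `|z n| ^+ 2 <= 1 by rewrite -[leRHS](expr1n _ 2) ler_pXn2r ?nnegrE.
  have H1 : `|T (z m + z n)| <= sg * `|z m + z n|.
    by apply: sg_ub; have := orth_lin 1 (zs m) (zs n); rewrite scale1r.
  have H2 : sg - m.+1%:R^-1 <= `|y| + m.+1%:R^-1.
    apply: (le_trans (zsg m)); have := ler_normB y (y - T (z m)); rewrite subKr.
    have := zy m; move: (m.+1%:R^-1) => a; lra.
  have H3 : 2 * `|y| <= `|T (z m + z n)| + m.+1%:R^-1 + n.+1%:R^-1.
    have -> : 2 * `|y| = `|2 *: y| by rewrite normrZ ger0_norm.
    have -> : 2 *: y = T (z m + z n) + ((y - T (z m)) + (y - T (z n))).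
      by rewrite linearD addrACA !(addrC (T _)) !subrK scaler_nat mulr2n.
    apply: (le_trans (ler_normD _ _)); rewrite -[leRHS]addrA lerD2l.
    by apply: (le_trans (ler_normD _ _)); rewrite lerD.
  move: (m.+1%:R^-1) (n.+1%:R^-1) (invr_ge0 (m.+1%:R : R)) rn H1 H2 H3 => a b.
  rewrite ler0n => a0 ba H1 H2 H3.
  set p := `|z m + z n| in H1 *.
  have p0 : 0 <= p by exact: normr_ge0.
  have H4 : 2 * sg - 6 * a <= sg * p by lra.
  have : 4 - p ^+ 2 <= 24 / sg * a.
    rewrite mulrAC ler_pdivlMr//.
    have [p2|p2] := leP 2 p.
      have p4 : 0 <= p ^+ 2 - 4 by nra.
      by have := mulr_ge0 p4 (ltW sg_gt0); lra.
    have H5 : sg * (2 - p) <= 6 * a by lra.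
    have p4 : 0 <= 2 + p <= 4 by lra.
    case/andP: p4 => p4 p4'; have := ler_wpM2r p4 H5.
    have := ler_wpM2l a0 p4'; lra.
  lra.
have zC : norm_cauchy z.
  move=> e e0.
  have d0 : 0 < e ^+ 2 / (24 / sg) by rewrite divr_gt0 ?exprn_gt0// divr_gt0.
  have [N _ HN] := near_harmonic d0.
  have small m n : (N <= m)%N -> (m <= n)%N -> `|z m - z n| <= e.
    move=> Nm mn; rewrite -(@ler_pXn2r _ 2)// ?nnegrE ?(ltW e0)//.
    apply: (le_trans (zmn _ _ mn)); rewrite mulrC -ler_pdivlMr ?divr_gt0//.
    exact: HN.
  exists N => m n Nm Nn; case/orP: (leq_total m n) => ?; first exact: small.
  by rewrite distrC small.
have zl := V_complete zC; set l := limn z in zl.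
have ls : orth_to l by exact: orth_closed zl.
have l1 : `|l| <= 1.
  apply/ler_addgt0Pr => e e0; have /cvgrPdist_le/(_ _ e0) := zl.
  move=> /filter_ex[n /= Hn]; have := ler_normD (l - z n) (z n).
  by rewrite subrK; have := z1 n; lra.
have lsg : sg <= `|T l|.
  apply/ler_addgt0Pr => e e0; have d0 : 0 < e / 2 by rewrite divr_gt0.
  have /cvgrPdist_le/(_ _ d0) H1 := bounded_cvg zl.
  have [n [/= Hn1 Hn2]] := filter_ex (filterI H1 (near_harmonic d0)).
  have := ler_normB (T l) (T l - T (z n)); rewrite subKr.
  by have := zsg n; move: (n.+1%:R^-1) Hn2 => a; lra.
exists l; split=> //.
- right; apply/eqP; rewrite eq_le l1/=.
  by rewrite -(ler_pM2l sg_gt0) mulr1 (le_trans lsg)// sg_ub.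
- by move=> w ws; apply: (le_trans (sg_ub _ ws)); rewrite ler_wpM2r.
Qed.

End NormAttained.

(** The right singular vectors, listed by decreasing singular values |T (v_n)|. By
    the last clause v_n = 0 is possible only if T vanishes on the orthogonal
    complement of the previous vectors. *)
Definition singular_system (R : realType) (V W : preHilbertType R) (T : V -> W)
    (v : nat -> V) :=
  [/\ forall j k, j != k -> inner (v j) (v k) = 0 :> R,
      forall k, v k = 0 \/ `|v k| = 1 &
      forall n z, (forall j, (j < n)%N -> inner z (v j) = 0 :> R) ->
        `|T z| <= `|T (v n)| * `|z|].

Lemma singular_system_exists (R : realType) (V W : preHilbertType R)
    (T : {linear V -> W}) (B : R) :
  seq_complete V -> (forall x, `|T x| <= B * `|x|) -> compact_op T ->
  exists v, singular_system T v.
Proof.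
move=> V_complete TB T_compact.
have /choice[f Hf] := norm_attained V_complete TB T_compact.
pose build := fix build n := if n is m.+1 then rcons (build m) (f (build m)) else [::].
pose v n := f (build n).
have mem_build n y : y \in build n -> exists2 j, (j < n)%N & y = v j.
  elim: n => //= n IH; rewrite mem_rcons inE => /orP[/eqP ->|/IH[j jn ->]].
    by exists n.
  by exists j => //; exact: ltnW.
have build_mem n j : (j < n)%N -> v j \in build n.
  elim: n => // n IH; rewrite ltnS leq_eqVlt mem_rcons inE.
  by case/orP => [/eqP ->|/IH ->]; rewrite ?eqxx ?orbT.
have vlt j k : (j < k)%N -> inner (v k) (v j) = 0 :> R.
  by move=> jk; have [+ _ _] := Hf (build k); apply; exact: build_mem.
exists v; split=> [j k|k|n z zv].
- by case: (ltngtP j k) => // [/vlt|/vlt//]; rewrite innerC.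
- by have [] := Hf (build k).
- have [_ _] := Hf (build n); apply => y /mem_build[j jn ->]; exact: zv.
Qed.

Section SingularSystem.
Variables (R : realType) (V W : preHilbertType R) (T : {linear V -> W}).
Variable v : nat -> V.
Hypothesis v_sing : singular_system T v.

Let sg k := `|T (v k)|.

Let sg_ge0 k : 0 <= sg k. Proof. exact: normr_ge0. Qed.

Let v_orth j k : j != k -> inner (v j) (v k) = 0 :> R.
Proof. by case: v_sing => + _ _; apply. Qed.

Let v01 k : v k = 0 \/ `|v k| = 1. Proof. by case: v_sing. Qed.

Let v_max n z : (forall j, (j < n)%N -> inner z (v j) = 0 :> R) ->
  `|T z| <= sg n * `|z|.
Proof. by case: v_sing => _ _; apply. Qed.

Lemma singular_vector_inner x k : inner x (v k) * inner (v k) (v k) = inner x (v k) :> R.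
Proof.
have [->|v1] := v01 k; first by rewrite !inner0r mul0r.
by rewrite inner_norm v1 expr1n mulr1.
Qed.

(** Since the v_j have norm 0 or 1, this is the projection of x on the orthogonal
    complement of v_0, ..., v_(n-1). *)
Definition residual n x := x - \sum_(j < n) (inner x (v j) : R) *: v j.

Lemma partial_coord n x k : inner (\sum_(j < n) (inner x (v j) : R) *: v j) (v k) =
  (if (k < n)%N then inner x (v k) else 0) :> R.
Proof.
rewrite inner_suml; case: ltnP => kn.
  rewrite (bigD1 (Ordinal kn))//= innerZl singular_vector_inner big1 ?addr0// => j.
  by rewrite -val_eqE/= => jk; rewrite innerZl v_orth// mulr0.
rewrite big1// => j _; rewrite innerZl v_orth ?mulr0//.
by rewrite neq_ltn (leq_trans (ltn_ord j) kn).
Qed.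

Lemma residual_orth n x j : (j < n)%N -> inner (residual n x) (v j) = 0 :> R.
Proof. by move=> jn; rewrite innerBl partial_coord jn subrr. Qed.

Lemma residual_le n x : `|residual n x| <= `|x|.
Proof.
rewrite -(@ler_pXn2r _ 2)// ?nnegrE//.
have := sqr_normD (residual n x) (\sum_(j < n) (inner x (v j) : R) *: v j).
rewrite subrK => ->; rewrite inner_sumr big1 => [|j _]; last first.
  by rewrite innerZr residual_orth// mulr0.
by rewrite mulr0 addr0 lerDl sqr_ge0.
Qed.

Lemma singular_coord_le x k : `|inner x (v k) : R| <= `|x|.
Proof.
apply: (le_trans (cauchy_schwarz _ _)); have [->|->] := v01 k.
  by rewrite normr0 mulr0.
by rewrite mulr1.
Qed.

Lemma T_residual n x : `|T (residual n x)| <= sg n * `|x|.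
Proof.
apply: (le_trans (v_max (@residual_orth n x))).
by rewrite ler_wpM2l ?residual_le.
Qed.

Lemma singular_anti n : sg n.+1 <= sg n.
Proof.
apply: (le_trans (v_max (n := n) _)) => [j jn|].
  by rewrite v_orth// neq_ltn (leqW jn) orbT.
have [->|->] := v01 n.+1; last by rewrite mulr1.
by rewrite normr0 mulr0.
Qed.

Lemma singular_antitone m n : (m <= n)%N -> sg n <= sg m.
Proof.
move=> /subnK <-; elim: (n - m)%N => [|k IH]//.
by rewrite addSn (le_trans (singular_anti _)).
Qed.

(** The first variation of |T x| / |x| at its maximiser v_k. *)
Lemma singular_variation k z : (forall j, (j <= k)%N -> inner z (v j) = 0 :> R) ->
  inner (T (v k)) (T z) = 0 :> R.
Proof.
move=> zv; have [v0|v1] := v01 k; first by rewrite v0 linear0 inner0l.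
set i := inner _ _.
pose c := sg k ^+ 2 * `|z| ^+ 2.
have c0 : 0 <= c by rewrite mulr_ge0// sqr_ge0.
have key t : 2 * t * i <= t ^+ 2 * c.
  have : `|T (v k + t *: z)| ^+ 2 <= (sg k * `|v k + t *: z|) ^+ 2.
    rewrite ler_pXn2r ?nnegrE ?mulr_ge0//; apply: v_max => j jk.
    by rewrite innerDl innerZl zv ?(ltnW jk)// v_orth ?mulr0 ?addr0// neq_ltn jk orbT.
  rewrite exprMn linearD linearZ !sqr_normD !sqr_normZ !innerZr v1.
  rewrite (innerC (v k) z) zv// mulr0 mulr0 addr0 expr1n -/(sg k) -/i /c.
  by have := sqr_ge0 `|T z|; have := sqr_ge0 t; nra.
have c1 : 0 < c + 1 by rewrite ltr_wpDl.
(* t proportional to i makes the linear term dominate the quadratic one *)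
have := key (i / (c + 1)).
have -> : 2 * (i / (c + 1)) * i = (i / (c + 1)) ^+ 2 * (2 * (c + 1)).
  by field; rewrite gt_eqF.
rewrite -subr_ge0 -mulrBr => H.
have : (i / (c + 1)) ^+ 2 = 0.
  apply/eqP; rewrite eq_le sqr_ge0 andbT.
  have c2 : 0 < c + 2 by rewrite ltr_wpDl.
  by move: H; set q := _ ^+ 2; nra.
by move=> /eqP; rewrite sqrf_eq0 mulf_eq0 invr_eq0 (gt_eqF c1) orbF => /eqP.
Qed.

Lemma image_orth j k : j != k -> inner (T (v j)) (T (v k)) = 0 :> R.
Proof.
wlog jk : j k / (j < k)%N.
  move=> H; case: (ltngtP j k) => // [jk|kj] _; first by rewrite H// neq_ltn jk.
  by rewrite innerC H// neq_ltn kj.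
move=> _; apply: singular_variation => i ij; apply: v_orth.
by rewrite neq_ltn (leq_ltn_trans ij jk) orbT.
Qed.

(** So v_k is an eigenvector of T^* T for the eigenvalue |T (v_k)|^2, stated without
    the adjoint. *)
Lemma image_coord x k : inner (T x) (T (v k)) = sg k ^+ 2 * inner x (v k) :> R.
Proof.
rewrite -{1}[x](subrK (\sum_(j < k.+1) (inner x (v j) : R) *: v j)) linearD innerDl.
rewrite innerC singular_variation => [|j jk]; last exact: residual_orth.
rewrite add0r linear_sum inner_suml (bigD1 ord_max)//= linearZ innerZl inner_norm.
rewrite big1 ?addr0 1?[LHS]mulrC// => j; rewrite -val_eqE/= => jk.
by rewrite linearZ innerZl image_orth// mulr0.
Qed.

(** Singular values are at most approximation numbers: the n conditions
    al_k(x) = 0 have a nonzero solution x in the span of v_0, ..., v_n, where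
    |T x| >= sg n |x|, while the approximant vanishes at x. *)
Lemma singular_le_approx n (al : nat -> {linear V -> R^o}) (w : nat -> W) (eps : R) :
  0 <= eps ->
  (forall F, `|T F - \sum_(k < n) (al k F : R) *: w k| <= eps * `|F|) ->
  sg n <= eps.
Proof.
move=> eps0 Teps; rewrite leNgt; apply/negP => sgn.
have v1 (j : 'I_n.+1) : `|v j| = 1.
  have [v0|//] := v01 j.
  have := singular_antitone (ltn_ord j : (j <= n)%N).
  by rewrite /sg v0 linear0 normr0 leNgt (le_lt_trans eps0 sgn).
pose M : 'M[R]_(n.+1, n) := \matrix_(j, k) al k (v j).
have ker0 : kermx M != 0.
  rewrite kermx_eq0 /row_free; apply/negP => /eqP rM.
  by have := rank_leq_col M; rewrite rM ltnn.
pose u := nz_row (kermx M).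
have u0 : u != 0 by rewrite nz_row_eq0.
have uM : u *m M = 0 by apply/sub_kermxP; exact: nz_row_sub.
pose x := \sum_(j < n.+1) u ord0 j *: v j.
have alx (k : 'I_n) : al k x = 0.
  have H : \sum_j u ord0 j * M j k = 0.
    by have /matrixP/(_ ord0 k) := uM; rewrite !mxE.
  apply: etrans H; rewrite linear_sum; apply: eq_bigr => j _.
  by rewrite linearZ mxE.
have sq_sum (U : preHilbertType R) (y : 'I_n.+1 -> U) :
    (forall i j, i != j -> inner (y i) (y j) = 0 :> R) ->
    `|\sum_j u ord0 j *: y j| ^+ 2 = \sum_j u ord0 j ^+ 2 * `|y j| ^+ 2.
  move=> yo; rewrite -inner_norm inner_suml; apply: eq_bigr => j _.
  rewrite inner_sumr (bigD1 j)//= big1 => [|i ij].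
    by rewrite innerZl innerZr inner_norm addr0 mulrA expr2.
  by rewrite innerZl innerZr yo ?mulr0// eq_sym.
have xx : `|x| ^+ 2 = \sum_j u ord0 j ^+ 2.
  rewrite sq_sum => [|i j ij]; last by rewrite v_orth.
  by apply: eq_bigr => j _; rewrite v1 expr1n mulr1.
have Txx : `|T x| ^+ 2 = \sum_j u ord0 j ^+ 2 * sg j ^+ 2.
  rewrite linear_sum; under eq_bigr do rewrite linearZ.
  by rewrite sq_sum// => i j ij; exact: image_orth.
have x0 : 0 < `|x|.
  rewrite normr_gt0; apply: contra_neq u0 => x0; apply/rowP => j; rewrite mxE.
  have : u ord0 j ^+ 2 <= 0.
    have <- : `|x| ^+ 2 = 0 by rewrite x0 normr0 expr0n.
    by rewrite xx (bigD1 j)//= lerDl sumr_ge0// => i _; rewrite sqr_ge0.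
  by move=> H; apply/eqP; rewrite -sqrf_eq0 eq_le H sqr_ge0.
have := Teps x; rewrite big1 => [|k _]; last by rewrite alx scale0r.
rewrite subr0 leNgt => /negP; apply.
apply: (@lt_le_trans _ _ (sg n * `|x|)); first by rewrite ltr_pM2r.
rewrite -(@ler_pXn2r _ 2) ?nnegrE ?mulr_ge0// exprMn xx Txx mulr_sumr.
apply: ler_sum => j _; rewrite mulrC ler_wpM2l ?sqr_ge0//.
by rewrite ler_pXn2r ?nnegrE// singular_antitone// -ltnS.
Qed.

End SingularSystem.

(** * Geometric decay of singular values and Schatten classes *)

Lemma bounded_linear_cts (R : realType) (V W : normedModType R)
    (T : {linear V -> W}) (B : R) :
  (forall x, `|T x| <= B * `|x|) -> continuous T.
Proof.
move=> TB; apply/linear_bounded_continuous; apply/linear_boundedP; near=> r => x.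
by apply: (le_trans (TB x)); rewrite ler_wpM2r.
Unshelve. all: by end_near. Qed.

Lemma eq_cvgn (T : topologicalType) (u w : nat -> T) (l : T) :
  u =1 w -> u @ \oo --> l -> w @ \oo --> l.
Proof. by move=> /funext ->. Qed.

Lemma geometric_small (R : realType) (C r e : R) : 0 <= r < 1 -> 0 < e ->
  exists N, forall n, (N <= n)%N -> C * r ^+ n <= e.
Proof.
case/andP=> r0 r1 e0.
have /cvgrPdist_le/(_ _ e0)[N _ HN] : geometric C r @ \oo --> 0.
  by apply: cvg_geometric; rewrite ger0_norm.
exists N => n /HN; rewrite /= sub0r normrN; apply: le_trans; exact: ler_norm.
Qed.

Section GeometricSeries.
Variables (R : realType) (V : normedModType R) (C r : R) (y : nat -> V).
Hypothesis r01 : 0 <= r < 1.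
Hypothesis yC : forall k, `|y k| <= C * r ^+ k.

Let r1 : 0 < 1 - r. Proof. by rewrite subr_gt0; case/andP: r01. Qed.
Let C0 : 0 <= C.
Proof. by have := yC 0; rewrite expr0 mulr1; apply: le_trans. Qed.
Let r0 : 0 <= r. Proof. by case/andP: r01. Qed.

Lemma geometric_tail m n : (m <= n)%N ->
  `|\sum_(k < m) y k - \sum_(k < n) y k| <= C / (1 - r) * r ^+ m.
Proof.
move=> mn; rewrite distrC -!(big_mkord xpredT y) (@big_cat_nat _ _ _ m 0 n)//=.
rewrite addrAC subrr add0r; apply: (le_trans (ler_norm_sum _ _ _)).
apply: (@le_trans _ _ (\sum_(m <= k < n) C * r ^+ k)); first by apply: ler_sum.
rewrite -mulr_sumr -mulrA ler_wpM2l// -{1}[m]add0n big_addn big_mkord.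
under eq_bigr do rewrite exprD.
by rewrite -mulr_suml ler_wpM2r ?exprn_ge0// sum_expr_le.
Qed.

Lemma geometric_cauchy : norm_cauchy (fun n => \sum_(k < n) y k).
Proof.
move=> e e0; have [N HN] := geometric_small (C / (1 - r)) r01 e0.
have small m n : (N <= m)%N -> (m <= n)%N ->
    `|\sum_(k < m) y k - \sum_(k < n) y k| <= e.
  by move=> Nm mn; apply: (le_trans (geometric_tail mn)); exact: HN.
exists N => m n Nm Nn; case/orP: (leq_total m n) => ?; first exact: small.
by rewrite distrC small.
Qed.

End GeometricSeries.

(** The sum of the a_k(x) v_k converges absolutely; the functionals a_k and the
    vectors v_k are arbitrary so that both the absolute value and the adjoint of
    an operator are of this form. *)
Lemma diagonal_operator (R : realType) (U V : normedModType R) (C r : R)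
    (a : nat -> U -> R) (v : nat -> V) :
  seq_complete V -> 0 <= r < 1 -> 0 <= C ->
  (forall k, `|v k| <= 1) ->
  (forall k t x y, a k (t *: x + y) = t * a k x + a k y) ->
  (forall k x, `|a k x| <= C * r ^+ k * `|x|) ->
  exists2 D : {linear U -> V}, continuous D &
    forall x, \sum_(k < n) a k x *: v k @[n --> \oo] --> D x.
Proof.
move=> V_complete r01 C0 v1 a_lin aC.
have r1 : 0 < 1 - r by rewrite subr_gt0; case/andP: r01.
have r0 : 0 <= r by case/andP: r01.
have termC x k : `|a k x *: v k| <= C * `|x| * r ^+ k.
  by rewrite normrZ mulrAC (le_trans (ler_piMr _ (v1 k))).
pose d x : V := limn (fun n => \sum_(k < n) a k x *: v k).
have d_cvg x : \sum_(k < n) a k x *: v k @[n --> \oo] --> d x.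
  by apply: V_complete; exact: (geometric_cauchy r01 (termC x)).
have d_lin : linear d.
  move=> t x y; apply: (cvg_unique _ (d_cvg _)) => //.
  apply: eq_cvgn (cvgD (cvgZl_tmp (k := t) (d_cvg x)) (d_cvg y)) => n /=.
  rewrite fctE [X in X + _]/= scaler_sumr -big_split/=; apply: eq_bigr => k _.
  by rewrite a_lin scalerDl scalerA.
pose D : {linear U -> V} := HB.pack d (GRing.isLinear.Build R U V *:%R d d_lin).
exists D => //; apply: (@bounded_linear_cts _ _ _ _ (C / (1 - r))) => x.
apply/ler_addgt0Pr => e e0.
have /cvgrPdist_le/(_ _ e0) := d_cvg x.
move=> /filter_ex[n /= Hn].
have := ler_normD (d x - \sum_(k < n) a k x *: v k) (\sum_(k < n) a k x *: v k).
rewrite subrK => /le_trans; apply; rewrite addrC lerD//.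
have := geometric_tail r01 (termC x) (leq0n n).
by rewrite big_ord0 sub0r normrN expr0 mulr1 mulrAC.
Qed.

Section SchattenClass.
Variables (R : realType) (V W : preHilbertType R) (T : {linear V -> W}).
Variables (B C r : R) (al : nat -> {linear V -> R^o}) (w : nat -> W).
Hypothesis V_complete : seq_complete V.
Hypothesis TB : forall x, `|T x| <= B * `|x|.
Hypothesis T_compact : compact_op T.
Hypothesis r01 : 0 < r < 1.
Hypothesis C_ge0 : 0 <= C.
Hypothesis T_approx : forall n F,
  `|T F - \sum_(k < n) (al k F : R) *: w k| <= C * r ^+ n * `|F|.

(** The singular values sg k decay geometrically, because they are at most the
    distances to operators of rank k. Hence |T| x = sum sg k <x, v_k> v_k and
    T^* y = sum <y, T v_k> v_k converge absolutely, and image_coord gives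
    |T|^2 = T^* T. The nonzero eigenvalues of |T| are the nonzero sg k, since
    an eigenvector for l has no component along v_k unless sg k = l. *)
Lemma geometric_approx_schatten q : 0 < q -> schatten q T.
Proof.
move=> q0; split=> //.
have r0 : 0 < r by case/andP: r01.
have r01' : 0 <= r < 1 by case/andP: r01 => /ltW ->.
have [v v_sing] := singular_system_exists V_complete TB T_compact.
pose sg k := `|T (v k)|.
have sg_ge0 k : 0 <= sg k by exact: normr_ge0.
have sgC k : sg k <= C * r ^+ k.
  apply: (singular_le_approx v_sing _ (T_approx k)).
  by rewrite mulr_ge0// exprn_ge0// ltW.
have [v_orth v01 _] := v_sing.
have v1 k : `|v k| <= 1 by have [->|->] := v01 k; rewrite ?normr0.
have [A A_cts A_lim] : exists2 A : {linear V -> V}, continuous A &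
    forall x, \sum_(k < n) (sg k * inner x (v k)) *: v k @[n --> \oo] --> A x.
  apply: (@diagonal_operator _ _ _ C r (fun k x => sg k * inner x (v k))) => //.
    by move=> k t x y; rewrite inner_linear mulrDr mulrCA.
  move=> k x; rewrite normrM ger0_norm//.
  by apply: ler_pM => //; exact: (singular_coord_le v_sing).
have [S S_cts S_lim] : exists2 S : {linear W -> V}, continuous S &
    forall y, \sum_(k < n) (inner y (T (v k)) : R) *: v k @[n --> \oo] --> S y.
  apply: (@diagonal_operator _ _ _ C r (fun k y => inner y (T (v k)))) => //.
    by move=> k t x y; rewrite inner_linear.
  move=> k y; apply: (le_trans (cauchy_schwarz _ _)); rewrite mulrC.
  by apply: ler_wpM2r => //; exact: sgC.
have inner_lim (U : preHilbertType R) (u : U^nat) l z : u @ \oo --> l ->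
    inner (u n) z @[n --> \oo] --> (inner l z : R).
  by move=> ul; have := cvg_comp _ _ ul (@inner_continuous R U z l).
have A_coord x k : inner (A x) (v k) = sg k * inner x (v k) :> R.
  apply: (cvg_unique _ (inner_lim _ _ _ (v k) (A_lim x))) => //.
  apply: cvg_near_cst; exists k.+1 => // n /= kn.
  rewrite inner_suml (bigD1 (Ordinal kn))//= innerZl -mulrA.
  rewrite (singular_vector_inner v_sing) big1 ?addr0// => j.
  by rewrite -val_eqE/= => jk; rewrite innerZl v_orth// mulr0.
have A_sym : is_adjoint A A.
  move=> x y; apply: (cvg_unique _ (inner_lim _ _ _ y (A_lim x))) => //.
  rewrite innerC; apply: eq_cvgn (inner_lim _ _ _ x (A_lim y)) => n.
  rewrite !inner_suml; apply: eq_bigr => k _; rewrite !innerZl !(innerC (v k)).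
  by rewrite mulrAC.
have A_ge0 x : 0 <= inner (A x) x :> R.
  apply: (cvgr_to_ge (inner_lim _ _ _ x (A_lim x))).
  exists 0%N => // n _ /=; rewrite inner_suml sumr_ge0// => k _.
  by rewrite innerZl (innerC (v k)) -mulrA mulr_ge0// -expr2 sqr_ge0.
have T_lim x : \sum_(k < n) (inner x (v k) : R) *: T (v k) @[n --> \oo] --> T x.
  apply/cvgrPdist_le => e e0.
  have [N HN] := geometric_small (C * `|x|) r01' e0.
  exists N => // n /= /HN; apply: le_trans.
  have -> : T x - \sum_(k < n) (inner x (v k) : R) *: T (v k) = T (residual v n x).
    rewrite /residual linearB; congr (_ - _); rewrite linear_sum.
    by apply: eq_bigr => k _; rewrite linearZ.
  apply: (le_trans (T_residual v_sing n x)).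
  by rewrite mulrAC ler_wpM2r//; exact: sgC.
have TS : is_adjoint T S.
  move=> x y; apply: (cvg_unique _ (inner_lim _ _ _ y (T_lim x))) => //.
  rewrite innerC; apply: eq_cvgn (inner_lim _ _ _ x (S_lim y)) => n.
  rewrite !inner_suml; apply: eq_bigr => k _; rewrite !innerZl.
  by rewrite mulrC (innerC (v k)) (innerC y).
have AA x : A (A x) = S (T x).
  apply: (cvg_unique _ (A_lim (A x))) => //.
  apply: eq_cvgn (S_lim (T x)) => n; apply: eq_bigr => k _; congr (_ *: _).
  by rewrite (image_coord v_sing) A_coord -/(sg k) expr2 mulrA.
exists A, sg; split.
- by split=> //; exists S.
- move=> l l0.
  have [N HN] : exists N, forall n, (N <= n)%N -> sg n != l.
    have l20 : 0 < `|l| / 2 by rewrite divr_gt0 ?normr_gt0.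
    have [N HN] := geometric_small C r01' l20.
    exists N => n /HN H; apply/eqP => snl.
    have := le_trans (sgC n) H; rewrite -snl ger0_norm//.
    have : 0 < sg n by rewrite lt_neqAle snl eq_sym l0 -snl normr_ge0.
    by lra.
  (* the finitely many indices k with sg k = l *)
  pose s := [seq k <- iota 0 N | sg k == l].
  have s_uniq : uniq s by rewrite filter_uniq// iota_uniq.
  have mem_s k : (k \in s) = (sg k == l).
    rewrite mem_filter mem_iota add0n/=; apply: andb_idr => /eqP skl.
    by rewrite ltnNge; apply/negP => /HN/eqP.
  have v1s k : k \in s -> `|v k| = 1.
    rewrite mem_s => /eqP skl; have [v0|//] := v01 k.
    by move: skl l0; rewrite /sg v0 linear0 normr0 => <-; rewrite eqxx.
  exists (size s).
    exists (fun i => v (nth 0%N s i)); split.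
      move=> c /(congr1 (fun x => inner x (v (nth 0%N s _)))) c0 i.
      have := c0 i; rewrite inner0l inner_suml (bigD1 i)//= innerZl inner_norm.
      rewrite v1s ?mem_nth// expr1n mulr1 big1 ?addr0// => j ji.
      by rewrite innerZl v_orth ?mulr0// nth_uniq.
    have big_s (f : nat -> V) : \sum_(i < size s) f (nth 0%N s i) = \sum_(k <- s) f k.
      by rewrite (big_nth 0%N) big_mkord.
    apply/seteqP; split=> [x /= Ax|_ [c _ <-] /=].
      exists (fun i => inner x (v (nth 0%N s i))) => //.
      rewrite (big_s (fun k => (inner x (v k) : R) *: v k)).
      apply: (@scalerI _ _ l); first by apply/negP; rewrite (negPf l0).
      rewrite -Ax; apply: (cvg_unique _ _ (A_lim x)) => //.
      apply: cvg_near_cst; exists N => // n /= Nn.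
      have coord0 k : sg k != l -> inner x (v k) = 0 :> R.
        move=> skl; have := A_coord x k; rewrite Ax innerZl => /eqP.
        by rewrite -subr_eq0 -mulrBl mulf_eq0 subr_eq0 eq_sym (negPf skl) => /eqP.
      rewrite -(big_mkord xpredT (fun k => (sg k * inner x (v k)) *: v k)).
      rewrite (@big_cat_nat _ _ _ N)//= [X in _ + X]big_nat.
      rewrite [X in _ + X]big1 ?addr0 => [|k /andP[/HN/coord0 -> _]]; last first.
        by rewrite mulr0 scale0r.
      rewrite scaler_sumr big_filter [RHS]big_mkcond /index_iota subn0.
      apply: eq_bigr => k _; case: eqP => [->|/eqP/coord0 ->].
        by rewrite scalerA.
      by rewrite mulr0 scale0r.
    rewrite [LHS]linear_sum scaler_sumr; apply: eq_bigr => i _.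
    rewrite linearZ/= scalerA mulrC -scalerA; congr (_ *: _).
    have /eqP skl : sg (nth 0%N s i) == l by rewrite -mem_s mem_nth.
    set k := nth _ _ _ in skl *.
    apply: (cvg_unique _ (A_lim (v k))) => //.
    apply: cvg_near_cst; exists k.+1 => // n /= kn.
    rewrite (bigD1 (Ordinal kn))//= big1 ?addr0 => [|j].
      by rewrite inner_norm v1s ?mem_nth// expr1n mulr1 skl.
    rewrite -val_eqE/= => jk.
    by rewrite v_orth 1?eq_sym// mulr0 scale0r.
  have -> : [set k | sg k = l] = (nth 0%N s) @` `I_(size s).
    apply/seteqP; split=> [k /= /eqP|_ [i /= si <-]].
      rewrite -mem_s => ks; exists (index k s); rewrite /= ?index_mem//.
      by rewrite nth_index.
    by apply/eqP; rewrite -mem_s mem_nth.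
  apply: inj_card_eq => i j; rewrite !inE/= => si sj.
  by move=> /eqP; rewrite nth_uniq// => /eqP.
- apply: (@series_le_cvg _ _ (geometric (C `^ q) (r `^ q))).
  + by move=> n; rewrite powR_ge0.
  + by move=> n; rewrite /geometric/= mulr_ge0 ?exprn_ge0// powR_ge0.
  + move=> n /=; rewrite -[X in _ * X]powR_mulrn ?powR_ge0// powRAC.
    rewrite powR_mulrn ?(ltW r0)//.
    rewrite -powRM ?exprn_ge0 ?(ltW r0)//.
    rewrite (ger0_norm (sg_ge0 n)) ge0_ler_powR ?(ltW q0) ?nnegrE ?sgC ?sg_ge0//.
    by rewrite mulr_ge0 ?exprn_ge0 ?(ltW r0).
  + apply: is_cvg_geometric_series.
    have p1 : (1 : R) `^ q = 1 by rewrite powR1.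
    rewrite ger0_norm ?powR_ge0// -p1 gt0_ltr_powR ?nnegrE ?(ltW r0)//.
    by case/andP: r01.
Qed.

End SchattenClass.

(** * Completeness of L2 *)

Section L2Basics.
Context d (T : measurableType d) (R : realType).
Variable mu : {measure set T -> \bar R}.
Local Notation L2 := (L2 mu).

Lemma L2fun_measurable (F : L2) : measurable_fun [set: T] (L2fun F).
Proof. by rewrite /L2fun. Qed.

Lemma measurable_sqr (f : T -> R) : measurable_fun [set: T] f ->
  measurable_fun [set: T] (fun x => (f x ^+ 2)%:E).
Proof. by move=> mf; apply/measurable_EFinP; exact: measurable_funX. Qed.

Lemma L2_sqr_norm (F : L2) : ((`|F| ^+ 2)%:E = \int[mu]_x (L2fun F x ^+ 2)%:E)%E.
Proof.
rewrite -inner_norm -[inner F F]/(L2inner F F) /L2inner /Rintegral fineK; last first.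
  by apply: integrable_fin_num => //; exact: L2mul_integrable.
by apply: eq_integral => x _; rewrite expr2.
Qed.

Lemma L2_sqr_norm_ae (F : L2) (f : T -> R) : measurable_fun [set: T] f ->
  {ae mu, forall x, L2fun F x = f x} ->
  ((`|F| ^+ 2)%:E = \int[mu]_x (f x ^+ 2)%:E)%E.
Proof.
move=> mf Ff; rewrite L2_sqr_norm; apply: ge0_ae_eq_integral => //.
- exact/measurable_sqr/L2fun_measurable.
- exact: measurable_sqr.
- by move=> x _; rewrite lee_fin sqr_ge0.
- by move=> x _; rewrite lee_fin sqr_ge0.
by apply: filterS Ff => x -> .
Qed.

Lemma L2_of_fun (f : T -> R) : measurable_fun [set: T] f ->
  (\int[mu]_x (f x ^+ 2)%:E < +oo)%E ->
  exists F : L2, {ae mu, forall x, L2fun F x = f x}.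
Proof.
move=> mf foo.
have Lf : f \in Lfun mu 2%:E.
  rewrite inE; apply/andP; split; rewrite inE//=.
  rewrite /finite_norm unlock/= poweR_lty//; apply: le_lt_trans foo.
  rewrite le_eqVlt; apply/orP; left; apply/eqP; apply: eq_integral => x _.
  by rewrite /= powR_mulrn// real_normK ?num_real.
exists (\pi_(Defs.L2 mu)%qT (Lfun_Sub (lee1n 2) Lf)).
exact: L2fun_pi.
Qed.

Lemma L2funB (F G : L2) : {ae mu, forall x, L2fun (F - G) x = L2fun F x - L2fun G x}.
Proof.
rewrite -scaleN1r; apply: filterS2 (L2funD F (-1 *: G)) (L2funZ (-1) G) => x -> ->.
by rewrite mulN1r.
Qed.

End L2Basics.

Section RieszFischer.
Context d (T : measurableType d) (R : realType).
Variable mu : {measure set T -> \bar R}.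
Local Notation L2 := (L2 mu).

(** A sequence with distances at most 8^(-k/2) converges almost everywhere: the
    function H = sum 4^k (u_k - u_(k+1))^2 has integral at most 2, so it is
    finite almost everywhere, and there |u_k - u_(k+1)| <= sqrt H 2^(-k). *)
Section FastCauchy.
Variable u : nat -> L2.
Hypothesis u_fast : forall k m, (k <= m)%N -> `|u k - u m| ^+ 2 <= (8 ^- k).

Let h k x := L2fun (u k) x - L2fun (u k.+1) x.

Let mh k : measurable_fun [set: T] (h k).
Proof. by apply: measurable_funB; exact: L2fun_measurable. Qed.

Let int_h k : (\int[mu]_x (h k x ^+ 2)%:E <= (8 ^- k)%:E)%E.
Proof.
rewrite -(@L2_sqr_norm_ae _ _ _ _ (u k - u k.+1))//; last exact: L2funB.
by rewrite lee_fin u_fast.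
Qed.

Let H x : \bar R := (\sum_(0 <= k <oo) ((4 ^+ k)%:E * (h k x ^+ 2)%:E))%E.

Let H_ae : {ae mu, forall x, H x \is a fin_num}.
Proof.
have mt k : measurable_fun [set: T] (fun x => (4 ^+ k)%:E * (h k x ^+ 2)%:E)%E.
  by apply: measurable_funeM; exact: measurable_sqr.
have t0 k x : (0 <= (4 ^+ k)%:E * (h k x ^+ 2)%:E)%E.
  by rewrite -EFinM lee_fin mulr_ge0 ?sqr_ge0// exprn_ge0.
have iH : mu.-integrable [set: T] H.
  apply/integrableP; split.
    by have := @ge0_emeasurable_sum _ T R setT
      (fun k x => ((4 ^+ k)%:E * (h k x ^+ 2)%:E)%E) xpredT (fun k x _ _ => t0 k x)
      (fun k _ => mt k).
  under eq_integral do rewrite gee0_abs ?nneseries_ge0//.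
  rewrite integral_nneseries//.
  apply: (@le_lt_trans _ _ 2%:E); last exact: ltry.
  apply: lime_le; first by apply: is_cvg_nneseries => n _ _; exact: integral_ge0.
  apply: nearW => n.
  apply: (@le_trans _ _ (\sum_(0 <= k < n) (2 ^- k)%:E)%E).
    apply: lee_sum => k _; rewrite ge0_integralZl_EFin ?exprn_ge0//; last first.
    + exact: measurable_sqr.
    + by move=> x _; rewrite lee_fin sqr_ge0.
    apply: (@le_trans _ _ ((4 ^+ k)%:E * (8 ^- k)%:E)%E).
      by rewrite lee_pmul2l// lte_fin exprn_gt0.
    rewrite -EFinM lee_fin -!exprVn -exprMn.
    by rewrite le_eqVlt; apply/orP; left; apply/eqP; congr (_ ^+ _); field.
  rewrite sumEFin lee_fin big_mkord; under eq_bigr do rewrite -exprVn.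
  have half01 : 0 <= (2^-1 : R) < 1 by rewrite invr_ge0 ler0n invf_lt1// ltr1n.
  apply: (le_trans (sum_expr_le half01 n)).
  by rewrite le_eqVlt; apply/orP; left; apply/eqP; field.
by have := integrable_ae measurableT iH; apply: filterS => x; apply.
Qed.

Let good x : H x \is a fin_num -> cvgn (fun k => L2fun (u k) x).
Proof.
move=> Hx; set s := fine (H x).
have t0 k : (0 <= (4 ^+ k)%:E * (h k x ^+ 2)%:E)%E.
  by rewrite -EFinM lee_fin mulr_ge0 ?sqr_ge0// exprn_ge0.
have s0 : 0 <= s by apply: fine_ge0; exact: nneseries_ge0.
have hk k : `|h k x| <= Num.sqrt s * 2^-1 ^+ k.
  have : ((4 ^+ k)%:E * (h k x ^+ 2)%:E <= H x)%E.
    apply: le_trans (@nneseries_lim_ge _ _ xpredT 0 k.+1 (fun n _ _ => t0 n)).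
    by rewrite big_nat_recr//= leeDr// sume_ge0.
  rewrite -(fineK Hx) -EFinM lee_fin -/s => hs.
  rewrite -(@ler_pXn2r _ 2) ?nnegrE ?mulr_ge0 ?sqrtr_ge0 ?exprn_ge0//.
  rewrite exprMn sqr_sqrtr// real_normK ?num_real//.
  have -> : (2^-1 ^+ k) ^+ 2 = (4 ^+ k)^-1 :> R.
    by rewrite -exprM mulnC exprM -exprVn; congr (_ ^+ k); field.
  by rewrite ler_pdivlMr ?exprn_gt0// mulrC.
have half01 : 0 <= (2^-1 : R) < 1 by rewrite invr_ge0 ler0n invf_lt1// ltr1n.
have := geometric_cauchy (y := fun k => h k x : R^o) half01 hk.
move/real_seq_complete => c.
have -> : (fun k => L2fun (u k) x) =
    (fun k => L2fun (u 0%N) x - \sum_(j < k) (h j x : R^o)).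
  apply/funext => k; elim: k => [|k IH]; first by rewrite big_ord0 subr0.
  by rewrite big_ord_recr/= opprD addrA -IH /h subKr.
by apply: is_cvgB => //; exact: is_cvg_cst.
Qed.

(** The upper limit f of the u_k is measurable and is almost everywhere their
    limit. By Fatou the integral of (f - u_k)^2 is at most 8^(-k), hence f is
    square integrable and is the limit in L^2. *)
Lemma fast_cauchy_cvg : cvgn u.
Proof.
pose f x := fine (limn_esup (fun k => (L2fun (u k) x)%:E)).
have mf : measurable_fun [set: T] f.
  apply: (@measurableT_comp _ _ _ _ _ _ fine); first exact: fine_measurable.
  apply: measurable_fun_limn_esup => n; apply/measurable_EFinP.
  exact: L2fun_measurable.
have f_lim : {ae mu, forall x, L2fun (u k) x @[k --> \oo] --> f x}.
  apply: filterS H_ae => x /good c.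
  have cE : (L2fun (u k) x)%:E @[k --> \oo] -->
      (limn (fun k => L2fun (u k) x))%:E by apply: cvg_EFin => //; exact: nearW.
  by rewrite /f; have [_ ->] := cvg_limn_einf_sup cE.
have int_f k : (\int[mu]_x ((f x - L2fun (u k) x) ^+ 2)%:E <= (8 ^- k)%:E)%E.
  pose ph j x := ((L2fun (u (k + j)%N) x - L2fun (u k) x) ^+ 2)%:E.
  have mph j : measurable_fun [set: T] (ph j).
    by apply: measurable_sqr; apply: measurable_funB; exact: L2fun_measurable.
  have ph0 j x : (0 <= ph j x)%E by rewrite lee_fin sqr_ge0.
  have -> : (\int[mu]_x ((f x - L2fun (u k) x) ^+ 2)%:E =
      \int[mu]_x (limn_einf (ph ^~ x)))%E.
    apply: ge0_ae_eq_integral => //.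
    - apply: measurable_sqr; apply: measurable_funB => //; exact: L2fun_measurable.
    - apply: (@measurableT_comp _ _ _ _ _ _ oppe) => //.
      apply: measurable_fun_limn_esup => j.
      exact: (@measurableT_comp _ _ _ _ _ _ oppe).
    - by move=> x _; rewrite lee_fin sqr_ge0.
    - move=> x _; rewrite limn_einf_lim; apply: lime_ge; first exact: is_cvg_einfs.
      by apply: nearW => n; apply: le_ereal_inf_tmp => _ [m _ <-].
    apply: filterS f_lim => x fx _.
    have fkx : L2fun (u (k + j)%N) x @[j --> \oo] --> f x.
      move: fx; rewrite -(cvg_shiftn k); apply: eq_cvgn => j /=.
      by rewrite addnC.
    have cE : ph j x @[j --> \oo] --> ((f x - L2fun (u k) x) ^+ 2)%:E.
      apply: cvg_EFin; first exact: nearW.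
      rewrite /ph; apply: (@cvg_comp _ _ _ _ (fun y : R => y ^+ 2)).
        by apply: cvgB fkx _; exact: cvg_cst.
      exact: exprn_continuous.
    by have [-> _] := cvg_limn_einf_sup cE.
  apply: (le_trans (fatou _ _ _ _)) => //.
  rewrite limn_einf_lim; apply: lime_le; first exact: is_cvg_einfs.
  apply: nearW => n; apply: (@le_trans _ _ (\int[mu]_x ph n x)%E).
    by apply: ereal_inf_lbound; exists n => /=.
  rewrite /ph -(@L2_sqr_norm_ae _ _ _ _ (u (k + n)%N - u k)).
  - by rewrite lee_fin distrC u_fast// leq_addr.
  - by apply: measurable_funB; exact: L2fun_measurable.
  - exact: L2funB.
have [D0 D0f] : exists D0 : L2, {ae mu, forall x, L2fun D0 x = f x - L2fun (u 0%N) x}.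
  apply: L2_of_fun; last by rewrite (le_lt_trans (int_f 0%N))// ltry.
  by apply: measurable_funB => //; exact: L2fun_measurable.
have [F Ff] : exists F : L2, {ae mu, forall x, L2fun F x = f x}.
  exists (D0 + u 0%N); apply: filterS2 (L2funD D0 (u 0%N)) D0f => x -> ->.
  by rewrite subrK.
apply/cvg_ex; exists F; apply/cvgrPdist_le => e e0.
have h01 : 0 <= (8^-1 : R) < 1 by rewrite invr_ge0 ler0n invf_lt1// ltr1n.
have [N HN] := geometric_small 1 h01 (exprn_gt0 2 e0).
exists N => // k /= /HN; rewrite mul1r exprVn => Hk.
rewrite -(@ler_pXn2r _ 2) ?nnegrE ?(ltW e0)//; apply: le_trans Hk.
rewrite -lee_fin (@L2_sqr_norm_ae _ _ _ _ (F - u k) (fun x => f x - L2fun (u k) x)).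
- exact: int_f.
- by apply: measurable_funB => //; exact: L2fun_measurable.
- by apply: filterS2 (L2funB F (u k)) Ff => x -> ->.
Qed.

End FastCauchy.

Lemma L2_complete : seq_complete L2.
Proof.
move=> u uC.
have /choice[N HN] : forall k : nat, exists N, forall m n,
    (N <= m)%N -> (N <= n)%N -> `|u m - u n| ^+ 2 <= 8 ^- k.
  move=> k; have [|N HN] := uC (Num.sqrt (8 ^- k)).
    by rewrite sqrtr_gt0 invr_gt0 exprn_gt0.
  exists N => m n Nm Nn; rewrite -[leRHS]sqr_sqrtr ?invr_ge0 ?exprn_ge0//.
  by rewrite ler_pXn2r ?nnegrE ?sqrtr_ge0// HN.
pose M k := (k + \sum_(j < k.+1) N j)%N.
have NM k m : (k <= m)%N -> (N k <= M m)%N.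
  move=> km; rewrite /M (bigD1 (Ordinal (km : k < m.+1)%N))//= addnCA.
  exact: leq_addr.
have ul : cvgn (u \o M).
  apply: fast_cauchy_cvg => k m km; apply: HN; first exact: NM.
  exact: NM.
apply/cvg_ex; exists (limn (u \o M)); apply/cvgrPdist_le => e e0.
have e20 : 0 < e / 2 by rewrite divr_gt0.
have [n0 Hn0] := uC _ e20.
move/cvgrPdist_le: (ul) => /(_ _ e20)[k0 _ Hk0].
exists n0 => // n /= n0n; pose k := maxn k0 n0.
have nk : (n0 <= M k)%N by rewrite /M (leq_trans (leq_maxr k0 n0))// leq_addr.
have := Hk0 k (leq_maxl _ _); have := Hn0 _ _ nk n0n.
by have := ler_normD (limn (u \o M) - u (M k)) (u (M k) - u n); rewrite subrKA /=; lra.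
Qed.

End RieszFischer.

(** * Square integrable functions on the unit interval *)

Lemma muntz_complete (R : realType) (lam : R^nat) : seq_complete (muntz lam).
Proof.
move=> u uC.
have vC : norm_cauchy (fun n => val (u n)).
  move=> e e0; have [N HN] := uC e e0; exists N => m n Nm Nn.
  by have := HN m n Nm Nn; rewrite -raddfB.
have vl := L2_complete vC; set l := limn _ in vl.
have lP : l \in muntz_pred lam.
  apply/mem_set; apply: closed_closure => B nB.
  have [n _ /(_ n (leqnn n)) /= Hn] : \forall n \near \oo, B (val (u n)) by exact: vl.
  exists (val (u n)); split=> //.
  by have /set_mem := valP (u n).
pose L : muntz lam := Sub l lP.
apply/cvg_ex; exists L; apply/cvgrPdist_le => e e0.
move/cvgrPdist_le: (vl) => /(_ _ e0); apply: filterS => n Hn.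
by rewrite (_ : `|L - u n| = `|val (L - u n)|)// raddfB /=.
Qed.

Lemma ae_imply2 d (T : measurableType d) (R : realType)
    (mu : {measure set T -> \bar R}) (P Q S : T -> Prop) :
  (forall x, P x -> Q x -> S x) -> {ae mu, forall x, P x} ->
  {ae mu, forall x, Q x} -> {ae mu, forall x, S x}.
Proof. by move=> PQS; apply: filterS2. Qed.

Section UnitInterval.
Context {R : realType}.
Local Notation leb := (@lebesgue_measure R).
Local Notation mu01 := (@mu01 R).

Lemma mu01_setC : (mu01 (~` @I01 R) = 0)%E.
Proof. by rewrite /Defs.mu01 /mrestr setICl measure0. Qed.

Lemma ge0_integral_mu01 (f : R -> \bar R) : measurable_fun [set: R] f ->
  (forall x, (0 <= f x)%E) ->
  (\int[mu01]_x f x = \int[leb]_(x in I01) f x)%E.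
Proof.
move=> mf f0.
have mIC : measurable (~` @I01 R : set (measurableTypeR R)).
  by apply: measurableC; exact: (@measurable_I01 R).
have := @ge0_negligible_integral _ (measurableTypeR R) R mu01 [set: R] (~` @I01 R) f
  mIC measurableT mf (fun x _ => f0 x) mu01_setC.
move=> ->; rewrite setTD setCK;
apply: (@eq_measure_integral _ (measurableTypeR R) R (@I01 R) leb mu01 f) => A _ AI.
have E : mu01 A = leb (A `&` @I01 R) by [].
by move: E; rewrite (setIidl AI).
Qed.

Lemma ae_mu01 (P : R -> Prop) : (forall x, I01 x -> P x) -> {ae mu01, forall x, P x}.
Proof.
move=> HP; exists (~` I01); split; [|exact: mu01_setC|].
  by apply: measurableC; exact: (@measurable_I01 R).
by move=> x nPx Ix; apply: nPx; exact: HP.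
Qed.

(** Elements of L^2 come from functions measurable on the whole line, while the
    functions of interest are only measurable on the unit interval; they are
    extended by 0. *)
Lemma represents_patch (F : L2 mu01) (g : R -> R) :
  represents F g <-> represents F (g \_ I01).
Proof.
have E : {ae mu01, forall x, g x = (g \_ I01) x}.
  by apply: ae_mu01 => x Ix; rewrite patchE mem_set.
by split=> Fg; apply: ae_imply2 E Fg => x gx ->; rewrite gx.
Qed.

Lemma measurable_patch (g : R -> R) : measurable_fun (@I01 R) g ->
  measurable_fun [set: R] (g \_ I01).
Proof. by move/(measurable_restrictT _ measurable_I01). Qed.

Lemma I01_bounded_lty (g : R -> R) : measurable_fun (@I01 R) g ->
  (forall x, I01 x -> `|g x| <= 1) ->
  (\int[leb]_(x in I01) (g x ^+ 2)%:E < +oo)%E.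
Proof.
move=> mg g1; apply: (@le_lt_trans _ _ (\int[leb]_(x in I01) (cst 1) x)%E).
  apply: ge0_le_integral => //; first exact: measurable_I01.
  - by move=> x _; rewrite lee_fin sqr_ge0.
  - by apply/measurable_EFinP; exact: measurable_funX.
  move=> x Ix; rewrite /= lee_fin -real_normK ?num_real//.
  by rewrite -[leRHS](expr1n _ 2) ler_pXn2r ?nnegrE// g1.
rewrite integral_cst ?mul1e; last exact: measurable_I01.
rewrite -[X in (X < _)%E]/(lebesgue_measure (`[0, 1]%classic : set R)).
by rewrite lebesgue_measure_itv/= lte_fin ltr01 oppr0 adde0 ltry.
Qed.

Lemma represented_exists (g : R -> R) : measurable_fun (@I01 R) g ->
  (forall x, I01 x -> `|g x| <= 1) -> exists F : L2 mu01, represents F g.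
Proof.
move=> mg g1.
have [|F HF] := L2_of_fun (mu := mu01) (measurable_patch mg).
  rewrite ge0_integral_mu01; last 2 first.
  - by apply: measurable_sqr; exact: measurable_patch.
  - by move=> x; rewrite lee_fin sqr_ge0.
  apply: le_lt_trans (I01_bounded_lty mg g1); rewrite le_eqVlt; apply/orP; left.
  by apply/eqP/eq_integral => x xI; rewrite patchE xI.
by exists F; apply/represents_patch.
Qed.

Lemma represents_sqr_norm (F : L2 mu01) (g : R -> R) : measurable_fun (@I01 R) g ->
  represents F g -> ((`|F| ^+ 2)%:E = \int[leb]_(x in I01) (g x ^+ 2)%:E)%E.
Proof.
move=> mg /represents_patch Fg.
rewrite (@L2_sqr_norm_ae _ (measurableTypeR R) R mu01 F (g \_ I01)
  (measurable_patch mg) Fg) ge0_integral_mu01.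
- by apply: eq_integral => x xI; rewrite patchE xI.
- by apply: measurable_sqr; exact: measurable_patch.
- by move=> x; rewrite lee_fin sqr_ge0.
Qed.

Lemma represents_inner (F G : L2 mu01) (f g : R -> R) :
  measurable_fun (@I01 R) f -> measurable_fun (@I01 R) g ->
  (forall x, I01 x -> 0 <= f x * g x) ->
  represents F f -> represents G g ->
  ((inner F G : R)%:E = \int[leb]_(x in I01) (f x * g x)%:E)%E.
Proof.
move=> mf mg fg0 /represents_patch Ff /represents_patch Gg.
rewrite -[inner F G]/(L2inner F G) /L2inner /Rintegral fineK; last first.
  by apply: integrable_fin_num => //; exact: L2mul_integrable.
have mfg : measurable_fun [set: R] (fun x => ((f \_ I01) x * (g \_ I01) x)%:E).
  apply/measurable_EFinP; apply: measurable_funM; exact: measurable_patch.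
transitivity (\int[mu01]_x ((f \_ I01) x * (g \_ I01) x)%:E)%E.
  apply: ae_eq_integral => //.
  - exact: measurable_int (L2mul_integrable _ _).
  - by apply: ae_imply2 Ff Gg => x -> ->.
rewrite ge0_integral_mu01//.
- by apply: eq_integral => x xI; rewrite !patchE xI.
- move=> x; rewrite !patchE; case: ifPn => xI; last by rewrite mulr0.
  by rewrite lee_fin fg0//; exact: set_mem.
Qed.

Lemma powRD_ge0 (x a b : R) : 0 <= a -> 0 <= b -> x `^ (a + b) = x `^ a * x `^ b.
Proof.
move=> a0 b0; have [->|x0] := eqVneq x 0; last by rewrite powRD// x0 implybT.
have [->|an] := eqVneq a 0; first by rewrite add0r powRr0 mul1r.
by rewrite (powR0 an) mul0r powR0// gt_eqF// ltr_pwDl// lt_neqAle eq_sym an.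
Qed.

Lemma represents_powR_inner (F G : L2 mu01) (psi : R -> R) a b :
  measurable_fun (@I01 R) psi -> 0 <= a -> 0 <= b ->
  represents F (fun x => psi x `^ a) -> represents G (fun x => psi x `^ b) ->
  ((inner F G : R)%:E = \int[leb]_(x in I01) (psi x `^ (a + b))%:E)%E.
Proof.
move=> mpsi a0 b0 Fa Gb.
have mp c : measurable_fun (@I01 R) (fun x => psi x `^ c).
  by apply: (@measurableT_comp _ _ _ _ _ _ (@powR R ^~ c)) => //; exact: measurable_powR.
rewrite (represents_inner (mp a) (mp b) _ Fa Gb) => [|x _]; last first.
  by rewrite mulr_ge0// powR_ge0.
by apply: eq_integral => x _; rewrite powRD_ge0.
Qed.

Lemma cvg_powR_at_left (s : R) : x `^ s @[x --> 1^'-] --> (1 `^ s : R).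
Proof.
have D : {for 1, continuous (fun x : R => x `^ s)}.
  apply: differentiable_continuous; apply/derivable1_diffP.
  by apply: derivable_powR; rewrite in_itv/= ltr01.
by apply: cvg_at_left_filter; exact: D.
Qed.

Lemma cvg_powR_at_right (s : R) : 0 <= s -> x `^ s @[x --> 0^'+] --> (0 `^ s : R).
Proof.
rewrite le_eqVlt => /orP[/eqP <-|s0]; last by rewrite powR0 ?gt_eqF//; exact: powR_cvg0.
by rewrite powRr0; under eq_cvg do rewrite powRr0; exact: cvg_cst.
Qed.

Lemma integral_powR (s : R) : 0 <= s ->
  (\int[leb]_(x in I01) (x `^ s)%:E = ((s + 1)^-1)%:E)%E.
Proof.
move=> s0; have s1 : 0 < s + 1 by rewrite ltr_wpDl.
have LR c : 0 <= c -> derivable_oo_LRcontinuous (fun x : R => x `^ c) 0 1.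
  move=> c0; split; [|exact: cvg_powR_at_right|exact: cvg_powR_at_left].
  by move=> x /[!in_itv]/= /andP[x0 _]; apply: derivable_powR; rewrite in_itv/= x0.
have [D L0 L1] := LR _ (ltW s1).
rewrite (@continuous_FTC2 _ (fun x => x `^ s) ((s + 1)^-1 \*: (fun x => x `^ (s + 1))))//=.
- by rewrite /GRing.scale/= powR1 mulr1 powR0 ?gt_eqF// mulr0 -EFinB subr0.
- exact/derivable_oo_LRcontinuous_within/LR.
- split; [|exact: cvgZl_tmp L0|exact: cvgZl_tmp L1].
  by move=> x /D Dx; apply: derivableZ.
- move=> x xI; have /[!in_itv]/= /andP[x0 _] := xI.
  rewrite derive1E deriveZ; last exact: D.
  have D1 := is_derive1_powR (s + 1) x0.
  by rewrite derive_val /GRing.scale/= mulKf ?gt_eqF// addrK.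
Qed.

End UnitInterval.

(** * Decay of the moments of phi *)

Lemma powR_le_expR (R : realType) (p y : R) : 0 < p -> 0 <= y ->
  y `^ p <= p `^ p * expR y.
Proof.
move=> p0 y0.
have le1 : y / p <= expR (y / p) by have := expR_ge1Dx (y / p); lra.
have yE : y = p * (y / p) by rewrite mulrCA divff ?gt_eqF// mulr1.
rewrite {1}yE powRM ?divr_ge0 ?(ltW p0)// ler_wpM2l ?powR_ge0//.
apply: (@le_trans _ _ (expR (y / p) `^ p)).
  by rewrite ge0_ler_powR ?nnegrE ?(ltW p0) ?divr_ge0 ?expR_ge0 ?(ltW p0).
by rewrite -expRM divfK ?gt_eqF.
Qed.

Lemma powR_expN (R : realType) (x s : R) : 0 <= x -> 0 < s ->
  x `^ s <= expR (- (s * (1 - x))).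
Proof.
move=> x0 s0.
apply: (@le_trans _ _ (expR (- (1 - x)) `^ s)).
  rewrite ge0_ler_powR ?nnegrE ?(ltW s0) ?expR_ge0//.
  by have := expR_ge1Dx (- (1 - x)); lra.
by rewrite -expRM mulNr mulrC.
Qed.

Section DecayOfPowers.
Variables (R : realType) (beta : R).
Hypothesis beta_ge1 : 1 <= beta.

Let beta0 : 0 < beta. Proof. exact: lt_le_trans beta_ge1. Qed.

Definition decay_const : R := 1 + (2 * beta) `^ (2 * beta).

Lemma decay_const_ge0 : 0 <= decay_const.
Proof. by rewrite addr_ge0// powR_ge0. Qed.

(** With y = s (1 - x) and v = s^beta u / c one has x^s <= e^(- y) and
    v^2 <= y^(2 beta), which is at most a multiple of e^y. The bound is a multiple
    of 1 / (1 + v^2) because this function of u has an explicit primitive. *)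
Lemma powR_decay (c x u s : R) : 0 < c -> 0 <= x <= 1 -> 0 < s ->
  `|u| <= c * (1 - x) `^ beta ->
  x `^ s <= decay_const / (1 + (s `^ beta / c * u) ^+ 2).
Proof.
move=> c0 /andP[x0 x1] s0 ux; set v := _ * u.
have v2 : 0 < 1 + v ^+ 2 by rewrite ltr_pwDl// sqr_ge0.
rewrite ler_pdivlMr//; pose y := s * (1 - x).
have y0 : 0 <= y by rewrite mulr_ge0 ?(ltW s0)// subr_ge0.
have vy : v ^+ 2 <= y `^ (2 * beta).
  rewrite -real_normK ?num_real// mulrC powRrM powR_mulrn ?powR_ge0//.
  rewrite ler_pXn2r ?nnegrE ?powR_ge0// /v normrM.
  rewrite ger0_norm ?divr_ge0 ?powR_ge0 ?(ltW c0)//.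
  rewrite /y powRM ?(ltW s0) ?subr_ge0// -mulrA ler_wpM2l ?powR_ge0//.
  by rewrite ler_pdivrMl.
have b20 : 0 < 2 * beta by rewrite mulr_gt0.
have D : 1 + v ^+ 2 <= decay_const * expR y.
  rewrite /decay_const mulrDl mul1r lerD//.
    by rewrite (le_trans _ (expR_ge1Dx y))// lerDl.
  by apply: (le_trans vy); exact: powR_le_expR.
apply: (le_trans (ler_pM _ _ (powR_expN x0 s0) D)); rewrite ?powR_ge0 ?(ltW v2)//.
by rewrite mulrCA -expRD -/y addNr expR0 mulr1.
Qed.

End DecayOfPowers.

Section CauchyKernel.
Variables (R : realType) (a y : R).
Hypothesis a0 : 0 < a.
Local Notation leb := (@lebesgue_measure R).

Definition cauchy_kernel (x : R) := (1 + (a * (x - y)) ^+ 2)^-1.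

Lemma cauchy_kernel_ge0 x : 0 <= cauchy_kernel x.
Proof. by rewrite invr_ge0 addr_ge0// sqr_ge0. Qed.

Let atan_deriv (x : R) :
  is_derive x 1 (fun x => a^-1 * atan (a * (x - y))) (cauchy_kernel x).
Proof.
have D1 : is_derive x 1 (fun x : R => a * (x - y)) a.
  have := is_deriveZ a (is_deriveB (is_derive_id x 1) (is_derive_cst y x 1)).
  by rewrite subr0 /GRing.scale/= mulr1.
have D2 := @is_derive1_comp _ atan (fun x : R => a * (x - y)) x _ _ (is_derive1_atan _) D1.
have := is_deriveZ a^-1 D2; rewrite /GRing.scale/=.
by rewrite mulrCA mulVf ?gt_eqF// mulr1.
Qed.

Lemma cauchy_kernel_continuous : continuous cauchy_kernel.
Proof.
move=> x; apply: cvgV; first by rewrite gt_eqF// ltr_pwDl// sqr_ge0.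
apply: cvgD; first exact: cvg_cst.
apply: (@cvg_comp _ _ _ (fun x => a * (x - y)) (fun z : R => z ^+ 2)).
  by apply: cvgMl_tmp; apply: cvgB; [exact: cvg_id|exact: cvg_cst].
exact: exprn_continuous.
Qed.

Lemma integral_cauchy_kernel :
  (\int[leb]_(x in I01) (cauchy_kernel x)%:E <= (pi / a)%:E)%E.
Proof.
pose G x := a^-1 * atan (a * (x - y)).
rewrite (@continuous_FTC2 _ cauchy_kernel G)//.
- rewrite -EFinB lee_fin /G -mulrBr mulrC ler_wpM2r ?invr_ge0 ?(ltW a0)//.
  by have := atan_ltpi2 (a * (1 - y)); have := atan_gtNpi2 (a * (0 - y)); lra.
- apply: continuous_subspaceT; exact: cauchy_kernel_continuous.
- have Gc x : {for x, continuous G}.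
    by apply: differentiable_continuous; apply/derivable1_diffP; have [] := atan_deriv x.
  split; [by move=> x _; have [] := atan_deriv x| |].
  + by apply: cvg_at_right_filter; exact: Gc.
  + by apply: cvg_at_left_filter; exact: Gc.
- by move=> x _; rewrite derive1E; have [] := atan_deriv x.
Qed.

End CauchyKernel.

Lemma ae_imply d (T : measurableType d) (R : realType)
    (mu : {measure set T -> \bar R}) (P Q : T -> Prop) :
  (forall x, P x -> Q x) -> {ae mu, forall x, P x} -> {ae mu, forall x, Q x}.
Proof. by move=> PQ; apply: filterS. Qed.

Section AwayFromMaxima.
Context {R : realType}.
Variables (phi : R -> R).
Hypothesis phi_sup : ess_sup_on I01 phi = 1%E.
Local Notation leb := (@lebesgue_measure R).

Let ess_lt1 (A : set R) := exists2 rho : R, 0 <= rho < 1 &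
  {ae leb, forall x, A x -> phi x <= rho}.

Let ess_lt1_sub A B : A `<=` B -> ess_lt1 B -> ess_lt1 A.
Proof. by move=> AB [r r1 HB]; exists r => //; apply: ae_imply HB => x + /AB; apply. Qed.

Let ess_lt1U A B : ess_lt1 A -> ess_lt1 B -> ess_lt1 (A `|` B).
Proof.
move=> [r /andP[r0 r1] HA] [s /andP[s0 s1] HB]; exists (Num.max r s).
  by rewrite le_max r0 gt_max r1 s1.
by apply: ae_imply2 HA HB => x ha hb [/ha|/hb] H; rewrite le_max H ?orbT.
Qed.

Let ess_lt1_local x : I01 x -> ~ ess_max_points phi x ->
  exists2 U, nbhs x U & ess_lt1 (U `&` I01).
Proof.
move=> Ix xM.
have [E [EI nE Esup]] : exists E : set R, [/\ E `<=` I01, within I01 (nbhs x) E &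
    ess_sup_on E phi <> ess_sup_on I01 phi].
  apply: contrapT => H; apply: xM; split=> // E EI nE.
  by apply: contrapT => Esup; apply: H; exists E.
have : (ess_sup_on E phi < 1)%E.
  rewrite -phi_sup lt_neqAle; apply/andP; split; first exact/eqP.
  apply: le_ereal_inf => z /= Hz; apply: ae_imply Hz => t + /EI; exact.
move=> /ereal_inf_lt[z Hz z1].
exists [set t | I01 t -> E t]; first exact: nE.
exists (Num.max 0 (fine z)).
  rewrite le_max lexx/= gt_max ltr01/=; case: z z1 {Hz} => [r| |]//=.
apply: ae_imply Hz => t Ht [tE It]; have := Ht (tE It).
by case: z z1 {Ht} => [r| |]//= _; rewrite lee_fin le_max => ->; rewrite orbT.
Qed.

(** Every point that is not an essential maximum has a neighbourhood on which phi is
    essentially bounded by some rho < 1, and sets with this property are stable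
    under finite unions; the points at distance at least delta of the maxima
    form a compact set. *)
Lemma ess_lt1_away (l : seq R) (delta : R) : 0 < delta ->
  ess_max_points phi `<=` [set` l] ->
  exists2 rho : R, 0 <= rho < 1 & {ae leb, forall x, I01 x ->
    (forall y, y \in l -> delta <= `|x - y|) -> phi x <= rho}.
Proof.
move=> d0 Ml.
pose K := [set x | I01 x /\ forall y, y \in l -> delta <= `|x - y|].
suff [rho r1 H] : ess_lt1 K.
  by exists rho => //; apply: ae_imply H => x Hx Ix xl; apply: Hx.
have cK : compact K.
  apply: (@subclosed_compact R K (`[0, 1]%classic : set R)); last 2 first.
  - exact: segment_compact.
  - by move=> x [].
  rewrite (_ : K = `[0, 1]%classic `&` \bigcap_(y in [set` l]) [set x | delta <= `|x - y|]).
    apply: closedI; first exact: interval_closed.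
    apply: closed_bigI => y _.
    have yc : continuous (fun x : R => `|x - y|).
      move=> x; apply: cvg_norm; apply: cvgB; [exact: cvg_id|exact: cvg_cst].
    by move/continuous_closedP: yc => /(_ _ (@closed_ge R delta)).
  by apply/seteqP; split=> x [].
apply: contrapT => nK.
(* if K were not such a set, the sets whose complement in K is would form a
   proper filter, with a cluster point in K *)
pose G := [set A | ess_lt1 (K `\` A)].
have FG : ProperFilter G.
  apply: Build_ProperFilter.
    by move=> /(ess_lt1_sub _) H; apply: nK; apply: H => x Kx; split.
  split.
  - exists 0; first by rewrite lexx ltr01.
    by apply: nearW => x [_ []].
  - move=> A B GA GB; apply: ess_lt1_sub (ess_lt1U GA GB) => x [Kx nAB].
    have [Ax|nAx] := pselect (A x); [right|left]; split=> // Bx; exact: nAB.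
  - by move=> A B AB; apply: ess_lt1_sub => x [Kx nB]; split=> // /AB.
have GK : G K.
  by apply: (@ess_lt1_sub _ set0) => [x []//|]; exists 0; rewrite ?lexx ?ltr01//;
    apply: nearW => x [].
have [x [[Ix xl] clx]] := cK G FG GK.
have xM : ~ ess_max_points phi x.
  by move=> /Ml /= /xl; rewrite subrr normr0 leNgt d0.
have [U nU HU] := ess_lt1_local Ix xM.
have GU : G (~` U).
  by apply: ess_lt1_sub HU => z [[Iz _] nnU]; split=> //; exact: contrapT.
by have [z [nUz Uz]] := clx _ _ GU nU.
Qed.

End AwayFromMaxima.

(** The integrals of the powers of phi, that is, the moments of the image of the
    Lebesgue measure under phi: the Gram matrix of the functions phi^(lam n)
    consists of moments. *)
Definition moment (R : realType) (phi : R -> R) (s : R) : R :=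
  fine (\int[@lebesgue_measure R]_(x in I01) (phi x `^ s)%:E)%E.

(** For beta = 1 this is a linear bound from below of 1 - phi on both sides of y;
    for beta > 1 the peak of phi at y is sharper. *)
Definition peak_at (R : realType) (phi : R -> R) (beta c y : R) :=
  exists2 delta : R, 0 < delta & forall x, I01 x -> `|x - y| < delta ->
    `|x - y| <= c * `|phi x - 1| `^ beta.

Lemma seq_uniform (R : realType) (l : seq R) (P : R -> R -> Prop) :
  (forall y d e, P y d -> 0 < e <= d -> P y e) ->
  (forall y, y \in l -> exists2 d, 0 < d & P y d) ->
  exists2 d, 0 < d & forall y, y \in l -> P y d.
Proof.
move=> Pmono; elim: l => [|y l IH] Pl; first by exists 1.
have [|d d0 Hd] := IH; first by move=> z zl; apply: Pl; rewrite inE zl orbT.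
have [e e0 He] := Pl _ (mem_head y l).
exists (Num.min d e); first by rewrite lt_min d0.
move=> z; rewrite inE => /orP[/eqP ->|/Hd H].
  by apply: Pmono He _; rewrite lt_min d0 e0 ge_min lexx orbT.
by apply: Pmono H _; rewrite lt_min d0 e0 ge_min lexx.
Qed.

Section Moments.
Context {R : realType}.
Variables (phi : R -> R).
Hypothesis phi01 : forall x, I01 x -> I01 (phi x).
Hypothesis phi_borel : measurable_fun I01 phi.
Hypothesis phi_sup : ess_sup_on I01 phi = 1%E.
Local Notation leb := (@lebesgue_measure R).

Let phi_itv x : I01 x -> 0 <= phi x <= 1.
Proof. by move=> /phi01; rewrite /I01/= in_itv. Qed.

Let mpow s : measurable_fun (@I01 R) (fun x => (phi x `^ s)%:E).
Proof.
apply/measurable_EFinP.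
by apply: (@measurableT_comp _ _ _ _ _ _ (@powR R ^~ s)) => //; exact: measurable_powR.
Qed.

Lemma integral_I01_cst (r : R) : (\int[leb]_(x in I01) (r%:E) = r%:E)%E.
Proof.
rewrite integral_cst; last exact: measurable_I01.
rewrite -[X in (_ * X)%E]/(lebesgue_measure (`[0, 1]%classic : set R)).
by rewrite lebesgue_measure_itv/= lte_fin ltr01 oppr0 adde0 mule1.
Qed.

Let int_le1 s : 0 <= s -> (\int[leb]_(x in I01) (phi x `^ s)%:E <= 1%:E)%E.
Proof.
move=> s0; rewrite -(integral_I01_cst 1); apply: ge0_le_integral => //.
- exact: measurable_I01.
- by move=> x _; rewrite lee_fin powR_ge0.
- exact: mpow.
move=> x Ix; have /andP[p0 p1] := phi_itv Ix; rewrite lee_fin.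
have E : (1 : R) `^ s = 1 by rewrite powR1.
by rewrite -[leRHS]E ge0_ler_powR ?nnegrE.
Qed.

Let int_ge0 s : (0 <= \int[leb]_(x in I01) (phi x `^ s)%:E)%E.
Proof. by apply: integral_ge0 => x _; rewrite lee_fin powR_ge0. Qed.

Lemma momentE s : 0 <= s ->
  (\int[leb]_(x in I01) (phi x `^ s)%:E = (moment phi s)%:E)%E.
Proof.
move=> s0; rewrite /moment fineK// ge0_fin_numE//.
by apply: le_lt_trans (int_le1 s0) _; exact: ltry.
Qed.

(** Almost everywhere phi^s is at most rho^s far from the maxima and at most a
    Cauchy kernel of width c / s^beta near one of them, hence at most the sum of
    all these functions. The constant is linear in c, which matters for
    compactness. *)
Lemma moment_le1 s : 0 <= s -> moment phi s <= 1.
Proof. by move=> s0; rewrite -lee_fin -momentE// int_le1. Qed.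

Lemma moment_ge0 s : 0 <= moment phi s.
Proof. exact: fine_ge0. Qed.

Lemma moment_le (l : seq R) (beta c : R) : 1 <= beta -> 0 < c ->
  ess_max_points phi `<=` [set` l] ->
  (forall y, y \in l -> peak_at phi beta c y) ->
  exists2 rho, 0 <= rho < 1 & forall s, 0 < s -> moment phi s <=
    rho `^ s + (size l)%:R * (decay_const beta * (pi * c)) / s `^ beta.
Proof.
move=> b1 c0 Ml peak.
have [d d0 Hd] : exists2 d, 0 < d & forall y, y \in l -> forall x, I01 x ->
    `|x - y| < d -> `|x - y| <= c * `|phi x - 1| `^ beta.
  apply: (@seq_uniform _ _ (fun y d => forall x, I01 x ->
    `|x - y| < d -> `|x - y| <= c * `|phi x - 1| `^ beta)) => //.
  move=> y e e' H /andP[_ e'e] x Ix xy; apply: H => //; exact: lt_le_trans e'e.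
have [rho rho01 Hrho] := ess_lt1_away phi_sup d0 Ml.
have /andP[rho0 rho1] := rho01.
exists rho => // s s0; set a := s `^ beta / c.
have a0 : 0 < a by rewrite divr_gt0// powR_gt0.
have D0 := decay_const_ge0 beta.
have mck y : measurable_fun (@I01 R) (cauchy_kernel a y).
  apply: measurable_funTS; apply: continuous_measurable_fun.
  exact: cauchy_kernel_continuous.
have mDck y : measurable_fun (@I01 R) (fun x => (decay_const beta * cauchy_kernel a y x)%:E).
  apply/measurable_EFinP; exact: measurable_funM.
have ck0 y x : 0 <= decay_const beta * cauchy_kernel a y x.
  by rewrite mulr_ge0// cauchy_kernel_ge0.
have bound : {ae leb, forall x, I01 x -> ((phi x `^ s)%:E <=
    (rho `^ s)%:E + \sum_(y <- l) (decay_const beta * cauchy_kernel a y x)%:E)%E}.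
  apply: ae_imply Hrho => x Hx Ix; rewrite sumEFin -EFinD lee_fin.
  have /andP[p0 p1] := phi_itv Ix.
  have [[y yl xy]|far] := pselect (exists2 y, y \in l & `|x - y| < d).
    rewrite (big_rem y)//=; apply: ler_wpDl; first exact: powR_ge0.
    apply: ler_wpDr; first exact: sumr_ge0.
    apply: powR_decay => //; first exact/andP.
    have := Hd _ yl _ Ix xy; rewrite distrC (distrC (phi x)).
    by rewrite (ger0_norm (_ : 0 <= 1 - phi x)) ?subr_ge0// (distrC y).
  apply: ler_wpDr; first exact: sumr_ge0.
  rewrite ge0_ler_powR ?nnegrE ?(ltW s0)// Hx// => y yl.
  by rewrite leNgt; apply/negP => xy; apply: far; exists y.
rewrite -lee_fin -momentE ?(ltW s0)//.
apply: (le_trans (ae_ge0_le_integral _ _ _ _ _ bound)) => //.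
- exact: measurable_I01.
- by move=> x _; rewrite lee_fin powR_ge0.
- exact: mpow.
- by move=> x _; rewrite adde_ge0// ?lee_fin ?powR_ge0// sumEFin lee_fin sumr_ge0.
- apply: emeasurable_funD; first exact: measurable_cst.
  by apply: emeasurable_sum => y; exact: mDck.
rewrite ge0_integralD//; last first.
  - by apply: emeasurable_sum => y; exact: mDck.
  - by move=> x _; rewrite sumEFin lee_fin sumr_ge0.
  - by move=> x _; rewrite lee_fin powR_ge0.
  - exact: measurable_I01.
rewrite integral_I01_cst EFinD leeD2l//.
have ck0E y x : I01 x -> (0 <= (decay_const beta * cauchy_kernel a y x)%:E)%E.
  by move=> _; rewrite lee_fin.
rewrite (ge0_integral_sum leb (@measurable_I01 R) mDck ck0E).
apply: (@le_trans _ _ (\sum_(y <- l) (decay_const beta * (pi / a))%:E)%E).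
  apply: lee_sum => y _.
  under eq_integral do rewrite EFinM.
  rewrite ge0_integralZl_EFin ?D0//.
  - by rewrite EFinM lee_wpmul2l ?lee_fin// integral_cauchy_kernel.
  - exact: measurable_I01.
  - by move=> x _; rewrite lee_fin cauchy_kernel_ge0.
  - by apply/measurable_EFinP; exact: mck.
rewrite sumEFin lee_fin big_const_seq count_predT iter_addr_0.
by rewrite -[leLHS]mulr_natl -!mulrA /a invf_div.
Qed.

End Moments.

Lemma geometric_powR_decay (R : realType) (rho p s : R) : 0 <= rho < 1 -> 0 < p ->
  0 < s -> rho `^ s <= (p / (1 - rho)) `^ p / s `^ p.
Proof.
move=> /andP[r0 r1] p0 s0; have e0 : 0 < 1 - rho by rewrite subr_gt0.
apply: (le_trans (powR_expN r0 s0)).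
have H : s `^ p * (1 - rho) `^ p <= p `^ p * expR (s * (1 - rho)).
  rewrite -powRM ?(ltW s0) ?(ltW e0)//; apply: powR_le_expR => //.
  by rewrite mulr_ge0 ?ltW.
have ep0 : 0 < (1 - rho) `^ p by rewrite powR_gt0.
have V : (1 - rho)^-1 `^ p = ((1 - rho) `^ p)^-1.
  apply: (mulIf (negbT (gt_eqF ep0))).
  rewrite -powRM ?invr_ge0 ?(ltW e0)// !mulVf ?gt_eqF//.
  by rewrite powR1.
rewrite powRM ?invr_ge0 ?(ltW p0) ?(ltW e0)// V.
rewrite !ler_pdivlMr ?powR_gt0// -mulrA mulrC expRN ler_pdivrMr ?expR_gt0//.
Qed.

Section MomentAsymptotics.
Context {R : realType}.
Variables (phi : R -> R).
Hypothesis phi01 : forall x, I01 x -> I01 (phi x).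
Hypothesis phi_borel : measurable_fun I01 phi.
Hypothesis phi_sup : ess_sup_on I01 phi = 1%E.
Hypothesis phi_fin : finite_set (ess_max_points phi).

Lemma peak_at_mono (beta c c' y : R) : 0 <= c -> c <= c' ->
  peak_at phi beta c y -> peak_at phi beta c' y.
Proof.
move=> c0 cc' [d d0 H]; exists d => // x Ix xy; apply: (le_trans (H x Ix xy)).
by rewrite ler_wpM2r// powR_ge0.
Qed.

(** For s <= 1 the factor (s + 1)^beta is at most 2^beta and the moment at most 1;
    for s >= 1 both terms of moment_le are at most a multiple of s^(- beta). *)
Lemma moment_power_decay (beta : R) : 1 <= beta ->
  (forall y, ess_max_points phi y -> exists2 c, 0 < c & peak_at phi beta c y) ->
  exists2 C, 0 <= C & forall s, 0 <= s -> moment phi s * (s + 1) `^ beta <= C.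
Proof.
move=> b1 peak; have b0 : 0 < beta by exact: lt_le_trans b1.
have [l lE] := (finite_seqP _).1 phi_fin.
(* seq_uniform takes a minimum, and a common c is a maximum: use d = 1 / c *)
have [d d0 Hd] : exists2 d, 0 < d &
    forall y, y \in l -> 0 < d -> peak_at phi beta d^-1 y.
  apply: (@seq_uniform _ l (fun y d => 0 < d -> peak_at phi beta d^-1 y)) => //.
    move=> y d e H /andP[e0 ed] _; have d0 := lt_le_trans e0 ed.
    apply: peak_at_mono (H d0); first by rewrite invr_ge0 ltW.
    by rewrite lef_pV2 ?posrE.
  move=> y yl; have [|c c0 Hc] := peak y; first by rewrite lE.
  by exists c^-1; rewrite ?invr_gt0// => _; rewrite invrK.
have Ml : ess_max_points phi `<=` [set` l] by rewrite lE.
have [|rho rho01 Hrho] := moment_le phi01 phi_borel phi_sup b1 (c := d^-1) _ Ml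
  (fun y yl => Hd y yl d0).
  by rewrite invr_gt0.
pose C1 := (beta / (1 - rho)) `^ beta + (size l)%:R * (decay_const beta * (pi * d^-1)).
have D0 := decay_const_ge0 beta.
have C10 : 0 <= C1.
  rewrite addr_ge0 ?powR_ge0// !mulr_ge0 ?pi_ge0// invr_ge0 ltW//.
exists (2 `^ beta * (C1 + 1)); first by rewrite mulr_ge0 ?powR_ge0// addr_ge0.
move=> s s0; have [s1|s1] := leP s 1.
  rewrite mulrC; apply: ler_pM; rewrite ?powR_ge0 ?moment_ge0//.
    by rewrite ge0_ler_powR ?nnegrE ?(ltW b0) ?addr_ge0//; lra.
  by rewrite (le_trans (moment_le1 _ _ _))// lerDr.
have sp : 0 < s by exact: lt_trans s1.
have s2 : (s + 1) `^ beta <= 2 `^ beta * s `^ beta.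
  rewrite -powRM ?(ltW sp)//.
  by rewrite ge0_ler_powR ?nnegrE ?(ltW b0) ?addr_ge0 ?mulr_ge0 ?(ltW sp)//; lra.
have mC : moment phi s * s `^ beta <= C1.
  rewrite -ler_pdivlMr ?powR_gt0//; apply: (le_trans (Hrho s sp)).
  by rewrite /C1 [leRHS]mulrDl; apply: lerD => //; exact: geometric_powR_decay.
apply: (le_trans (ler_wpM2l (moment_ge0 _ _) s2)).
by rewrite mulrCA ler_wpM2l ?powR_ge0// (le_trans mC)// lerDl.
Qed.

(** In moment_le the term c / s is the only one of order 1 / s, and c is arbitrarily
    small. *)
Lemma moment_little_o :
  (forall y c, ess_max_points phi y -> 0 < c -> peak_at phi 1 c y) ->
  forall eps, 0 < eps -> exists S, forall s, S <= s -> moment phi s * (s + 1) <= eps.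
Proof.
move=> peak eps eps0.
have [l lE] := (finite_seqP _).1 phi_fin.
have Ml : ess_max_points phi `<=` [set` l] by rewrite lE.
pose K := (size l)%:R * (decay_const 1 * pi) : R.
have K0 : 0 <= K by rewrite !mulr_ge0 ?pi_ge0 ?decay_const_ge0.
pose c := eps / (4 * (K + 1)).
have c0 : 0 < c by rewrite divr_gt0// mulr_gt0// ltr_wpDl.
have [|rho rho01 Hrho] := moment_le phi01 phi_borel phi_sup (lexx _) c0 Ml.
  by move=> y yl; apply: peak => //; rewrite lE.
pose E := (2 / (1 - rho)) `^ 2.
exists (Num.max 1 (4 * E / eps)) => s; rewrite ge_max => /andP[s1 sE].
have sp : 0 < s by exact: lt_le_trans s1.
have := Hrho s sp; rewrite powRr1 ?(ltW sp)// => Hm.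
have Hr := geometric_powR_decay rho01 (ltr0n _ 2) sp.
rewrite -/E powR_mulrn ?(ltW sp)// in Hr.
have E0 : 0 <= E by rewrite powR_ge0.
have m1 : moment phi s * s <= E / s + K * c.
  rewrite -ler_pdivlMr//; apply: (le_trans Hm); rewrite [leRHS]mulrDl.
  apply: lerD; first by rewrite -mulrA -invfM -expr2.
  by rewrite /K !mulrA.
have H1 : E / s <= eps / 4.
  rewrite ler_pdivrMr//; move: sE; rewrite ler_pdivrMr// => ?; nra.
have H2 : K * c <= eps / 4.
  rewrite /c mulrA ler_pdivrMr ?mulr_gt0 ?ltr_wpDl//.
  by have := ltW eps0; nra.
have := moment_ge0 phi s; nra.
Qed.

End MomentAsymptotics.

Section SlopesAtMaxima.
Context {R : realType}.
Variables (phi : R -> R).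

Lemma left_slope (m y : R) : (m%:E < lower_left_derivative phi y)%E ->
  exists2 d, 0 < d & forall x, y - d < x -> x < y -> m * (y - x) <= phi y - phi x.
Proof.
rewrite /lower_left_derivative limf_einfE => /ereal_sup_gt[_ [V nV <-]] mV.
have [d /= d0 Hd] := (nbhs_ballP _ _).1 nV.
exists d => // x yx xy; rewrite -ler_pdivlMr ?subr_gt0//.
have Vx : V x.
  by apply: Hd => //=; rewrite /ball/= ger0_norm ?subr_ge0 ?(ltW xy)//; lra.
rewrite -lee_fin; apply: (le_trans (ltW mV)); apply: ereal_inf_lbound.
by exists x.
Qed.

Lemma right_slope (m y : R) : (upper_right_derivative phi y < (- m)%:E)%E ->
  exists2 d, 0 < d & forall x, y < x -> x < y + d -> m * (x - y) <= phi y - phi x.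
Proof.
rewrite /upper_right_derivative limf_esupE => /ereal_inf_lt[_ [V nV <-]] mV.
have [d /= d0 Hd] := (nbhs_ballP _ _).1 nV.
exists d => // x yx xy.
have Vx : V x.
  by apply: Hd => //=; rewrite /ball/= ltr0_norm ?subr_lt0//; lra.
have : ((phi y - phi x) / (y - x) <= - m).
  rewrite -lee_fin; apply: le_trans (ltW mV); apply: ereal_sup_ubound.
  by exists x.
by rewrite ler_ndivrMr ?subr_lt0//; lra.
Qed.

Lemma slope_peak (m y : R) : 0 < m -> phi y = 1 ->
  (0 < y -> (m%:E < lower_left_derivative phi y)%E) ->
  (y < 1 -> (upper_right_derivative phi y < (- m)%:E)%E) ->
  peak_at phi 1 m^-1 y.
Proof.
move=> m0 y1 Hl Hr.
have [dl dl0 HL] : exists2 d, 0 < d & 0 < y ->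
    forall x, y - d < x -> x < y -> m * (y - x) <= phi y - phi x.
  have [/Hl/left_slope[d d0 H]|_] := boolP (0 < y); first by exists d.
  by exists 1.
have [dr dr0 HR] : exists2 d, 0 < d & y < 1 ->
    forall x, y < x -> x < y + d -> m * (x - y) <= phi y - phi x.
  have [/Hr/right_slope[d d0 H]|_] := boolP (y < 1); first by exists d.
  by exists 1.
exists (Num.min dl dr); first by rewrite lt_min dl0.
move=> x; rewrite /I01/= in_itv/= => /andP[x0 x1].
rewrite lt_min => /andP[xl xr]; rewrite powRr1// ler_pdivlMl// distrC.
case: (ltgtP x y) => [xy|yx|->]; last by rewrite subrr normr0 mulr0.
- have H := HL (le_lt_trans x0 xy) x _ xy.
  rewrite gtr0_norm ?subr_gt0// distrC -{1}y1; apply: le_trans (ler_norm _).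
  apply: H; move: xl; rewrite ltr0_norm ?subr_lt0//; lra.
- have H := HR (lt_le_trans yx x1) x yx.
  rewrite distrC gtr0_norm ?subr_gt0// distrC -{1}y1; apply: le_trans (ler_norm _).
  apply: H; move: xr; rewrite gtr0_norm ?subr_gt0//; lra.
Qed.

End SlopesAtMaxima.

(** * The composition operator *)

(** The numbers lam n + 1/2 are the ones that appear in the Gram matrix. A ratio
    (x + 1/2) / (g x + 1/2) with g > 1 decreases in x, so that its value at
    lam 1 is a bound for all later ones; the first step is treated apart because
    lam 0 may be 0. *)
Lemma lacunary_shift (R : realType) (lam : R^nat) :
  muntz_exponents lam -> lacunary lam ->
  exists2 t : R, 0 < t < 1 & forall n, lam n + 2^-1 <= t * (lam n.+1 + 2^-1).
Proof.
move=> [lam0 lam_lt _] [g g1 lac].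
have lam_gt0 n : 0 < lam n.+1 by exact: le_lt_trans (lam_lt n).
have lam_ge n : lam 1%N <= lam n.+1.
  by elim: n => // n IH; apply: (le_trans IH); exact: ltW.
have den0 : 0 < lam 1%N + 2^-1 by have := lam_gt0 0%N; lra.
have num0 : 0 < lam 0%N + 2^-1 by have := lam0 0%N; lra.
have g0 : 0 < g by lra.
have glam : 0 < g * lam 1%N by rewrite mulr_gt0.
have den1 : 0 < g * lam 1%N + 2^-1 by lra.
pose t0 := (lam 0%N + 2^-1) / (lam 1%N + 2^-1).
pose t1 := (lam 1%N + 2^-1) / (g * lam 1%N + 2^-1).
exists (Num.max t0 t1).
  rewrite lt_max gt_max divr_gt0//=; apply/andP; split.
    by rewrite ltr_pdivrMr// mul1r; have := lam_lt 0%N; lra.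
  by rewrite ltr_pdivrMr// mul1r ltrD2r ltr_pMl.
case=> [|n].
  apply: (@le_trans _ _ (t0 * (lam 1%N + 2^-1))); first by rewrite divfK ?gt_eqF.
  by rewrite ler_wpM2r ?(ltW den0)// le_max lexx.
have x0 : 0 < lam n.+2 + 2^-1 by have := lam_gt0 n.+1; lra.
apply: (@le_trans _ _ (t1 * (lam n.+2 + 2^-1))); last first.
  by rewrite ler_wpM2r ?(ltW x0)// le_max lexx orbT.
rewrite mulrAC ler_pdivlMr//.
have H : g * lam n.+1 <= lam n.+2 by rewrite -ler_pdivlMr// lac.
have H1 : 0 <= (g - 1) * (lam n.+1 - lam 1%N).
  by rewrite mulr_ge0// subr_ge0 ?(ltW g1) ?lam_ge.
have H2 : 0 <= (lam 1%N + 2^-1) * (lam n.+2 - g * lam n.+1).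
  by rewrite mulr_ge0 ?(ltW den0)// subr_ge0.
lra.
Qed.

Section CompositionOperator.
Variables (R : realType) (lam : R^nat) (phi : R -> R) (t : R).
Hypothesis lam_ge0 : forall n, 0 <= lam n.
Hypothesis t01 : 0 < t < 1.
Hypothesis lam_lac : forall n, lam n + 2^-1 <= t * (lam n.+1 + 2^-1).
Hypothesis phi01 : forall x, I01 x -> I01 (phi x).
Hypothesis phi_borel : measurable_fun I01 phi.

Local Notation L201 := (L2 (@mu01 R)).
Local Notation leb := (@lebesgue_measure R).

Let mu n := lam n + 2^-1.
Let sq n := Num.sqrt (2 * mu n).

Let mu0_gt0 : 0 < mu 0%N.
Proof. by rewrite /mu ltr_wpDl. Qed.

Let mu_gt0 n : 0 < mu n.
Proof. exact: (lac_gt0 t01 mu0_gt0 lam_lac). Qed.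

Let sq_gt0 n : 0 < sq n.
Proof. by rewrite sqrtr_gt0 mulr_gt0. Qed.

Let muD j k : mu j + mu k = lam j + lam k + 1.
Proof. by rewrite /mu; field. Qed.

Let mpow (psi : R -> R) s : measurable_fun (@I01 R) psi ->
  measurable_fun (@I01 R) (fun x => psi x `^ s).
Proof.
move=> mpsi; apply: (@measurableT_comp _ _ _ _ _ _ (@powR R ^~ s)) => //.
Qed.

Let pow_le1 (psi : R -> R) s x : (forall x, I01 x -> I01 (psi x)) -> 0 <= s ->
  I01 x -> `|psi x `^ s| <= 1.
Proof.
move=> psi01 s0 /psi01; rewrite /I01/= in_itv/= => /andP[p0 p1].
rewrite ger0_norm ?powR_ge0//; have E : (1 : R) `^ s = 1 by rewrite powR1.
by rewrite -[leRHS]E ge0_ler_powR ?nnegrE.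
Qed.

Lemma represents_lincomb (F : nat -> L201) (g : nat -> R -> R) n c :
  (forall k, represents (F k) (g k)) ->
  represents (lincomb F n c) (fun x => \sum_(k < n) c k * g k x).
Proof.
move=> Fg; rewrite /lincomb /represents; elim: n => [|n IH].
  apply: ae_imply (L2fun0 _) => x; rewrite !big_ord0; exact.
rewrite big_ord_recr/=.
have H1 := L2funD (\sum_(i < n) c i *: F i) (c n *: F n).
apply: ae_imply2 (ae_imply2 (fun x => @conj _ _) H1 IH)
  (ae_imply2 (fun x => @conj _ _) (L2funZ (c n) (F n)) (Fg n)) => x [-> ->] [-> ->].
by rewrite big_ord_recr.
Qed.

(** For psi = id these are the normalised powers of x, and composition with phi
    sends them to those for psi = phi; treating both at once gives both Gram
    matrices. *)
Definition powers (psi : R -> R) n x := sq n * psi x `^ lam n.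

Lemma powers_exist (psi : R -> R) : measurable_fun (@I01 R) psi ->
  (forall x, I01 x -> I01 (psi x)) -> exists2 w : nat -> L201,
    forall k, represents (w k) (powers psi k) &
    forall j k, inner (w j) (w k) = sq j * sq k * moment psi (lam j + lam k) :> R.
Proof.
move=> mpsi psi01.
have /choice[u Hu] : forall k, exists F : L201, represents F (fun x => psi x `^ lam k).
  move=> k; apply: represented_exists; first exact: mpow.
  by move=> x; exact: pow_le1.
exists (fun k => sq k *: u k) => [k|j k].
  by apply: ae_imply2 (L2funZ (sq k) (u k)) (Hu k) => x -> ->.
rewrite innerZl innerZr mulrA; congr (_ * _); apply: EFin_inj.
rewrite (represents_powR_inner mpsi _ _ (Hu j) (Hu k))// momentE//.
by rewrite addr_ge0.
Qed.

Lemma muntz_sum_powers (p : seq (R * nat)) : exists n (c : nat -> R), forall psi x,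
  muntz_sum lam p (psi x) = \sum_(k < n) c k * powers psi k x.
Proof.
exists (\max_(s <- p) s.2).+1, (fun k => (\sum_(s <- p | s.2 == k) s.1) / sq k).
move=> psi x; rewrite /muntz_sum /powers.
under [RHS]eq_bigr do rewrite mulrA divfK ?gt_eqF// mulr_suml big_mkcond/=.
rewrite exchange_big/=; apply: eq_big_seq => s sp.
have sN : (s.2 < (\max_(s <- p) s.2).+1)%N by rewrite ltnS; apply: leq_bigmax_seq.
rewrite (bigD1 (Ordinal sN))//= eqxx big1 ?addr0// => k.
by rewrite -val_eqE/= eq_sym => /negPf ->.
Qed.

Lemma val_lincomb (e : nat -> muntz lam) n c :
  val (lincomb e n c) = lincomb (fun k => val (e k)) n c.
Proof.
by rewrite /lincomb raddf_sum; apply: eq_bigr => k _; exact: GRing.valZ.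
Qed.

Lemma muntz_powers : exists e : nat -> muntz lam,
  [/\ forall k, represents (val (e k)) (powers id k),
      forall j k, inner (e j) (e k) = lac_gram mu j k & dense_span e].
Proof.
have [w Hw Gw] := @powers_exist id (@measurable_id _ _ _) (fun x => id).
have wP k : w k \in muntz_pred lam.
  apply/mem_set/subset_closure; exists (muntz_sum lam [:: (sq k, k)]); first by eexists.
  by apply: ae_imply (Hw k) => x ->; rewrite /muntz_sum big_seq1.
pose e k : muntz lam := Sub (w k) (wP k).
exists e; split.
- by move=> k; exact: Hw.
- move=> j k; rewrite -[inner _ _]/(inner (w j) (w k)) Gw /lac_gram muD.
  congr (_ * _); rewrite /moment [X in fine X](_ : _ = ((lam j + lam k + 1)^-1)%:E)//.
  by rewrite -integral_powR// addr_ge0.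
- move=> F eps eps0.
  have [B [[g [p _ <-] Bp] /= FB]] := set_mem (valP F) _ (nbhsx_ballx (val F) eps eps0).
  have [n [c Hnc]] := muntz_sum_powers p.
  exists n, c; apply: ltW; move: FB; rewrite -ball_normE/=.
  congr (_ < _); rewrite -[`|F - _|]/(`|val (F - lincomb e n c)|) raddfB/= val_lincomb.
  congr (`| _ - _ |); apply: L2fun_inj.
  apply: ae_imply2 Bp (represents_lincomb n c Hw) => x -> ->.
  exact: (Hnc id).
Qed.

(** All three parts of the theorem are read off kappa_m, which compares the
    moments of phi with the ones of the Lebesgue measure, 1 / (s + 1): it is
    bounded, or tends to 0, or decays geometrically. *)
Section Bounds.
Variable kappa : nat -> R.
Hypothesis kappa_ge0 : forall m, 0 <= kappa m.
Hypothesis moment_kappa : forall m j k, (m <= j)%N -> (m <= k)%N ->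
  moment phi (lam j + lam k) * (lam j + lam k + 1) <= kappa m.

(** Entry by entry, the Gram matrix of the w_k with k >= m is at most kappa_m times
    the one of the normalised powers of x, to which the Schur test applies. *)
Lemma powers_tail (w : nat -> L201) m n (c : nat -> R) :
  (forall j k, inner (w j) (w k) = sq j * sq k * moment phi (lam j + lam k) :> R) ->
  `|\sum_(k < n | (m <= k)%N) c k *: w k| ^+ 2 <=
    kappa m * schur_const t * \sum_(k < n) c k ^+ 2.
Proof.
move=> Gw; pose d k := if (m <= k)%N then c k else 0.
have -> : \sum_(k < n | (m <= k)%N) c k *: w k = \sum_(k < n) d k *: w k.
  rewrite big_mkcond/=; apply: eq_bigr => k _; rewrite /d.
  by case: ifP => // _; rewrite scale0r.
rewrite sqr_norm_sum -mulrA.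
apply: (@le_trans _ _ (kappa m * (schur_const t * \sum_(k < n) d k ^+ 2))); last first.
  rewrite ler_wpM2l// ler_wpM2l ?(ltW (schur_const_gt0 t01))//.
  by apply: ler_sum => k _; rewrite /d; case: ifP => // _; rewrite expr0n sqr_ge0.
apply: le_trans (ler_wpM2l (kappa_ge0 m) (lac_schur t01 mu0_gt0 lam_lac n d)).
rewrite mulr_sumr; apply: ler_sum => j _; rewrite mulr_sumr; apply: ler_sum => k _.
rewrite /d; case: ifPn => mj; last by rewrite normr0 !mul0r mulr0.
case: ifPn => mk; last by rewrite normr0 !mulr0 !mul0r mulr0.
rewrite Gw; apply: (le_trans (ler_norm _)); rewrite normrM normrM.
rewrite [leRHS]mulrCA ler_wpM2l ?mulr_ge0//.
rewrite ger0_norm ?mulr_ge0 ?(ltW (sq_gt0 _)) ?moment_ge0//.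
rewrite /lac_gram -/(sq j) -/(sq k) mulrCA ler_wpM2l ?mulr_ge0 ?(ltW (sq_gt0 _))//.
by rewrite muD ler_pdivlMr ?moment_kappa// -muD addr_gt0.
Qed.

(** The operator sends the normalised powers of x, a Riesz sequence, to the w_k. *)
Lemma composition_operator : exists (T : {linear muntz lam -> L201})
    (al : nat -> {linear muntz lam -> R^o}) (w : nat -> L201) (B K : R),
  [/\ is_comp_op phi T,
      forall F, `|T F| <= B * `|F|,
      forall k F, `|al k F| <= K * `|F| &
      forall m F, `|T F - \sum_(k < m) (al k F : R) *: w k| <=
        Num.sqrt (kappa m * schur_const t * riesz_const t) * `|F|].
Proof.
have [w Hw Gw] := powers_exist phi_borel phi01.
have [e [He Ge e_dense]] := muntz_powers.
have sc0 := schur_const_gt0 t01; have rc0 := riesz_const_gt0 t01.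
have [||||T [al [Te TB alK Tal]]] := @riesz_operator _ _ _ e w (riesz_const t)
    (fun m => kappa m * schur_const t) e_dense (@L2_complete _ _ _ (@mu01 R)).
- exact: ltW.
- by move=> m; rewrite mulr_ge0// ltW.
- by move=> n c; exact: (riesz_lower_bound t01 mu0_gt0 lam_lac Ge).
- by move=> m n c; exact: powers_tail.
exists T, al, w, (Num.sqrt (kappa 0 * schur_const t * riesz_const t)), (Num.sqrt (riesz_const t)).
split=> //; split; first exact: bounded_linear_cts TB.
move=> F g [p _ <-] Fp; have [n [c Hnc]] := muntz_sum_powers p.
have FE : F = lincomb e n c.
  apply: val_inj; apply: L2fun_inj.
  by rewrite val_lincomb; apply: ae_imply2 Fp (represents_lincomb n c He) => x -> ->; exact: (Hnc id).
have -> : T F = lincomb w n c.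
  by rewrite FE linear_lincomb; apply: eq_bigr => k _ /=; rewrite Te.
by apply: ae_imply (represents_lincomb n c Hw) => x ->; rewrite /= -Hnc.
Qed.

Lemma norm01_represents (F : L201) (g : R -> R) : measurable_fun (@I01 R) g ->
  represents F g -> norm01 g = (`|F|)%:E.
Proof.
move=> mg Fg; rewrite /norm01.
have -> : (\int[leb]_(x in I01) (`|g x| ^+ 2)%:E = (`|F| ^+ 2)%:E)%E.
  rewrite (represents_sqr_norm mg Fg); apply: eq_integral => x _.
  by rewrite real_normK ?num_real.
by rewrite poweR_EFin powR12_sqrt ?sqr_ge0// sqrtr_sqr normr_id.
Qed.

Lemma composition_bounded : comp_bounded lam phi.
Proof.
have [T [al [w [B [K [[_ Tphi] TB _ _]]]]]] := composition_operator.
have [e [He Ge e_dense]] := muntz_powers.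
exists B => _ [p _ <-]; have [n [c Hnc]] := muntz_sum_powers p.
pose F := lincomb e n c.
have mp psi : measurable_fun (@I01 R) psi ->
    measurable_fun (@I01 R) (fun x => muntz_sum lam p (psi x)).
  move=> mpsi; rewrite /muntz_sum; apply: measurable_sum => s.
  by apply: measurable_funM => //; exact: mpow.
have Fp : represents (val F) (muntz_sum lam p).
  by rewrite val_lincomb; apply: ae_imply (represents_lincomb n c He) => x ->; rewrite -(Hnc id).
have TFp := Tphi F _ (ex_intro2 _ _ p I erefl) Fp.
rewrite (norm01_represents (mp phi phi_borel) TFp).
rewrite (norm01_represents (mp id (@measurable_id _ _ _)) Fp).
by rewrite -EFinM lee_fin; exact: TB.
Qed.

End Bounds.

End CompositionOperator.

(** * The theorem *)

Section Conclusions.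
Variables (R : realType) (lam : R^nat) (phi : R -> R) (t : R).
Hypothesis lam_ge0 : forall n, 0 <= lam n.
Hypothesis t01 : 0 < t < 1.
Hypothesis lam_lac : forall n, lam n + 2^-1 <= t * (lam n.+1 + 2^-1).
Hypothesis phi01 : forall x, I01 x -> I01 (phi x).
Hypothesis phi_borel : measurable_fun I01 phi.

Let mu0_gt0 : 0 < lam 0%N + 2^-1.
Proof. by rewrite ltr_wpDl. Qed.

Lemma compact_of_moments (kappa : nat -> R) : (forall m, 0 <= kappa m) ->
  (forall m j k, (m <= j)%N -> (m <= k)%N ->
    moment phi (lam j + lam k) * (lam j + lam k + 1) <= kappa m) ->
  (forall e, 0 < e -> exists N, forall m, (N <= m)%N -> kappa m <= e) ->
  exists2 T : {linear muntz lam -> L2 (@mu01 R)}, is_comp_op phi T & compact_op T.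
Proof.
move=> k0 kM klim.
have [T [al [w [B [K [Tphi TB alK Tal]]]]]] :=
  composition_operator lam_ge0 t01 lam_lac phi01 phi_borel k0 kM.
exists T => //; apply: (approximable_compact (@L2_complete _ _ _ (@mu01 R)) alK Tal).
apply/cvgrPdist_le => e e0; pose a' := schur_const t * riesz_const t.
have a0 : 0 < a' by rewrite mulr_gt0 ?schur_const_gt0 ?riesz_const_gt0.
have [|N HN] := klim (e ^+ 2 / a'); first by rewrite divr_gt0 ?exprn_gt0.
exists N => // m /= /HN; rewrite ler_pdivlMr// => H.
rewrite sub0r normrN ger0_norm ?sqrtr_ge0//.
rewrite -[leRHS]ger0_norm ?(ltW e0)// -sqrtr_sqr ler_wsqrtr//.
by rewrite -mulrA.
Qed.

Lemma exponents_unbounded (S : R) : exists N, forall m, (N <= m)%N -> S <= lam m + 2^-1.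
Proof.
have t0 : 0 < t by case/andP: t01.
have t01' : 0 <= t < 1 by case/andP: t01 => /ltW ->.
have [N HN] := geometric_small S t01' mu0_gt0.
exists N => m Nm; have tm : 0 < t ^+ m by rewrite exprn_gt0.
rewrite -(ler_pM2l tm) mulrC (le_trans (HN _ Nm))//.
by have := lac_decay t01 lam_lac (leq0n m); rewrite subn0.
Qed.

(** Here s + 1 = mu_j + mu_k >= mu_m for s = lam j + lam k, and mu_m grows
    geometrically; so the excess exponent beta - 1 turns into geometric decay. *)
Lemma schatten_of_moments (beta C : R) : 1 < beta -> 0 <= C ->
  (forall s, 0 <= s -> moment phi s * (s + 1) `^ beta <= C) ->
  exists2 T : {linear muntz lam -> L2 (@mu01 R)},
    is_comp_op phi T & forall q : R, 0 < q -> schatten q T.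
Proof.
move=> b1 C0 mC; pose mu0 := lam 0%N + 2^-1; have mu00 : 0 < mu0 by exact: mu0_gt0.
have t0 : 0 < t by case/andP: t01.
have t1 : t < 1 by case/andP: t01.
pose p := beta - 1; have p0 : 0 < p by rewrite subr_gt0.
pose r := t `^ p; have r0 : 0 < r by rewrite powR_gt0.
have one : (1 : R) `^ p = 1 by rewrite powR1.
have r1 : r < 1 by rewrite -one gt0_ltr_powR ?nnegrE ?(ltW t0).
pose kappa m := C / mu0 `^ p * r ^+ m.
have kappa0 m : 0 <= kappa m.
  by rewrite mulr_ge0 ?divr_ge0 ?powR_ge0 ?exprn_ge0 ?(ltW r0).
have kM m j k : (m <= j)%N -> (m <= k)%N ->
    moment phi (lam j + lam k) * (lam j + lam k + 1) <= kappa m.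
  move=> mj mk; set s := lam j + lam k.
  have s0 : 0 <= s by rewrite addr_ge0.
  have s1 : 0 < s + 1 by rewrite ltr_wpDl.
  have H1 : mu0 <= t ^+ m * (s + 1).
    have := lac_decay t01 lam_lac (leq0n m); rewrite subn0 => /le_trans; apply.
    rewrite ler_pM2l ?exprn_gt0//.
    have := lac_decay t01 lam_lac mj.
    have tj : t ^+ (j - m) <= 1 by rewrite exprn_ile1 ?(ltW t0) ?(ltW t1).
    have j0 : 0 < lam j + 2^-1 by rewrite ltr_wpDl.
    have := ler_wpM2r (ltW j0) tj; rewrite /s; have := lam_ge0 k; lra.
  have H2 : mu0 `^ p <= r ^+ m * (s + 1) `^ p.
    have -> : r ^+ m = (t ^+ m) `^ p.
      by rewrite /r -[LHS]powR_mulrn ?powR_ge0// powRAC powR_mulrn// ltW.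
    rewrite -powRM ?exprn_ge0 ?(ltW t0) ?(ltW s1)//.
    by rewrite ge0_ler_powR ?nnegrE ?(ltW p0) ?mulr_ge0 ?exprn_ge0 ?(ltW t0) ?(ltW s1) ?(ltW mu00).
  have H3 : moment phi s * (s + 1) * (s + 1) `^ p <= C.
    rewrite -mulrA -{1}(powRr1 (ltW s1)) -powRD ?(gt_eqF s1) ?implybT//.
    by rewrite (_ : 1 + p = beta) ?mC// /p addrC subrK.
  rewrite /kappa mulrAC ler_pdivlMr ?powR_gt0//.
  apply: (le_trans (ler_wpM2l _ H2)); first by rewrite mulr_ge0 ?moment_ge0 ?(ltW s1).
  by rewrite mulrCA mulrC ler_wpM2r ?exprn_ge0 ?(ltW r0).
have [T [al [w [B [K [Tphi TB alK Tal]]]]]] :=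
  composition_operator lam_ge0 t01 lam_lac phi01 phi_borel kappa0 kM.
have a0 : 0 <= C / mu0 `^ p * schur_const t * riesz_const t.
  have sc0 := schur_const_gt0 t01; have rc0 := riesz_const_gt0 t01.
  by rewrite mulr_ge0 ?(ltW rc0)// mulr_ge0 ?(ltW sc0)// divr_ge0 ?powR_ge0.
pose D := Num.sqrt (C / mu0 `^ p * schur_const t * riesz_const t).
pose rr := Num.sqrt r.
have rr01 : 0 < rr < 1.
  by rewrite sqrtr_gt0 r0 /= -[ltRHS]sqrtr1 ltr_sqrt.
have epsE m : Num.sqrt (kappa m * schur_const t * riesz_const t) = D * rr ^+ m.
  rewrite /D /rr.
  have -> : Num.sqrt r ^+ m = Num.sqrt (r ^+ m).
    rewrite -[LHS]ger0_norm ?exprn_ge0 ?sqrtr_ge0// -sqrtr_sqr exprAC.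
    by rewrite sqr_sqrtr ?(ltW r0).
  by rewrite -sqrtrM//; congr Num.sqrt; rewrite /kappa; ring.
have T_compact : compact_op T.
  apply: (approximable_compact (@L2_complete _ _ _ (@mu01 R)) alK Tal).
  have rr1 : `|rr| < 1 by case/andP: rr01 => ? ?; rewrite ger0_norm// ltW.
  by apply: eq_cvgn (cvg_geometric D rr1) => m /=; rewrite epsE.
exists T => // q q0.
apply: (geometric_approx_schatten (@muntz_complete _ _) TB T_compact rr01 (C := D) (al := al) (w := w)) => //.
  exact: sqrtr_ge0.
by move=> m F; rewrite -epsE.
Qed.

End Conclusions.

Lemma ereal_gt0_real (R : realType) (z : \bar R) : (0 < z)%E ->
  exists2 m : R, 0 < m & (m%:E < z)%E.
Proof.
case: z => [r|_|//]; last by exists 1 => //; exact: ltry.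
by rewrite lte_fin => r0; exists (r / 2); rewrite ?lte_fin; lra.
Qed.

Theorem theorem3p5 (R : realType) (lam : R^nat) (phi : R -> R)
    (Hlam : muntz_exponents lam) (Hlac : lacunary lam)
    (phi01 : forall x, I01 x -> I01 (phi x))
    (phi_borel : measurable_fun I01 phi)
    (phi_sup : ess_sup_on I01 phi = 1%E)
    (phi_fin : finite_set (ess_max_points phi))
    (phi_max : forall y, ess_max_points phi y -> phi y = 1) :
  [/\ (* (i) *)
      (forall y, ess_max_points phi y ->
         (0 < y -> (0 < lower_left_derivative phi y)%E) /\
         (y < 1 -> (upper_right_derivative phi y < 0)%E)) ->
      comp_bounded lam phi,
      (* (ii) *)
      (forall y, ess_max_points phi y ->
         (0 < y -> lower_left_derivative phi y = +oo%E) /\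
         (y < 1 -> upper_right_derivative phi y = -oo%E)) ->
      exists2 T : {linear muntz lam -> L2 (@mu01 R)},
        is_comp_op phi T & compact_op T &
      (* (iii) *)
      (exists (eps beta c : R), [/\ 0 < eps, 1 < beta &
         forall y x, ess_max_points phi y -> I01 x -> `|x - y| < eps ->
           `|x - y| <= c * `|phi x - 1| `^ beta]) ->
      exists2 T : {linear muntz lam -> L2 (@mu01 R)},
        is_comp_op phi T & forall q : R, 0 < q -> schatten q T].
Proof.
have [t t01 lam_lac] := lacunary_shift Hlam Hlac.
have lam_ge0 n : 0 <= lam n by case: Hlam.
split.
- move=> slopes.
  have peak y : ess_max_points phi y -> exists2 c, 0 < c & peak_at phi 1 c y.
    move=> My; have [Hl Hr] := slopes y My.
    have [ml ml0 Hml] : exists2 m, 0 < m & 0 < y -> (m%:E < lower_left_derivative phi y)%E.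
      have [/Hl/ereal_gt0_real[m m0 H]|_] := boolP (0 < y); first by exists m.
      by exists 1.
    have [mr mr0 Hmr] : exists2 m, 0 < m & y < 1 ->
        (upper_right_derivative phi y < (- m)%:E)%E.
      have [/Hr|_] := boolP (y < 1); last by exists 1.
      rewrite -oppe_gt0 => /ereal_gt0_real[m m0 H]; exists m => // _.
      by rewrite EFinN lteNr.
    pose m := Num.min ml mr; have m0 : 0 < m by rewrite lt_min ml0.
    exists m^-1; first by rewrite invr_gt0.
    apply: slope_peak => //; first exact: phi_max.
      by move=> /Hml; apply: le_lt_trans; rewrite lee_fin ge_min lexx.
    move=> /Hmr /lt_le_trans; apply.
    by rewrite lee_fin lerN2 ge_min lexx orbT.
  have [C C0 mC] := moment_power_decay phi01 phi_borel phi_sup phi_fin (lexx _) peak.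
  apply: (composition_bounded lam_ge0 t01 lam_lac phi01 phi_borel (kappa := fun=> C)) => //.
  move=> _ j k _ _; have s0 : 0 <= lam j + lam k by rewrite addr_ge0.
  by have := mC _ s0; rewrite powRr1 ?addr_ge0.
- move=> slopes.
  have peak y c : ess_max_points phi y -> 0 < c -> peak_at phi 1 c y.
    move=> My c0; have [Hl Hr] := slopes y My; rewrite -[c]invrK.
    apply: slope_peak; rewrite ?invr_gt0//; first exact: phi_max.
      by move=> /Hl ->; exact: ltry.
    by move=> /Hr ->; exact: ltNyr.
  have [C C0 mC] := moment_power_decay phi01 phi_borel phi_sup phi_fin (lexx _)
    (fun y My => ex_intro2 _ _ 1 ltr01 (peak y 1 My ltr01)).
  have little := moment_little_o phi01 phi_borel phi_sup phi_fin peak.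
  (* kappa_m is the supremum of the ratios of the moments for s >= lam m *)
  pose A m := [set moment phi s * (s + 1) | s in [set s | lam m <= s]].
  have supA m : has_sup (A m).
    split; first by exists (moment phi (lam m) * (lam m + 1)), (lam m) => /=.
    exists C => _ [s /= ms <-].
    have s0 : 0 <= s by exact: le_trans (lam_ge0 m) ms.
    by have := mC s s0; rewrite powRr1 ?addr_ge0.
  have A_ge0 m s : lam m <= s -> 0 <= moment phi s * (s + 1).
    by move=> ms; rewrite mulr_ge0 ?moment_ge0// addr_ge0// (le_trans (lam_ge0 m)).
  have lam_mono m j : (m <= j)%N -> lam m <= lam j.
    move=> /subnK <-; elim: (j - m)%N => // n IH; apply: (le_trans IH).
    by rewrite addSn ltW//; case: Hlam.
  apply: (compact_of_moments lam_ge0 t01 lam_lac phi01 phi_borel (kappa := fun m => sup (A m))).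
  + move=> m; apply: (le_trans (A_ge0 m (lam m) (lexx _))).
    by apply: (ub_le_sup (supA m).2); exists (lam m) => /=.
  + move=> m j k mj mk; apply: (ub_le_sup (supA m).2); exists (lam j + lam k) => //=.
    by rewrite (le_trans (lam_mono _ _ mj))// lerDl.
  + move=> e e0; have [S HS] := little e e0.
    have [N HN] := exponents_unbounded lam_ge0 t01 lam_lac (S + 2^-1).
    exists N => m Nm; apply: ge_sup; first by case: (supA m).
    move=> _ [s /= ms <-]; apply: HS; apply: le_trans ms.
    by have := HN m Nm; rewrite lerD2r.
- move=> [eps [beta [c [eps0 b1 H]]]].
  have peak y : ess_max_points phi y -> exists2 c, 0 < c & peak_at phi beta c y.
    move=> My; exists (Num.max c 1); first by rewrite lt_max ltr01 orbT.
    exists eps => // x Ix xy; apply: (le_trans (H y x My Ix xy)).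
    by rewrite ler_wpM2r ?powR_ge0// le_max lexx.
  have [C C0 mC] := moment_power_decay phi01 phi_borel phi_sup phi_fin (ltW b1) peak.
  exact: (schatten_of_moments lam_ge0 t01 lam_lac phi01 phi_borel b1 C0 mC).
Qed.
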